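(* Let $(X_t,t\ge 0)$ be a CBI$(\Psi,\Phi)$ process and let $x>a\geq v$, where $v=b/\mathbf d$. For every $\lambda>0$ and $\mu\geq0$, $$\mathbb{E}_{x}\Big[\exp\Big\{-\lambda \sigma_{a}-\mu\int_0^{\sigma_a}X_t \,\mathrm dt\Big\}\Big]=\frac{\displaystyle\int_{q(\mu)}^{\infty}\frac{\mathrm dz}{\Psi(z)-\mu}\exp\left(-xz+\int_{\theta}^{z}\frac{\Phi(u)+\lambda}{\Psi(u)-\mu}\,\mathrm du\right)}{\displaystyle\int_{q(\mu)}^{\infty}\frac{\mathrm dz}{\Psi(z)-\mu}\exp\left(-az+\int_{\theta}^{z}\frac{\Phi(u)+\lambda}{\Psi(u)-\mu}\,\mathrm du\right)},$$ where $q(\mu):=\sup\{q\geq0: \Psi(q)=\mu\}$ and $\theta$ is an arbitrary constant larger than $q(\mu)$.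
   Context: Mechanisms: $\Psi(q)=\gamma q+\frac{1}{2}\sigma^{2}q^{2}+\int_{0}^{\infty}(e^{-qu}-1+qu\mathbf 1_{\{u\in (0,1)\}})\pi(\mathrm du)$ and $\Phi(q)=bq+\int_{0}^{\infty}(1-e^{-qu})\nu(\mathrm du)$ for $q\ge 0$, where $\sigma,b\ge 0$, $\gamma\in\mathbb R$, and $\pi,\nu$ are measures on $(0,\infty)$ with $\int_0^\infty(1\wedge u^2)\pi(\mathrm du)<\infty$ and $\int_0^\infty(1\wedge u)\nu(\mathrm du)<\infty$. A CBI$(\Psi,\Phi)$ process (continuous-state branching process with immigration) is the càdlàg Feller process $(X_t,t\ge0)$ with values in $\mathbb R_+=[0,\infty)$ (in case of explosion, $\infty$ is added as an absorbing state) such that for $q>0$, $x\ge 0$, $\mathbb{E}_{x}[e^{-qX_{t}}]=\exp\left(-xv_{t}(q)-\int_{0}^{t}\Phi(v_{s}(q))\,\mathrm ds\right)$, where $\frac{\partial v_t(q)}{\partial t}=-\Psi(v_t(q))$, $v_0(q)=q$. $\mathbb P_x$ is the law of the process started at $x$ and $\mathbb E_x$ its expectation. Standing assumptions: at least one of $\sigma\neq 0$, $\pi\not\equiv0$, $\nu\not\equiv 0$ holds, and there exists $q\ge0$ with $\Psi(q)>0$. The effective drift is $\mathbf d:=\gamma+\int_{(0,1)}z\,\pi(\mathrm dz)$ in the bounded variation case ($\sigma=0$ and $\int_{(0,1)}z\,\pi(\mathrm dz)<\infty$) and $\mathbf d:=+\infty$ otherwise (unbounded variation case); under the assumption, $\mathbf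 d\in(0,\infty]$. Set $v:=b/\mathbf d$. $\sigma_a:=\inf\{t>0: X_t=a\}$ (with $\inf\emptyset=\infty$). Conventions: $C/\infty=0$ for finite real $C$ (so the ratio is $0$ if the denominator is infinite), and $e^{-\infty}=0$. *)

(* Defs.v *)
From HB Require Import structures.
From mathcomp Require Export all_boot all_order all_algebra.
From mathcomp Require Export all_classical all_reals all_analysis.
From mathcomp Require Export measurable_realfun.

Set Implicit Arguments.
Unset Strict Implicit.
Unset Printing Implicit Defensive.

Import Order.TTheory GRing.Theory Num.Theory.
Import numFieldNormedType.Exports.

Local Open Scope classical_set_scope.
Local Open Scope ring_scope.

Section Mechanisms.
Context {R : realType}.
Implicit Types (pi nu : {measure set R -> \bar R}) (psi : R -> R).

(* A measure on (0, oo) is a Borel measure on R that does not charge ]-oo, 0].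
   The order is p = 2 for the branching and p = 1 for the immigration
   mechanism. *)
Definition levy_measure (p : nat) (m : {measure set R -> \bar R}) : Prop :=
  m `]-oo, 0]%classic = 0%E /\
  (\int[m]_(u in `]0%R, +oo[) (Num.min 1 (u ^+ p))%:E < +oo)%E.

Definition branching_mechanism (gamma sigma : R) pi (q : R) : R :=
  gamma * q + 2^-1 * sigma ^+ 2 * q ^+ 2 +
  \int[pi]_(u in `]0, +oo[)
    (expR (- (q * u)) - 1 + q * u * \1_(`]0, 1[%classic) u).

Definition immigration_mechanism (b : R) nu (q : R) : R :=
  b * q + \int[nu]_(u in `]0, +oo[) (1 - expR (- (q * u))).

Definition effective_drift (gamma sigma : R) pi : \bar R :=
  let m := (\int[pi]_(z in `]0%R, 1%R[) z%:E)%E in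
  if (sigma == 0) && (m < +oo)%E then (gamma%:E + m)%E else +oo%E.

Definition largest_root psi (mu : R) : R :=
  sup [set q | 0 <= q /\ psi q = mu].

End Mechanisms.

Section Processes.
Context {R : realType} {d : measure_display} {T : measurableType d}.
(* X is only meaningful at times t >= 0; Pr y, the law of the process started
   at y, is only meaningful for y in [0, +oo]. *)
Implicit Types (X : R -> T -> \bar R) (Pr : \bar R -> probability T R).
Implicit Types (psi phi : R -> R) (v : R -> R -> R).

Definition cadlag_path (x : R -> \bar R) : Prop :=
  (forall t : R, 0 <= t -> x u @[u --> t^'+] --> x t) /\
  (forall t : R, 0 < t -> exists l : \bar R, x u @[u --> t^'-] --> l).

Definition natural_filtration X (s : R) : set (set T) :=
  <<s [set A | exists (u : R) (B : set (\bar R)),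
         [/\ 0 <= u <= s, measurable B & A = X u @^-1` B]] >>.

Record markov_process Pr X : Prop := MarkovProcess {
  markov_measurable : forall t : R, 0 <= t -> measurable_fun [set: T] (X t) ;
  markov_start : forall y : \bar R, (0 <= y)%E ->
    Pr y (X 0 @^-1` [set y]) = 1%E ;
  markov_kernel : forall (t : R) (B : set (\bar R)), 0 <= t -> measurable B ->
    measurable_fun [set y : \bar R | (0 <= y)%E]
      (fun y => Pr y (X t @^-1` B)) ;
  markov_property : forall (y : \bar R) (s t : R) (A : set T) (B : set (\bar R)),
    (0 <= y)%E -> 0 <= s -> 0 <= t ->
    natural_filtration X s A -> measurable B ->
    Pr y (A `&` X (s + t) @^-1` B) =
      (\int[Pr y]_(w in A) Pr (X s w) (X t @^-1` B))%E }.

(* C_0([0, oo[): continuous functions vanishing at infinity, extended by 0 to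
   the cemetery state +oo. *)
Definition C0 (f : \bar R -> R) : Prop :=
  {within [set y : \bar R | (0 <= y)%E], continuous f} /\ f +oo%E = 0.

Definition semigroup Pr X (t : R) (f : \bar R -> R) (y : \bar R) : R :=
  \int[Pr y]_w f (X t w).

Definition feller Pr X : Prop := forall f, C0 f ->
  (forall t : R, 0 <= t -> C0 (semigroup Pr X t f)) /\
  (forall e : R, 0 < e -> \forall t \near 0^'+,
     forall y : \bar R, (0 <= y)%E -> `|semigroup Pr X t f y - f y| <= e).

Record cadlag_feller_process Pr X : Prop := CadlagFellerProcess {
  cfp_ge0 : forall (t : R) w, 0 <= t -> (0 <= X t w)%E ;
  cfp_cadlag : forall w, cadlag_path (fun t => X t w) ;
  cfp_absorbing : forall (s t : R) w, 0 <= s <= t ->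
    X s w = +oo%E -> X t w = +oo%E ;
  cfp_markov : markov_process Pr X ;
  cfp_feller : feller Pr X }.

(* v t q is v_t(q); it stays in [0, oo[, the domain of psi. *)
Definition cumulant_flow psi v : Prop := forall q : R, 0 < q ->
  [/\ v 0 q = q,
      forall t : R, 0 <= t -> 0 <= v t q,
      {within [set t : R | 0 <= t], continuous (fun t => v t q)} &
      forall t : R, 0 < t -> is_derive t 1 (fun s => v s q) (- psi (v t q))].

Definition CBI_process psi phi Pr X : Prop :=
  cadlag_feller_process Pr X /\
  exists2 v, cumulant_flow psi v &
    forall q x t : R, 0 < q -> 0 <= x -> 0 <= t ->
      (\int[Pr x%:E]_w expeR (- (q%:E * X t w)))%E =
      (expR (- (x * v t q) -
        \int[lebesgue_measure]_(s in `[0, t]) phi (v s q)))%:E.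

Definition hitting_time X (a : R) (w : T) : \bar R :=
  ereal_inf [set t%:E | t in [set t : R | 0 < t /\ X t w = a%:E]].

Definition area_before_hitting X (a : R) (w : T) : \bar R :=
  (\int[lebesgue_measure]_(t in
     [set t : R | (0 <= t)%R /\ (t%:E < hitting_time X a w)%E]) X t w)%E.

End Processes.

Definition oriented_integral {R : realType} (a b : R) (f : R -> R) : R :=
  if a <= b then \int[lebesgue_measure]_(u in `[a, b]) f u
  else - \int[lebesgue_measure]_(u in `[b, a]) f u.

Definition hitting_integral {R : realType} (psi phi : R -> R)
    (lambda mu theta x : R) : \bar R :=
  (\int[lebesgue_measure]_(z in `]largest_root psi mu, +oo[)
    ((psi z - mu)^-1 *
     expR (- (x * z) +
       oriented_integral theta z
         (fun u => (phi u + lambda) / (psi u - mu))))%R%:E)%E.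

(* Main.v *)
(* The Markov property on the grid h N, together with the expansion of the
   Laplace exponent over one step, yields for every discretised stopping time a
   Dynkin identity for [exp (- z X)] discounted by lambda and by mu times the
   area.  Read as a differential equation in z, solved by the integrating
   factor exp (int_theta^z (Phi + lambda) / (Psi - mu)), it determines, as
   h -> 0, the transform of the passage time below a level a' in (v, x):
   the process has no negative jumps, so that it is at a' at that time and the
   occupation terms vanish at both ends of ]q(mu), oo[.  Letting a' decrease to
   a covers a = v, where the denominator may be infinite: the passage times
   increase to a time at which, by quasi-left-continuity, the process is at a,
   that is, to the hitting time of a. *)
Require Import Defs.
From mathcomp Require Import ring lra.

Set Implicit Arguments.
Unset Strict Implicit.
Unset Printing Implicit Defensive.

Import Order.TTheory GRing.Theory Num.Theory.
Import numFieldNormedType.Exports.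

Local Open Scope classical_set_scope.
Local Open Scope ring_scope.

(** * Branching and immigration mechanisms *)

Section Elementary.
Context {R : realType}.
Implicit Types s t x y z : R.

(** All that is known of [X] is its Laplace transform at fixed times and the Markov property, so the
    path properties named above are extracted from the Dynkin identity itself. Absence of undershoot
    is a comparison of growth rates: multiplied by exp (z a), the identity bounds the discounted
    mean of exp (z (a - X)) at the passage by O(z^2), because Psi is at most quadratic, while exp
    dominates a cube. Quasi-left-continuity holds because the discounted Laplace transform changes,
    between two ordered times, by at most a constant times the loss of discount; two exponents then
    give a vanishing variance. Passage strictly below a level is an open condition, so that it can
    be detected at rational times. The area is computed with the state capped at K: this makes the
    integrand bounded, hence its Riemann sums convergent, and costs an error exponentially small in
    K. The strict inequality a' > v makes (Phi + lambda) / (Psi - mu) eventually at most some c <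
    a', so that the integral at a' is finite and the boundary term at infinity vanishes. *)

Lemma expRN_remainder1 s : 0 <= s -> 0 <= 1 - expR (- s) <= s.
Proof.
move=> s0; have := expR_ge1Dx (- s); have : expR (- s) <= 1.
  by rewrite expR_le1 oppr_le0.
lra.
Qed.

Lemma expRN_remainder2 s : 0 <= s -> 0 <= expR (- s) - 1 + s <= s ^+ 2.
Proof.
move=> s0; have h1 := expR_ge1Dx (- s); have h2 := expR_ge1Dx s.
have e0 := expR_gt0 (- s).
have : expR s * expR (- s) = 1 by rewrite expRxMexpNx_1.
move: (expR s) (expR (- s)) h1 h2 e0 => a b h1 h2 e0 ab.
have h : (1 + s) * b <= 1 by rewrite -[leRHS]ab ler_pM2r.
apply/andP; split; first by lra.
have : (1 + s) * (b - 1 + s) <= s ^+ 2 by nra.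
nra.
Qed.

(** The exponential factor, paid for negative [x], is affordable: [x] will be at most a small
    multiple of the state, up to a constant, and half of the Laplace weight absorbs it. *)
Lemma expRN_remainder2_abs x :
  `|expR (- x) - 1 + x| <= x ^+ 2 * expR `|x|.
Proof.
have [x0|x0] := leP 0 x.
  have /andP[h1 h2] := expRN_remainder2 x0.
  rewrite ger0_norm//; apply: (le_trans h2).
  by rewrite ler_peMr ?sqr_ge0//; have := expR_ge1Dx `|x|; have := normr_ge0 x; lra.
have [y y0 ->] : exists2 y : R, 0 < y & x = - y by exists (- x); lra.
rewrite opprK normrN (gtr0_norm y0) sqrrN.
have h1 := expR_ge1Dx (- y); have h2 := expR_ge1Dx y.
have e0 := expR_gt0 y.
have : expR y * expR (- y) = 1 by rewrite expRxMexpNx_1.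
move: (expR y) (expR (- y)) h1 h2 e0 => a b h1 h2 e0 ab.
have h : a * (1 - y) <= 1 by rewrite -[leRHS]ab ler_pM2l.
rewrite ger0_norm; last by lra.
have : y * (a - 1) <= y * (y * a) by rewrite ler_pM2l//; lra.
nra.
Qed.

Lemma mul_expRN_le z y : 0 < z -> y * expR (- (z * y)) <= z^-1.
Proof.
move=> z0; have := expR_ge1Dx (z * y).
have e0 := expR_gt0 (z * y).
rewrite expRN => h; have -> : y / expR (z * y) = z^-1 * (z * y / expR (z * y)).
  by rewrite !mulrA mulVf ?mul1r// gt_eqF.
rewrite ler_piMr ?invr_ge0 ?(ltW z0)// ler_pdivrMr// mul1r; lra.
Qed.

(** The left side is the square of (1 + y) exp (- z y / 2), to which [mul_expRN_le] applies with
    rate z / 2; hence the term 2 / z. *)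
Lemma sqr_expRN_le z y : 0 < z -> 0 <= y ->
  (1 + y) ^+ 2 * expR (- (z * y)) <= (1 + 2 / z) ^+ 2.
Proof.
move=> z0 y0.
have z20 : 0 < z / 2 by rewrite divr_gt0.
have h1 := mul_expRN_le y z20; rewrite invf_div in h1.
have h2 : expR (- (z / 2 * y)) <= 1.
  by rewrite expR_le1 oppr_le0 mulr_ge0// ltW.
have e0 := expR_ge0 (- (z / 2 * y)).
have -> : - (z * y) = - (z / 2 * y) - z / 2 * y by field.
rewrite expRD.
move: (expR _) h1 h2 e0 => e h1 h2 e0.
have -> : (1 + y) ^+ 2 * (e * e) = (e + y * e) ^+ 2 by ring.
rewrite ler_pXn2r// ?nnegrE; nra.
Qed.

Lemma expRN_diff_le x y z0 (u : R) : 0 < z0 -> z0 <= x -> z0 <= y -> 0 < u ->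
  `|expR (- (x * u)) - expR (- (y * u))| <= `|x - y| * (u * expR (- (z0 * u))).
Proof.
move=> z00.
wlog xy : x y / y <= x.
  move=> wl zx zy u0; have [|/ltW] := leP y x; first by move/wl; exact.
  by move/wl => /(_ zy zx u0); rewrite distrC (distrC x).
move=> zx zy u0.
have xy0 : 0 <= (x - y) * u by rewrite mulr_ge0 ?subr_ge0// ltW.
have /andP[h1 h2] := expRN_remainder1 xy0.
have -> : - (x * u) = - (y * u) - (x - y) * u by ring.
rewrite expRD distrC -[X in `|X - _|]mulr1 -mulrBr normrM.
rewrite (ger0_norm (expR_ge0 _)) (ger0_norm h1) (ger0_norm (_ : 0 <= x - y)) ?subr_ge0//.
have h3 : expR (- (y * u)) <= expR (- (z0 * u)).
  by rewrite ler_expR lerN2 ler_pM2r.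
apply: (@le_trans _ _ (expR (- (z0 * u)) * ((x - y) * u))).
  by rewrite ler_pM ?expR_ge0.
by rewrite le_eqVlt; apply/orP; left; apply/eqP; ring.
Qed.

(** Both endpoints are compared with the tangent at the barycentre [m]; the linear terms cancel in
    the average. *)
Lemma expR_convex x y t : 0 <= t <= 1 ->
  expR (t * x + (1 - t) * y) <= t * expR x + (1 - t) * expR y.
Proof.
move=> /andP[t0 t1]; set m := _ + _ * y.
have H z : expR m * (1 + (z - m)) <= expR z.
  rewrite [z in leRHS](_ : z = m + (z - m)); last by rewrite addrC subrK.
  by rewrite [in leRHS]expRD ler_pM2l ?expR_gt0// expR_ge1Dx.
rewrite -[leLHS](_ : t * (expR m * (1 + (x - m))) + (1 - t) * (expR m * (1 + (y - m))) = _).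
  by apply: lerD; rewrite ler_wpM2l// subr_ge0.
by rewrite /m; ring.
Qed.

End Elementary.

Lemma integrable_EFinZl d (T : measurableType d) (R : realType)
    (m : {measure set T -> \bar R}) (D : set T) (f : T -> R) (k : R) :
  measurable D -> m.-integrable D (EFin \o f) ->
  m.-integrable D (EFin \o (fun t => k * f t)).
Proof. by move=> mD; exact: integrableZl. Qed.

Section LevyIntegrals.
Context {R : realType}.
Variables (p : nat) (m : {measure set R -> \bar R}).
Hypothesis hm : levy_measure p m.
Local Notation D := (`]0%R, +oo[%classic : set R).
Local Notation w := (fun u : R => Num.min 1 (u ^+ p)).

Lemma measurable_levy_weight : measurable_fun D w.
Proof. by apply: measurable_minr => //; exact: measurable_funX. Qed.

Lemma levy_weight_ge0 (u : R) : 0 <= u -> 0 <= w u.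
Proof. by move=> u0; rewrite le_min ler01 exprn_ge0. Qed.

Lemma integrable_levy_weight : m.-integrable D (EFin \o w).
Proof.
apply/integrableP; split.
  by apply/measurable_EFinP; exact: measurable_levy_weight.
apply: le_lt_trans hm.2; rewrite le_eqVlt; apply/orP; left; apply/eqP.
apply: eq_integral => u; rewrite inE /= in_itv /= andbT => u0.
by rewrite ger0_norm// levy_weight_ge0 // ltW.
Qed.

Lemma integrable_levy (g : R -> R) C : measurable_fun D g ->
  (forall u : R, 0 < u -> `|g u| <= C * w u) -> m.-integrable D (EFin \o g).
Proof.
move=> mg gC.
have ic : m.-integrable D (EFin \o (fun u => C * w u)).
  exact: integrable_EFinZl integrable_levy_weight.
apply: le_integrable ic => //; first exact/measurable_EFinP.
move=> u; rewrite /= in_itv /= andbT => u0; rewrite lee_fin.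
exact: (le_trans (gC _ u0) (ler_norm _)).
Qed.

Lemma Rintegral_levy_le (g : R -> R) C : measurable_fun D g ->
  (forall u : R, 0 < u -> `|g u| <= C * w u) ->
  `|\int[m]_(u in D) g u| <= C * \int[m]_(u in D) w u.
Proof.
move=> mg gC; have ig := integrable_levy mg gC.
have iw := integrable_levy_weight.
apply: (le_trans (le_normr_Rintegral _ ig)) => //.
rewrite -RintegralZl//; apply: le_Rintegral => //.
- exact: integrable_norm.
- exact: integrable_EFinZl.
- by move=> u; rewrite /= in_itv /= andbT; exact: gC.
Qed.

End LevyIntegrals.

(** A subordinator exponent without drift is o(q): (1 - exp (- q u)) / q tends to 0 and is dominated
    by min (1, u) for q >= 1. The quotient does not increase with q, so convergence along the
    integers suffices. *)
Lemma levy_linear_part_cvg0 (R : realType) (m : {measure set R -> \bar R}) (e : R) :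
  levy_measure 1 m -> 0 < e ->
  exists M, forall q, M <= q -> \int[m]_(u in `]0, +oo[) (1 - expR (- (q * u))) <= e * q.
Proof.
move=> hm e0; pose D : set R := `]0%R, +oo[%classic.
have mD : measurable D by exact: measurable_itv.
pose f (q u : R) : R := 1 - expR (- (q * u)).
have mf (q : R) : measurable_fun D (f q).
  apply: measurable_funB => //; apply: measurableT_comp => //.
  by apply: measurableT_comp => //; exact: measurable_funM.
have f01 (q u : R) : 0 <= q -> 0 < u -> 0 <= f q u <= q * u /\ f q u <= 1.
  move=> q0 u0; have qu0 : 0 <= q * u by rewrite mulr_ge0// ltW.
  have /andP[h1 h2] := expRN_remainder1 qu0; have := expR_ge0 (- (q * u)).
  by rewrite /f; lra.
have fb (q : R) : 0 < q -> forall u : R, 0 < u -> `|f q u| <= (1 + q) * Num.min 1 (u ^+ 1).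
  move=> q0 u u0; have [/andP[h1 h2] h3] := f01 _ _ (ltW q0) u0.
  by rewrite expr1 ger0_norm//; have [u1|u1] := ltP 1 u; nra.
have fi (q : R) : 0 < q -> m.-integrable D (EFin \o f q).
  by move=> q0; apply: (integrable_levy hm (mf q) (fb q q0)).
pose h (n : nat) (u : R) : R := n.+1%:R^-1 * f n.+1%:R u.
have n0 n : 0 < n.+1%:R :> R by rewrite ltr0n.
have cvgh : (\int[m]_(u in D) (EFin \o h n) u)%E @[n --> \oo] --> (\int[m]_(u in D) (cst 0) u)%E.
  apply: (@dominated_cvg _ _ _ _ _ mD _ _ (EFin \o (fun u : R => Num.min 1 (u ^+ 1)))).
  - by move=> n; apply/measurable_EFinP; exact: measurable_funM.
  - move=> u; rewrite /D /= in_itv /= andbT => u0; apply: cvg_EFin; first exact: nearW.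
    have h0 := @cvg_harmonic R.
    apply: (squeeze_cvgr _ (@cvg_cst _ _ _ _ _) h0).
    apply: nearW => n; have [/andP[h1 h2] h3] := f01 _ _ (ltW (n0 n)) u0.
    by rewrite /= /h mulr_ge0 ?invr_ge0//= ler_piMr// invr_ge0.
  - by [].
  - exact: integrable_levy_weight hm.
  - move=> n u; rewrite /D /= in_itv /= andbT => u0; rewrite lee_fin expr1.
    have [/andP[h1 h2] h3] := f01 _ _ (ltW (n0 n)) u0.
    rewrite ger0_norm; last by rewrite mulr_ge0// invr_ge0.
    rewrite le_min /h !ler_pdivrMl// h2 andbT mulr1 (le_trans h3)//.
    by rewrite ler1n.
move: cvgh; rewrite (integral_cst m mD) mul0e => /fine_cvgP[_ /cvgr_lt /(_ e e0)].
case=> n _ /(_ n (leqnn n)) /= hn; exists n.+1%:R => q nq.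
have q0 : 0 < q := lt_le_trans (n0 n) nq.
rewrite mulrC -ler_pdivrMl//; apply: ltW; apply: le_lt_trans hn.
rewrite -RintegralZl//; last exact: fi.
apply: le_Rintegral => //.
- by apply: integrable_EFinZl => //; exact: fi.
- by apply: integrable_EFinZl => //; exact: fi.
move=> u; rewrite /D /= in_itv /= andbT => u0.
rewrite /h ler_pdivrMl// mulrCA ler_pdivlMl// /f.
(* Convexity of exp at the point n.+1 = t q + (1 - t) 0 shows that (1 - exp (- q u)) / q does not
   increase from n.+1 to q. *)
have t01 : 0 <= n.+1%:R / q <= 1 by rewrite divr_ge0 ?(ltW q0)//= ler_pdivrMr// mul1r.
have := expR_convex (- (q * u)) 0 t01; rewrite mulr0 addr0 expR0 mulr1.
have -> : n.+1%:R / q * - (q * u) = - (n.+1%:R * u) by field; rewrite gt_eqF.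
move: (expR _) (expR _) => c a hac.
have h1 : a * q <= n.+1%:R * c + (1 - n.+1%:R / q) * q.
  have -> : n.+1%:R * c + (1 - n.+1%:R / q) * q = (n.+1%:R / q * c + (1 - n.+1%:R / q)) * q.
    by field; rewrite gt_eqF.
  by rewrite ler_pM2r.
have h2 : (1 - n.+1%:R / q) * q = q - n.+1%:R by field; rewrite gt_eqF.
lra.
Qed.

(** * Regularity and growth of Psi and Phi *)

Section Mechanisms_analysis.
Context {R : realType}.
Variables (gamma sigma b : R) (pi nu : {measure set R -> \bar R}).
Hypotheses (hpi : levy_measure 2 pi) (hnu : levy_measure 1 nu).
Hypothesis (hb : 0 <= b).
Local Notation psi := (branching_mechanism gamma sigma pi).
Local Notation phi := (immigration_mechanism b nu).
Local Notation D := (`]0%R, +oo[%classic : set R).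
Let g (q u : R) : R := expR (- (q * u)) - 1 + q * u * \1_(`]0, 1[%classic) u.
Let f (q u : R) : R := 1 - expR (- (q * u)).

Let g_lt1 (q u : R) : 0 < u -> u < 1 -> g q u = expR (- (q * u)) - 1 + q * u.
Proof. by move=> u0 u1; rewrite /g indicE mem_set ?mulr1//= in_itv /= u0 u1. Qed.

Let g_ge1 (q u : R) : 1 <= u -> g q u = expR (- (q * u)) - 1.
Proof.
move=> u1; rewrite /g indicE memNset ?mulr0 ?addr0//= in_itv /= => /andP[_].
by rewrite ltNge u1.
Qed.

Let measurable_g q : measurable_fun D (g q).
Proof.
apply: measurable_funD.
  apply: measurable_funB => //; apply: measurableT_comp => //.
  by apply: measurableT_comp => //; exact: measurable_funM.
by apply: measurable_funM => //; exact: measurable_funM.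
Qed.

Let measurable_f q : measurable_fun D (f q).
Proof.
apply: measurable_funB => //; apply: measurableT_comp => //.
by apply: measurableT_comp => //; exact: measurable_funM.
Qed.

Let w2_lt1 (u : R) : 0 < u -> u < 1 -> Num.min 1 (u ^+ 2) = u ^+ 2.
Proof. by move=> u0 u1; apply/min_idPr; rewrite expr_le1// ltW. Qed.
Let w2_ge1 (u : R) : 1 <= u -> Num.min 1 (u ^+ 2) = 1.
Proof. by move=> u1; apply/min_idPl; rewrite expr_ge1// (le_trans ler01). Qed.

Let g_bound (q : R) : 0 <= q -> forall u : R, 0 < u ->
  `|g q u| <= (1 + q ^+ 2) * Num.min 1 (u ^+ 2).
Proof.
move=> q0 u u0; have qu0 : 0 <= q * u by rewrite mulr_ge0// ltW.
have [u1|u1] := ltP u 1.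
  rewrite g_lt1// w2_lt1//; have /andP[h1 h2] := expRN_remainder2 qu0.
  rewrite ger0_norm//; apply: (le_trans h2); rewrite exprMn.
  by rewrite ler_wpM2r ?sqr_ge0// lerDr.
rewrite g_ge1// w2_ge1// mulr1 distrC; have /andP[h1 h2] := expRN_remainder1 qu0.
rewrite ger0_norm//; have := expR_ge0 (- (q * u)); have := sqr_ge0 q; lra.
Qed.

Let f_bound (q : R) : 0 <= q -> forall u : R, 0 < u ->
  `|f q u| <= (1 + q) * Num.min 1 (u ^+ 1).
Proof.
move=> q0 u u0; have qu0 : 0 <= q * u by rewrite mulr_ge0// ltW.
have e0 := expR_ge0 (- (q * u)).
have /andP[h1 h2] := expRN_remainder1 qu0.
rewrite /f expr1 ger0_norm//; have [u1|u1] := ltP 1 u; nra.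
Qed.

(** For u < 1 the compensator leaves a difference of second order, split into exp (- y u) (exp (- (x
    - y) u) - 1 + (x - y) u) and (x - y) u (1 - exp (- y u)). For u >= 1 the bound u exp (- z0 u) <=
    1 / z0 is where z0 > 0 enters. *)
Let g_lip (z0 z1 x y : R) : 0 < z0 -> z0 <= x <= z1 -> z0 <= y <= z1 ->
  forall u : R, 0 < u ->
  `|g x u - g y u| <= (`|x - y| * (z1 + z0^-1)) * Num.min 1 (u ^+ 2).
Proof.
move=> z00; wlog xy : x y / y <= x.
  move=> wl zx zy u u0; have [|/ltW] := leP y x; first by move/wl; exact.
  by move/wl => /(_ zy zx u u0); rewrite distrC (distrC x).
move=> /andP[zx xz] /andP[zy yz] u u0.
have zi0 : 0 < z0^-1 by rewrite invr_gt0.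
have [u1|u1] := ltP u 1.
  rewrite !g_lt1// w2_lt1//.
  have s0 : 0 <= (x - y) * u by rewrite mulr_ge0 ?subr_ge0// ltW.
  have yu0 : 0 <= y * u by rewrite mulr_ge0 ?ltW// (lt_le_trans z00).
  have /andP[h1 h2] := expRN_remainder2 s0.
  have /andP[h3 h4] := expRN_remainder1 yu0.
  have e0 := expR_ge0 (- (y * u)).
  have -> : expR (- (x * u)) = expR (- (y * u)) * expR (- ((x - y) * u)).
    by rewrite -expRD; congr expR; ring.
  rewrite (ger0_norm (_ : 0 <= x - y)) ?subr_ge0//.
  move: (expR (- (y * u))) (expR (- ((x - y) * u))) h1 h2 h3 h4 e0 => c e h1 h2 h3 h4 e0.
  have -> : c * e - 1 + x * u - (c - 1 + y * u) =
    c * (e - 1 + (x - y) * u) + (x - y) * u * (1 - c) by ring.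
  rewrite ger0_norm; last by rewrite addr_ge0// mulr_ge0.
  apply: (@le_trans _ _ (((x - y) * u) ^+ 2 + (x - y) * u * (y * u))).
    apply: lerD; last by rewrite ler_wpM2l.
    by apply: le_trans h2; rewrite ler_piMl//; lra.
  have -> : ((x - y) * u) ^+ 2 + (x - y) * u * (y * u) = (x - y) * x * u ^+ 2 by ring.
  rewrite ler_wpM2r ?sqr_ge0// ler_wpM2l ?subr_ge0//; lra.
rewrite !g_ge1// w2_ge1// mulr1 opprB addrA subrK.
have z0x : z0 <= x by [].
apply: (le_trans (expRN_diff_le z00 zx zy u0)).
rewrite ler_wpM2l//; have := mul_expRN_le u z00; lra.
Qed.

Let f_lip (z0 x y : R) : 0 < z0 -> z0 <= x -> z0 <= y -> forall u : R, 0 < u ->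
  `|f x u - f y u| <= (`|x - y| * (1 + z0^-1)) * Num.min 1 (u ^+ 1).
Proof.
move=> z00 zx zy u u0; rewrite /f.
have zi0 : 0 < z0^-1 by rewrite invr_gt0.
have := expRN_diff_le z00 zx zy u0; rewrite distrC => h.
rewrite [X in `|X|](_ : _ = expR (- (y * u)) - expR (- (x * u))); last by ring.
apply: (le_trans h); rewrite -mulrA ler_wpM2l//.
have h1 := mul_expRN_le u z00.
have h2 : expR (- (z0 * u)) <= 1 by rewrite expR_le1 oppr_le0 mulr_ge0// ltW.
have h3 := expR_ge0 (- (z0 * u)).
rewrite expr1; have [u1|u1] := ltP 1 u; nra.
Qed.

Let integrable_g (q : R) : 0 <= q -> pi.-integrable D (EFin \o g q).
Proof. by move=> q0; apply: (integrable_levy hpi (measurable_g q) (g_bound q0)). Qed.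
Let integrable_f (q : R) : 0 <= q -> nu.-integrable D (EFin \o f q).
Proof. by move=> q0; apply: (integrable_levy hnu (measurable_f q) (f_bound q0)). Qed.

Let psiE q : psi q = gamma * q + 2^-1 * sigma ^+ 2 * q ^+ 2 + \int[pi]_(u in D) g q u.
Proof. by []. Qed.
Let phiE q : phi q = b * q + \int[nu]_(u in D) f q u.
Proof. by []. Qed.

Lemma immigration_mechanism_ge0 (q : R) : 0 <= q -> 0 <= phi q.
Proof.
move=> q0; rewrite phiE addr_ge0 ?mulr_ge0//; apply: Rintegral_ge0 => u /=.
rewrite in_itv /= andbT => u0; rewrite /f.
by rewrite subr_ge0 expR_le1 oppr_le0 mulr_ge0// ltW.
Qed.

(** Stated away from 0, where Psi may have an infinite slope when the large jumps of [pi] have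
    infinite mean. *)
Lemma branching_mechanism_lipschitz (z0 z1 : R) : 0 < z0 ->
  exists2 C : R, 0 <= C & forall x y, z0 <= x <= z1 -> z0 <= y <= z1 ->
    `|psi x - psi y| <= C * `|x - y|.
Proof.
move=> z00; pose J := \int[pi]_(u in D) Num.min 1 (u ^+ 2).
have J0 : 0 <= J.
  by apply: Rintegral_ge0 => u /=; rewrite in_itv /= andbT => u0; rewrite levy_weight_ge0// ltW.
have [z10|z10] := ltP z1 z0.
  by exists 0 => // x y /andP[h1 h2]; lra.
have zi0 : 0 < z0^-1 by rewrite invr_gt0.
exists (`|gamma| + sigma ^+ 2 * z1 + (z1 + z0^-1) * J).
  by apply: addr_ge0; [apply: addr_ge0 => //|]; apply: mulr_ge0 => //; rewrite ?sqr_ge0//; lra.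
move=> x y hx hy; have [x0 y0] : 0 <= x /\ 0 <= y by lra.
rewrite !psiE.
have -> : gamma * x + 2^-1 * sigma ^+ 2 * x ^+ 2 + \int[pi]_(u in D) g x u -
  (gamma * y + 2^-1 * sigma ^+ 2 * y ^+ 2 + \int[pi]_(u in D) g y u) =
  gamma * (x - y) + sigma ^+ 2 * (2^-1 * (x + y)) * (x - y) +
  (\int[pi]_(u in D) g x u - \int[pi]_(u in D) g y u) by field.
rewrite -RintegralB//; [|exact: integrable_g|exact: integrable_g].
rewrite 2!mulrDl; apply: (le_trans (ler_normD _ _)); apply: lerD.
  apply: (le_trans (ler_normD _ _)); apply: lerD; first by rewrite normrM.
  rewrite normrM ler_wpM2r// ger0_norm; last by rewrite mulr_ge0 ?sqr_ge0//; lra.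
  by rewrite ler_wpM2l ?sqr_ge0//; lra.
have -> : (z1 + z0^-1) * J * `|x - y| = `|x - y| * (z1 + z0^-1) * J by ring.
apply: (Rintegral_levy_le hpi); last exact: g_lip.
exact: measurable_funB.
Qed.

Lemma immigration_mechanism_lipschitz (z0 : R) : 0 < z0 ->
  exists2 C : R, 0 <= C & forall x y, z0 <= x -> z0 <= y ->
    `|phi x - phi y| <= C * `|x - y|.
Proof.
move=> z00; pose J := \int[nu]_(u in D) Num.min 1 (u ^+ 1).
have J0 : 0 <= J.
  by apply: Rintegral_ge0 => u /=; rewrite in_itv /= andbT => u0; rewrite levy_weight_ge0// ltW.
have zi0 : 0 < z0^-1 by rewrite invr_gt0.
exists (b + (1 + z0^-1) * J).
  by rewrite !addr_ge0 ?mulr_ge0//; lra.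
move=> x y hx hy; have [x0 y0] : 0 <= x /\ 0 <= y by lra.
rewrite !phiE.
have E (s t : R) : b * x + s - (b * y + t) = b * (x - y) + (s - t) by ring.
rewrite E.
rewrite -RintegralB//; [|exact: integrable_f|exact: integrable_f].
rewrite mulrDl; apply: (le_trans (ler_normD _ _)); apply: lerD.
  by rewrite normrM ger0_norm.
have -> : (1 + z0^-1) * J * `|x - y| = `|x - y| * (1 + z0^-1) * J by ring.
apply: (Rintegral_levy_le hnu); last exact: f_lip.
exact: measurable_funB.
Qed.

(** This growth rate is what [no_undershoot] sets against a cubic lower bound of exp. *)
Lemma branching_mechanism_quadratic : exists2 C : R, 0 <= C &
  forall z, 1 <= z -> `|psi z| <= C * z ^+ 2.
Proof.
pose J := \int[pi]_(u in D) Num.min 1 (u ^+ 2).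
have J0 : 0 <= J.
  by apply: Rintegral_ge0 => u /=; rewrite in_itv /= andbT => u0; rewrite levy_weight_ge0// ltW.
exists (`|gamma| + 2^-1 * sigma ^+ 2 + 2 * J).
  have := sqr_ge0 sigma; have := normr_ge0 gamma; nra.
move=> z z1; have z0 : 0 <= z by lra.
rewrite psiE 2!mulrDl; apply: (le_trans (ler_normD _ _)); apply: lerD.
  apply: (le_trans (ler_normD _ _)); apply: lerD.
    by rewrite normrM ler_wpM2l// ger0_norm//; nra.
  by rewrite ger0_norm//; have := sqr_ge0 sigma; have := sqr_ge0 z; nra.
apply: (le_trans (Rintegral_levy_le hpi (measurable_g z) (g_bound z0))).
rewrite -/J; have : J * 1 <= J * z ^+ 2 by rewrite ler_wpM2l//; nra.
by rewrite mulrDl mul1r -mulrA; nra.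
Qed.

Lemma branching_mechanism_convex (x y t : R) : 0 <= x -> 0 <= y -> 0 <= t <= 1 ->
  psi (t * x + (1 - t) * y) <= t * psi x + (1 - t) * psi y.
Proof.
move=> x0 y0 t01; have t0 : 0 <= t by lra.
have s0 : 0 <= 1 - t by lra.
have h0 : 0 <= t * x + (1 - t) * y by rewrite addr_ge0 ?mulr_ge0.
have ix := integrable_g x0; have iy := integrable_g y0.
have itx : pi.-integrable D (EFin \o (fun u => t * g x u)).
  exact: integrable_EFinZl.
have ity : pi.-integrable D (EFin \o (fun u => (1 - t) * g y u)).
  exact: integrable_EFinZl.
have H : \int[pi]_(u in D) g (t * x + (1 - t) * y) u <=
   t * \int[pi]_(u in D) g x u + (1 - t) * \int[pi]_(u in D) g y u.
  rewrite -!RintegralZl// -RintegralD//; apply: le_Rintegral => //.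
  - exact: integrable_g.
  - exact: (integrableD _ itx ity).
  - move=> u _; rewrite /g.
    have := expR_convex (- (x * u)) (- (y * u)) t01.
    have -> : t * - (x * u) + (1 - t) * - (y * u) = - ((t * x + (1 - t) * y) * u).
      by ring.
    move=> h.
    move: (\1_(`]0, 1[%classic) u) (expR (- (x * u))) (expR (- (y * u))) h => i ex ey h.
    rewrite [leRHS](_ : _ = t * ex + (1 - t) * ey - 1 +
      (t * x + (1 - t) * y) * u * i); last by ring.
    by rewrite lerD2r lerD2r.
rewrite !psiE.
have -> : t * (gamma * x + 2^-1 * sigma ^+ 2 * x ^+ 2 + \int[pi]_(u in D) g x u) +
  (1 - t) * (gamma * y + 2^-1 * sigma ^+ 2 * y ^+ 2 + \int[pi]_(u in D) g y u) =
  gamma * (t * x + (1 - t) * y) +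
  2^-1 * sigma ^+ 2 * (t * x ^+ 2 + (1 - t) * y ^+ 2) +
  (t * \int[pi]_(u in D) g x u + (1 - t) * \int[pi]_(u in D) g y u) by ring.
apply: lerD => //; rewrite lerD2l ler_wpM2l//.
  by rewrite mulr_ge0// sqr_ge0.
have : 0 <= t * (1 - t) * (x - y) ^+ 2 by rewrite mulr_ge0 ?sqr_ge0// mulr_ge0.
lra.
Qed.

Lemma branching_mechanism0 : psi 0 = 0.
Proof.
rewrite psiE mulr0 expr0n /= mulr0 !add0r.
rewrite (@eq_Rintegral _ _ _ _ _ (fun=> 0)); first by rewrite Rintegral_cst// mul0r.
by move=> u _; rewrite /g !mul0r oppr0 expR0 subrr addr0.
Qed.

Let J2 := \int[pi]_(u in D) Num.min 1 (u ^+ 2).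
Let J1 := \int[nu]_(u in D) Num.min 1 (u ^+ 1).

Let J2_ge0 : 0 <= J2.
Proof.
by apply: Rintegral_ge0 => u /=; rewrite in_itv /= andbT => u0; rewrite levy_weight_ge0// ltW.
Qed.

Let J1_ge0 : 0 <= J1.
Proof.
by apply: Rintegral_ge0 => u /=; rewrite in_itv /= andbT => u0; rewrite levy_weight_ge0// ltW.
Qed.

Let phi_linear (q : R) : 0 <= q -> phi q <= b * q + (1 + q) * J1.
Proof.
move=> q0; rewrite phiE lerD2l; apply: (le_trans (ler_norm _)).
exact: (Rintegral_levy_le hnu (measurable_f q) (f_bound q0)).
Qed.

(** Compensated jumps below 1 contribute nonnegatively and a jump above 1 loses at most 1. The jump
    part of Psi is therefore bounded below by [- J2]. *)
Let g_ge (q u : R) : 0 <= q -> 0 < u -> - Num.min 1 (u ^+ 2) <= g q u.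
Proof.
move=> q0 u0; have qu0 : 0 <= q * u by rewrite mulr_ge0// ltW.
have [u1|u1] := ltP u 1.
  rewrite g_lt1// w2_lt1//; have /andP[h1 _] := expRN_remainder2 qu0.
  by rewrite (le_trans _ h1)// oppr_le0 sqr_ge0.
by rewrite g_ge1// w2_ge1//; have := expR_ge0 (- (q * u)); lra.
Qed.

Let psi_ge_gaussian (q : R) : 0 <= q ->
  gamma * q + 2^-1 * sigma ^+ 2 * q ^+ 2 - J2 <= psi q.
Proof.
move=> q0; rewrite psiE lerD2l -[leLHS]mulN1r -RintegralZl//; last exact: integrable_levy_weight hpi.
apply: le_Rintegral => //; last first.
- by move=> u; rewrite /= in_itv /= andbT mulN1r => u0; exact: g_ge.
- exact: integrable_g.
- by apply: integrable_EFinZl => //; exact: integrable_levy_weight hpi.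
Qed.

Let psi_superlinear_gaussian (A : R) : sigma != 0 ->
  exists M, forall q, M <= q -> A * q <= psi q.
Proof.
move=> s0; pose c := 2^-1 * sigma ^+ 2.
have c0 : 0 < c by rewrite mulr_gt0// exprn_even_gt0.
exists (1 + (`|A - gamma| + J2) / c) => q Mq.
have B0 : 0 <= `|A - gamma| + J2 by rewrite addr_ge0.
have q1 : 1 <= q by apply: le_trans Mq; rewrite lerDl divr_ge0// ltW.
have q0 : 0 <= q by lra.
apply: le_trans (psi_ge_gaussian q0); rewrite -/c.
have h : `|A - gamma| + J2 <= c * q.
  rewrite mulrC -ler_pdivrMr//; lra.
have h2 : A - gamma <= `|A - gamma| := ler_norm _.
have : (`|A - gamma| + J2) * q <= c * q * q by rewrite ler_wpM2r.
have : (A - gamma) * q <= `|A - gamma| * q by rewrite ler_wpM2r.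
have : J2 <= J2 * q by rewrite ler_peMr.
nra.
Qed.

Let small_jumps_cvg :
  (\int[pi]_(u in `[n.+1%:R^-1%R, 1%R[) u%:E)%E @[n --> \oo] -->
  (\int[pi]_(u in `]0%R, 1%R[) u%:E)%E.
Proof.
have -> : `]0%R, 1%R[%classic = \bigcup_n `[n.+1%:R^-1%R, 1%R[%classic :> set R.
  apply/seteqP; split => u /=.
    rewrite in_itv /= => /andP[u0 u1].
    exists (Num.truncn u^-1) => //=; rewrite in_itv /= u1 andbT.
    rewrite -[leRHS]invrK lef_pV2 ?posrE ?invr_gt0 ?ltr0n//.
    by apply: ltW; rewrite truncnS_gt.
  move=> [n _] /=; rewrite !in_itv /= => /andP[hu u1]; rewrite u1 andbT.
  by apply: lt_le_trans hu; rewrite invr_gt0.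
apply: ge0_nondecreasing_set_cvg_integral.
- apply/nondecreasing_seqP => n; rewrite subsetEset => u /=; rewrite !in_itv /= => /andP[h ->].
  by rewrite andbT; apply: le_trans h; rewrite lef_pV2 ?posrE ?ltr0n// ler_nat.
- by move=> n.
- by move=> n; exact/measurable_EFinP.
- move=> n u /=; rewrite in_itv /= => /andP[h _]; rewrite lee_fin.
  by apply: le_trans h; rewrite invr_ge0.
Qed.

(** Once q e >= 2, each jump u in [e, 1[ contributes at least q u / 2, since exp (- s) - 1 + s >= s
    / 2 for s >= 2. The mean of the jumps in [e, 1[ being as large as desired, Psi outgrows every
    linear function. *)
Let psi_superlinear_jumps (A : R) : (\int[pi]_(u in `]0%R, 1%R[) u%:E = +oo)%E ->
  exists M, forall q, M <= q -> A * q <= psi q.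
Proof.
(* The parts [|gamma|] and [J2] of [A'] pay for the drift and for the lower bound of the other
   jumps. *)
move=> infty; pose A' : R := `|A| + `|gamma| + J2.
have A'0 : 0 <= A' by rewrite !addr_ge0.
have := small_jumps_cvg; rewrite infty => /cvgeyPgt/(_ (2 * A')).
case=> n _ /(_ n (leqnn n)) /= hn.
pose e : R := n.+1%:R^-1; have e0 : 0 < e by rewrite invr_gt0.
exists (1 + 2 / e) => q Mq.
have e20 : 0 <= 2 / e by rewrite divr_ge0// ltW.
have q1 : 1 <= q by lra.
have q0 : 0 < q by lra.
have eq2 : 2 <= e * q by rewrite mulrC -ler_pdivrMr//; lra.
have iw := integrable_levy_weight hpi.
pose k (u : R) := u * \1_(`[e, 1[%classic) u.
have kE (u : R) : k u = (u * \1_(`[e, 1[%classic) u) by [].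
have mk : measurable_fun D k by apply: measurable_funM.
have ik : pi.-integrable D (EFin \o k).
  apply: (integrable_levy hpi (C := e^-1)) => // u u0; rewrite kE indicE.
  have [|_] := boolP (u \in `[e, 1[%classic);
    last by rewrite mulr0 normr0 mulr_ge0 ?invr_ge0 ?(ltW e0)// levy_weight_ge0// ltW.
  rewrite inE /= in_itv /= => /andP[eu u1]; rewrite mulr1 w2_lt1// ger0_norm; last lra.
  by rewrite ler_pdivlMl// expr2 ler_pM2r.
have Ek : 2 * A' < \int[pi]_(u in D) k u.
  rewrite -lte_fin; apply: (lt_le_trans hn).
  rewrite /Rintegral fineK; last exact: integrable_fin_num.
  rewrite (_ : `[e, 1[%classic = D `&` `[e, 1[%classic); last first.
    apply/seteqP; split => u /=; rewrite !in_itv /=; last by case.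
    by move=> /andP[h1 h2]; rewrite h1 h2 andbT; split => //; exact: lt_le_trans h1.
  rewrite integral_mkcondr; apply: ge0_le_integral => //.
  - by move=> u /=; rewrite in_itv /= andbT => u0; rewrite /patch; case: (u \in _) => //;
    rewrite lee_fin ltW.
  - apply: (@measurable_restrict _ _ _ _ _ _ _ _ _).1 => //=.
    by apply/measurable_EFinP.
  - by move=> u /= _; rewrite patchE kE indicE; case: (u \in _); rewrite ?mulr1 ?mulr0.
have H : q / 2 * \int[pi]_(u in D) k u - J2 <= \int[pi]_(u in D) g q u.
  rewrite -[- J2]mulN1r -!RintegralZl// -RintegralD//; [|exact: integrable_EFinZl|exact:
    integrable_EFinZl].
  apply: le_Rintegral => //.
  - exact: (integrableD _ (integrable_EFinZl (q / 2) _ ik) (integrable_EFinZl (-1) _ iw)).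
  - by apply: integrable_g; exact: ltW.
  - move=> u /=; rewrite in_itv /= andbT => u0; rewrite kE indicE.
    have [|_] := boolP (u \in `[e, 1[%classic); last by rewrite mulr0 mulr0 add0r mulN1r; apply:
      g_ge => //; exact: ltW.
    rewrite inE /= in_itv /= => /andP[eu u1]; rewrite mulr1.
    rewrite mulN1r -[leRHS]addr0; apply: lerD; last by rewrite oppr_le0 levy_weight_ge0// ltW.
    rewrite g_lt1//; have := expR_ge0 (- (q * u)); have : e * q <= u * q by rewrite ler_pM2r.
    nra.
rewrite psiE.
have h1 : - (`|gamma| * q) <= gamma * q by rewrite -mulNr ler_pM2r// lerNnormlW.
have h2 : 0 <= 2^-1 * sigma ^+ 2 * q ^+ 2 by rewrite mulr_ge0 ?sqr_ge0// mulr_ge0// sqr_ge0.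
have h3 : q / 2 * (2 * A') <= q / 2 * \int[pi]_(u in D) k u.
  by rewrite ler_pM2l ?divr_gt0// ltW.
have h4 : q / 2 * (2 * A') = `|A| * q + `|gamma| * q + J2 * q by rewrite /A'; field.
have h5 : A * q <= `|A| * q by rewrite ler_pM2r// ler_norm.
have h6 : J2 <= J2 * q by rewrite ler_peMr.
move: (\int[pi]_(u in D) k u) (\int[pi]_(u in D) g q u) H h3 => Ik Ig H h3.
lra.
Qed.

Let m1 := \int[pi]_(u in `]0, 1[) u.

Let small_integrable : (\int[pi]_(u in `]0%R, 1%R[) u%:E < +oo)%E ->
  pi.-integrable `]0, 1[ (EFin \o (fun u : R => u)).
Proof.
move=> fin; apply/integrableP; split; first exact/measurable_EFinP.
apply: le_lt_trans fin; rewrite le_eqVlt; apply/orP; left; apply/eqP.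
apply: eq_integral => u; rewrite inE /= in_itv /= => /andP[u0 _].
by rewrite ger0_norm// ltW.
Qed.

(** Since min (1, u) is at most u on ]0, 1[ and equals min (1, u^2) beyond, [pi] is of order 1 in
    the bounded variation case, and [levy_linear_part_cvg0] applies to it. *)
Let levy_measure1_pi : (\int[pi]_(u in `]0%R, 1%R[) u%:E < +oo)%E -> levy_measure 1 pi.
Proof.
move=> fin; split; first exact: hpi.1.
have i1 : pi.-integrable D (EFin \o (fun u : R => u * \1_(`]0, 1[%classic) u)).
  have E : `]0, 1[%classic = D `&` `]0, 1[%classic.
    by apply/seteqP; split => u /=; rewrite !in_itv /= ?andbT; [case/andP => -> ->|case].
  have h := small_integrable fin; rewrite E in h.
  have h1 : pi.-integrable D ((EFin \o (fun u : R => u)) \_ (`]0, 1[%classic)).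
    exact/integrable_restrict.
  apply: eq_integrable h1 => // u _.
  by rewrite patchE /= indicE; case: (u \in _); rewrite ?mulr1 ?mulr0.
have i2 := integrable_levy_weight hpi.
have /integrableP[_] := integrableD (measurable_itv _) i1 i2.
apply: le_lt_trans; apply: ge0_le_integral => //.
- by move=> u /=; rewrite in_itv /= andbT => u0; rewrite lee_fin levy_weight_ge0// ltW.
- by apply/measurable_EFinP; exact: measurable_levy_weight.
- apply: measurableT_comp => //; apply: measurable_int; apply: (integrableD _ i1 i2) => //.
- move=> u /=; rewrite in_itv /= andbT => u0; rewrite lee_fin.
  apply: le_trans (ler_norm _); rewrite expr1 indicE.
  have [u1|u1] := ltP u 1.
    rewrite mem_set/= ?in_itv/= ?u0//= mulr1 w2_lt1//.
    by rewrite lerDl sqr_ge0.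
  rewrite memNset/= ?in_itv/= ?mulr0; last by apply/negP; rewrite u0/= -leNgt.
  by rewrite add0r [leRHS]w2_ge1// ge_min lexx.
Qed.

(** The compensator is absorbed by the drift: Psi is linear with the effective drift as slope, minus
    a subordinator exponent. *)
Let psi_bounded_variation (q : R) : sigma = 0 -> 0 <= q ->
  (\int[pi]_(u in `]0%R, 1%R[) u%:E < +oo)%E ->
  psi q = (gamma + m1) * q - \int[pi]_(u in D) (1 - expR (- (q * u))).
Proof.
move=> s0 q0 fin; rewrite psiE s0 expr0n /= mulr0 mul0r addr0.
have hpi1 := levy_measure1_pi fin.
have i1 : pi.-integrable D (EFin \o (fun u : R => u * \1_(`]0, 1[%classic) u)).
  have E : `]0, 1[%classic = D `&` `]0, 1[%classic.
    by apply/seteqP; split => u /=; rewrite !in_itv /= ?andbT; [case/andP => -> ->|case].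
  have h := small_integrable fin; rewrite E in h.
  have h1 : pi.-integrable D ((EFin \o (fun u : R => u)) \_ (`]0, 1[%classic)).
    exact/integrable_restrict.
  apply: eq_integrable h1 => // u _.
  by rewrite patchE /= indicE; case: (u \in _); rewrite ?mulr1 ?mulr0.
have i2 : pi.-integrable D (EFin \o f q).
  by apply: (integrable_levy hpi1 (measurable_f q) (f_bound q0)).
have E : m1 = \int[pi]_(u in D) (u * \1_(`]0, 1[%classic) u).
  rewrite /m1 [in LHS](_ : `]0, 1[%classic = D `&` `]0, 1[%classic); last first.
    by apply/seteqP; split => u /=; rewrite !in_itv /= ?andbT; [case/andP => -> ->|case].
  rewrite Rintegral_mkcondr; apply: eq_Rintegral => u _.
  by rewrite patchE /= indicE; case: (u \in _); rewrite ?mulr1 ?mulr0.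
rewrite mulrDl -addrA; congr (_ + _); rewrite E mulrC -RintegralZl// -RintegralB//; last exact:
  integrable_EFinZl.
by apply: eq_Rintegral => u _; rewrite /g /f; move: (expR _) (\1_ _ _) => x1 y1; ring.
Qed.

Hypothesis hpos : exists q : R, 0 <= q /\ 0 < psi q.
Variables (lambda mu a : R).
Hypotheses (hlambda : 0 <= lambda) (hmu : 0 <= mu).
Hypothesis hva : (b%:E / effective_drift gamma sigma pi < a%:E)%E.

Let ratio_of_superlinear : 0 < a ->
  (forall A : R, exists M : R, forall q : R, M <= q -> A * q <= psi q) ->
  exists2 c, 0 <= c < a & exists2 M : R, 0 <= M & forall u : R, M <= u ->
    0 < psi u - mu /\ phi u + lambda <= c * (psi u - mu).
Proof.
move=> a0 sl; exists (a / 2); first by lra.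
pose C : R := b + 2 * J1 + lambda; have C0 : 0 <= C.
  by rewrite /C addr_ge0// addr_ge0// mulr_ge0.
have [M HM] := sl (C / (a / 2) + mu + 1).
exists (1 + `|M|) => [|u Mu]; first by rewrite addr_ge0.
have u1 : 1 <= u by apply: le_trans Mu; rewrite lerDl.
have := HM u _; have -> : M <= u by apply: le_trans Mu; have := ler_norm M; lra.
move=> /(_ isT) h.
have h1 : C / (a / 2) * u <= psi u - mu - 1.
  have : mu <= mu * u by rewrite ler_peMr. lra.
have h2 : C * u <= a / 2 * (psi u - mu - 1).
  have -> : C * u = a / 2 * (C / (a / 2) * u) by field; rewrite gt_eqF.
  by rewrite ler_pM2l// divr_gt0.
have h3 : 0 <= C / (a / 2) * u by rewrite !mulr_ge0 ?invr_ge0//; lra.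
split; first by lra.
have := phi_linear (_ : 0 <= u); have -> : 0 <= u by lra.
move=> /(_ isT) h4.
have h5 : b * u + (1 + u) * J1 + lambda <= C * u.
  rewrite /C; have : J1 <= J1 * u by rewrite ler_peMr. have : lambda <= lambda * u by rewrite ler_peMr.
  lra.
lra.
Qed.

(** At infinity Phi(u) + lambda grows like b u at most, up to o(u), and Psi(u) - mu like d u, or
    faster than linearly in the unbounded variation case. A constant c strictly between v and a thus
    dominates the quotient eventually. This is where a > v enters. *)
Lemma mechanism_ratio :
  exists2 c, 0 <= c < a & exists2 M : R, 0 <= M & forall u : R, M <= u ->
    0 < psi u - mu /\ phi u + lambda <= c * (psi u - mu).
Proof.
move: hva; rewrite /effective_drift; case: ifPn => [/andP[/eqP s0 fin]|].
  have Em : (\int[pi]_(z in `]0%R, 1%R[) z%:E = m1%:E)%E.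
    rewrite /m1 /Rintegral fineK//; apply: integrable_fin_num => //.
    exact: small_integrable.
  rewrite Em -EFinD; set dr := gamma + m1.
  have psiub (q : R) : 0 <= q -> psi q <= dr * q.
    move=> q0; rewrite psi_bounded_variation// gerDl oppr_le0.
    apply: Rintegral_ge0 => u /=; rewrite in_itv /= andbT => u0.
    by rewrite subr_ge0 expR_le1 oppr_le0 mulr_ge0// ltW.
  (* Psi lies below the line of slope [dr], so with [dr <= 0] it could not be positive anywhere. *)
  have dr0 : 0 < dr.
    have [q [q0 psiq]] := hpos; have := psiub _ q0 => h.
    have : 0 < dr * q by lra.
    by rewrite pmulr_lgt0// lt_neqAle q0 andbT eq_sym; apply/eqP => qE; move: psiq;
      rewrite qE branching_mechanism0 ltxx.
  rewrite inver gt_eqF// -EFinM lte_fin => ba.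
  have ba' : b < a * dr by rewrite -ltr_pdivrMr.
  have bd0 : 0 <= b / dr by rewrite divr_ge0// ltW.
  pose c : R := (b / dr + a) / 2.
  exists c; first by rewrite /c; lra.
  have c0 : 0 < c by rewrite /c; lra.
  have cb : b < c * dr by rewrite -ltr_pdivrMr// /c; lra.
  pose del : R := c * dr - b.
  have del0 : 0 < del by rewrite /del subr_gt0.
  (* [eta] is the error per unit of u allowed on both mechanisms. The gap [del] loses [eta (1 + c)],
     at most half of it; the other half absorbs [lambda + c mu] for large u. *)
  pose eta : R := Num.min (dr / 2) (del / (2 * (1 + c))).
  have eta0 : 0 < eta by rewrite lt_min !divr_gt0// mulr_gt0//; lra.
  have eta1 : eta <= dr / 2 by rewrite /eta ge_min lexx.
  have eta2 : eta * (1 + c) <= del / 2.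
    rewrite -ler_pdivlMr; last by lra.
    have -> : del / 2 / (1 + c) = del / (2 * (1 + c)) by field; rewrite gt_eqF//; lra.
    by rewrite /eta ge_min lexx orbT.
  have [M1 HM1] := levy_linear_part_cvg0 hnu eta0.
  have [M2 HM2] := levy_linear_part_cvg0 (levy_measure1_pi fin) eta0.
  pose M : R := `|M1| + `|M2| + (mu + 1) / (dr / 2) + (lambda + c * mu) / (del / 2).
  have p1 : 0 <= (mu + 1) / (dr / 2) by rewrite divr_ge0// ?addr_ge0// divr_ge0// ltW.
  have p2 : 0 <= (lambda + c * mu) / (del / 2).
    by rewrite divr_ge0// ?divr_ge0 ?(ltW del0)// addr_ge0// mulr_ge0// ltW.
  exists M; first by rewrite /M !addr_ge0.
  move=> u Mu.
  have q1 := normr_ge0 M1; have q2 := normr_ge0 M2.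
  have r1 := ler_norm M1; have r2 := ler_norm M2.
  have u1 : M1 <= u by move: Mu; rewrite /M; lra.
  have u2 : M2 <= u by move: Mu; rewrite /M; lra.
  have u3 : (mu + 1) / (dr / 2) <= u by move: Mu; rewrite /M; lra.
  have u4 : (lambda + c * mu) / (del / 2) <= u by move: Mu; rewrite /M; lra.
  have u0 : 0 <= u by lra.
  have {}u3 : mu + 1 <= u * (dr / 2) by rewrite -ler_pdivrMr// divr_gt0.
  have {}u4 : lambda + c * mu <= u * (del / 2) by rewrite -ler_pdivrMr// divr_gt0.
  have := HM1 _ u1; have := HM2 _ u2 => h2 h1.
  have psil : (dr - eta) * u <= psi u.
    by rewrite psi_bounded_variation//; rewrite -/dr; lra.
  have e1 : eta * u <= dr / 2 * u by rewrite ler_wpM2r.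
  have e2 : eta * (1 + c) * u <= del / 2 * u by rewrite ler_wpM2r.
  split; first by lra.
  have e3 : c * ((dr - eta) * u) <= c * psi u by rewrite ler_pM2l.
  rewrite phiE; move: h1; rewrite -/(f _) => h1.
  have h1' : \int[nu]_(u0 in D) f u u0 <= eta * u by exact: h1.
  move: (\int[nu]_(u0 in D) f u u0) h1' => I hI.
  have e4 : c * dr * u = del * u + b * u by rewrite /del; ring.
  nra.
rewrite negb_and -leNgt leye_eq invey mule0 lte_fin => h a0.
apply: ratio_of_superlinear => // A.
case/orP: h => [s0|/eqP inf]; first exact: psi_superlinear_gaussian.
exact: psi_superlinear_jumps.
Qed.

End Mechanisms_analysis.

(** * Scale function and the integrals of the statement *)

Section Calculus.
Context {R : realType}.
Implicit Types (f df : R -> R) (a b c : R).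

Lemma is_derive_MVT f df a b : a <= b ->
  (forall z : R, a <= z <= b -> is_derive z 1 f (df z)) ->
  exists2 z : R, a <= z <= b & f b - f a = df z * (b - a).
Proof.
move=> ab dfz; have [||z] := @MVT_segment _ f df a b ab.
- by move=> z; rewrite in_itv /= => /andP[az zb]; apply: dfz; rewrite !ltW.
- apply: derivable_within_continuous => z; rewrite in_itv /= => zab.
  by apply: ex_derive; exact: dfz.
by rewrite in_itv /= => zab ->; exists z.
Qed.

Lemma is_derive_ndecr f df a b : a <= b ->
  (forall z : R, a <= z <= b -> is_derive z 1 f (df z)) ->
  (forall z : R, a <= z <= b -> 0 <= df z) -> f a <= f b.
Proof.
move=> ab dfz df0; have [z zab] := is_derive_MVT ab dfz.
by rewrite -subr_ge0 => ->; rewrite mulr_ge0 ?subr_ge0// df0.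
Qed.

Lemma is_derive_bounded f df a b c : a <= b ->
  (forall z : R, a <= z <= b -> is_derive z 1 f (df z)) ->
  (forall z : R, a <= z <= b -> `|df z| <= c) -> `|f b - f a| <= c * (b - a).
Proof.
move=> ab dfz df0; have [z zab ->] := is_derive_MVT ab dfz.
rewrite normrM (ger0_norm (_ : 0 <= b - a)) ?subr_ge0//.
by rewrite ler_wpM2r ?subr_ge0// df0.
Qed.

Lemma is_derive_mull f (k z d : R) :
  is_derive z 1 f d -> is_derive z 1 (fun y => k * f y) (k * d).
Proof. by move=> h; have := @is_deriveZ _ _ _ f k z 1 d h. Qed.

Lemma is_derive_continuous f (z d : R) : is_derive z 1 f d -> {for z, continuous f}.
Proof.
by move=> h; apply/differentiable_continuous; rewrite -derivable1_diffP; exact: ex_derive.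
Qed.

Lemma integrable_continuous_itv f a b :
  (forall z : R, a <= z <= b -> {for z, continuous f}) ->
  lebesgue_measure.-integrable `[a, b] (EFin \o f).
Proof.
move=> cf; apply: continuous_compact_integrable; first exact: segment_compact.
by apply/continuous_in_subspaceT => z; rewrite inE /= in_itv /=; exact: cf.
Qed.

Lemma is_derive_Rintegral f a b (z : R) : a < z < b ->
  (forall z : R, a <= z <= b -> {for z, continuous f}) ->
  is_derive z 1 (fun y => \int[lebesgue_measure]_(t in `[a, y]) f t) (f z).
Proof.
move=> /andP[az zb] cf.
have [d1 d2] := @continuous_FTC1_closed _ f a z b zb (integrable_continuous_itv cf) az
  (cf z (introT andP (conj (ltW az) (ltW zb)))).
by apply: DeriveDef; [exact: d1|rewrite -derive1E; exact: d2].
Qed.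

Lemma locally_lipschitz_continuous f :
  (forall a b : R, 0 < a -> exists2 c : R, 0 <= c & forall x y : R,
    a <= x <= b -> a <= y <= b -> `|f x - f y| <= c * `|x - y|) ->
  forall z : R, 0 < z -> {for z, continuous f}.
Proof.
move=> lip z z0; have z20 : 0 < z / 2 by rewrite divr_gt0.
have [c c0 hc] := lip (z / 2) (z + 1) z20.
apply/cvgrPdist_le => /= e e0.
have m0 : 0 < Num.min (Num.min (z / 2) 1) (e / (c + 1)).
  by rewrite !lt_min z20 ltr01 divr_gt0// ltr_wpDl.
near=> y.
have : `|z - y| <= Num.min (Num.min (z / 2) 1) (e / (c + 1)).
  by near: y; exact: cvgr_dist_le.
rewrite !le_min => /andP[/andP[]]; rewrite !ler_norml => /andP[h1 h1'] /andP[h2 h2'].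
rewrite -!ler_norml => h3.
have hh : `|f z - f y| <= c * `|z - y| by apply: hc; apply/andP; split; lra.
apply: (le_trans hh); move: h3; rewrite ler_pdivlMr ?ltr_wpDl// => h3.
have := normr_ge0 (z - y); lra.
Unshelve. all: by end_near. Qed.

End Calculus.

Section Scale.
Context {R : realType}.
Variables (psi phi : R -> R) (lambda mu theta : R).
Hypothesis psi0 : psi 0 = 0.
Hypothesis psi_convex : forall x y t : R, 0 <= x -> 0 <= y -> 0 <= t <= 1 ->
  psi (t * x + (1 - t) * y) <= t * psi x + (1 - t) * psi y.
Hypothesis psi_lip : forall a b : R, 0 < a -> exists2 c : R, 0 <= c &
  forall x y, a <= x <= b -> a <= y <= b -> `|psi x - psi y| <= c * `|x - y|.
Hypothesis phi_lip : forall a b : R, 0 < a -> exists2 c : R, 0 <= c &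
  forall x y, a <= x <= b -> a <= y <= b -> `|phi x - phi y| <= c * `|x - y|.
Hypothesis phi_ge0 : forall x : R, 0 <= x -> 0 <= phi x.
Hypothesis hpos : exists q : R, 0 <= q /\ 0 < psi q.
Hypothesis hlambda : 0 < lambda.
Hypothesis hmu : 0 <= mu.
Local Notation q := (largest_root psi mu).
Hypothesis htheta : q < theta.

Let S := [set q : R | 0 <= q /\ psi q = mu].

Let psi_cont (z : R) : 0 < z -> {for z, continuous psi}.
Proof. by move=> z0; exact: (locally_lipschitz_continuous psi_lip). Qed.

(** Convexity and Psi(0) = 0 give Psi(t p) >= t Psi(p) for t >= 1; [t] is chosen with t p >= z and t
    Psi(p) > mu. *)
Let psi_large (z : R) : exists2 Z : R, z <= Z & mu < psi Z.
Proof.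
have [p [p0 psip]] := hpos.
have p_gt0 : 0 < p.
  by rewrite lt_neqAle p0 andbT; apply/eqP => pE; move: psip; rewrite -pE psi0 ltxx.
pose t : R := 1 + `|z| / p + mu / psi p.
have t1 : 1 <= t by rewrite /t -addrA lerDl addr_ge0 ?divr_ge0// ltW.
have t0 : 0 < t by lra.
exists (t * p).
  have : `|z| <= t * p.
    rewrite -ler_pdivrMr// /t; have : 0 <= mu / psi p by rewrite divr_ge0// ltW. lra.
  exact: le_trans (ler_norm _).
have := @psi_convex (t * p) 0 t^-1; rewrite psi0 !mulr0 !addr0 mulKf ?gt_eqF//.
have -> : 0 <= t * p by rewrite mulr_ge0// ltW.
have -> : 0 <= t^-1 <= 1 by rewrite invr_ge0 (ltW t0) invf_le1.
move=> /(_ isT (lexx 0) isT); rewrite ler_pdivlMl// => h.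
apply: lt_le_trans h; rewrite -ltr_pdivrMr// /t.
have : 0 <= `|z| / p by rewrite divr_ge0// ltW.
lra.
Qed.

Let psi_IVT (x y : R) : 0 < x -> x <= y -> psi x <= mu -> mu <= psi y ->
  exists2 z, x <= z <= y & psi z = mu.
Proof.
move=> x0 xy hx hy.
have cw : {within `[x, y], continuous psi}.
  apply/continuous_in_subspaceT => z; rewrite inE /= in_itv /= => /andP[xz _].
  by apply: psi_cont; exact: lt_le_trans xz.
have [|z] := IVT xy cw (v := mu).
  by rewrite ge_min hx le_max hy orbT.
by rewrite in_itv /= => zxy psiz; exists z.
Qed.

Let S_nonempty : S !=set0.
Proof.
move: hmu; rewrite le_eqVlt => /predU1P[mu0|mu0].
  by exists 0; split; rewrite // psi0.
have [Z Z1 psiZ] := psi_large 1.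
have psiZ0 : 0 < psi Z by lra.
(* [psi_IVT] starts from a positive point, so 0 is replaced by [t * Z], where the chord from 0
   already gives Psi <= mu. *)
pose t : R := mu / psi Z; have t01 : 0 <= t <= 1.
  by rewrite /t divr_ge0 ?ltW//= ltr_pdivrMr// mul1r.
have t0 : 0 < t by rewrite divr_gt0.
have tZ : psi (t * Z) <= mu.
  have := @psi_convex Z 0 t _ (lexx 0) t01; rewrite psi0 !mulr0 !addr0.
  have -> : 0 <= Z by lra.
  by move=> /(_ isT); rewrite /t divfK// gt_eqF.
have [z /andP[z1 z2] psiz] : exists2 z, t * Z <= z <= Z & psi z = mu.
  apply: psi_IVT => //; [by rewrite mulr_gt0//; lra| |exact: ltW].
  by rewrite ler_piMl//; lra.
by exists z; split => //; apply: le_trans z1; rewrite mulr_ge0//; lra.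
Qed.

(* By convexity the chord from a root [r] through a point where [psi] exceeds
   [mu] keeps rising, so that no root lies beyond that point. *)
Let chord (r y z : R) : S r -> r < y -> y <= z ->
  (psi y - mu) * (z - r) <= (psi z - mu) * (y - r).
Proof.
move=> [r0 psir] ry yz; have zr0 : 0 < z - r by lra.
pose t : R := (y - r) / (z - r).
have t01 : 0 <= t <= 1.
  by rewrite /t divr_ge0 ?(ltW zr0)//= ?subr_ge0 ?(ltW ry)// ler_pdivrMr// mul1r; lra.
have := @psi_convex z r t _ r0 t01; rewrite psir.
have -> : 0 <= z by lra.
have -> : t * z + (1 - t) * r = y by rewrite /t; field; rewrite gt_eqF.
move=> /(_ isT) h.
have {}h : psi y - mu <= t * (psi z - mu) by lra.
have -> : (psi z - mu) * (y - r) = t * (psi z - mu) * (z - r).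
  by rewrite /t; field; rewrite gt_eqF.
by rewrite ler_pM2r.
Qed.

Let S_ubound : has_ubound S.
Proof.
have [r0 Sr0] := S_nonempty.
have [Z Z1 psiZ] := psi_large (r0 + 1).
exists Z => z Sz; rewrite leNgt; apply/negP => Zz.
have rZ : r0 < Z by lra.
have := chord Sr0 rZ (ltW Zz); rewrite Sz.2 subrr mul0r.
by rewrite leNgt mulr_gt0//; lra.
Qed.

Lemma largest_root_ge0 : 0 <= q.
Proof.
have [r Sr] := S_nonempty; apply: (le_trans Sr.1); apply: ub_le_sup => //; exact: S_ubound.
Qed.

Lemma psi_gt_root (z : R) : q < z -> mu < psi z.
Proof.
move=> qz; have q0 := largest_root_ge0; rewrite ltNge; apply/negP => psiz.
have [Z zZ psiZ] := psi_large z.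
have [y /andP[y1 y2] psiy] := psi_IVT (le_lt_trans q0 qz) zZ psiz (ltW psiZ).
have : y <= q by apply: ub_le_sup; [exact: S_ubound|split => //; lra].
lra.
Qed.

Let slope : R := (psi theta - mu) / (theta - q).

Let slope_gt0 : 0 < slope.
Proof. by rewrite divr_gt0// subr_gt0// psi_gt_root. Qed.

(** The chord inequality holds from every root r; letting r approach the supremum q gives it from
    q. *)
Let psi_le_slope (z : R) : q < z <= theta -> psi z - mu <= slope * (z - q).
Proof.
move=> /andP[qz zt].
have h (e : R) : 0 < e -> psi z - mu <= slope * (z - q + e).
  move=> e0; have [r Sr re] : exists2 r, S r & q - e < r.
    have [r Sr re] := sup_adherent e0 (conj S_nonempty S_ubound).
    by exists r.
  have rq : r <= q by apply: ub_le_sup => //; exact: S_ubound.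
  have := chord Sr (le_lt_trans rq qz) zt.
  have tr : 0 < theta - r by lra.
  rewrite -ler_pdivlMr// => h; apply: (le_trans h).
  have pt : 0 < psi theta - mu by rewrite subr_gt0 psi_gt_root.
  rewrite /slope -mulrA -mulrA ler_pM2l// mulrC.
  rewrite ler_pM//; [by rewrite invr_ge0 ltW|by lra| |by lra].
  by rewrite lef_pV2 ?posrE//; lra.
rewrite leNgt; apply/negP => hlt.
pose e : R := (psi z - mu - slope * (z - q)) / (2 * slope).
have e0 : 0 < e by apply: divr_gt0; [rewrite subr_gt0|rewrite mulr_gt0].
have := h _ e0; rewrite /e.
have -> : slope * (z - q + (psi z - mu - slope * (z - q)) / (2 * slope)) =
  (psi z - mu + slope * (z - q)) / 2 by field; rewrite gt_eqF.
lra.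
Qed.

Definition rate (u : R) : R := (phi u + lambda) / (psi u - mu).
(** The integrating factor: its derivative is (Phi + lambda) [density], while [scale] itself is (Psi
    - mu) [density] beyond q. [density] is the weight of exp (- x z) in the integrals of the
    statement. *)
Definition scale (z : R) : R := expR (oriented_integral theta z rate).
Definition density (z : R) : R := scale z / (psi z - mu).

Let rate_cont (z : R) : q < z -> {for z, continuous rate}.
Proof.
move=> qz; have z0 : 0 < z by apply: le_lt_trans qz; exact: largest_root_ge0.
apply: cvgM.
  by apply: cvgD; [exact: (locally_lipschitz_continuous phi_lip)|exact: cvg_cst].
apply: cvgV; first by rewrite subr_eq0 gt_eqF// psi_gt_root.
by apply: cvgB; [exact: psi_cont|exact: cvg_cst].
Qed.

Let rate_gt0 (z : R) : q < z -> 0 < rate z.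
Proof.
move=> qz; rewrite divr_gt0 ?subr_gt0 ?psi_gt_root//.
by rewrite ltr_wpDl// phi_ge0// (le_trans largest_root_ge0)// ltW.
Qed.

(** A common base point [c] below both theta and z turns the oriented integral, on either side of
    theta, into an integral with variable upper end, to which the fundamental theorem of calculus
    applies. *)
Let oriented_integralE (c z : R) : q < c -> c <= theta -> c <= z ->
  oriented_integral theta z rate =
  \int[lebesgue_measure]_(u in `[c, z]) rate u -
  \int[lebesgue_measure]_(u in `[c, theta]) rate u.
Proof.
move=> qc ct cz; rewrite /oriented_integral.
have ir y : lebesgue_measure.-integrable `[c, y] (EFin \o rate).
  apply: integrable_continuous_itv => u /andP[cu _]; apply: rate_cont; lra.
have split (x y : R) : c <= x -> x <= y ->
  \int[lebesgue_measure]_(u in `[c, y]) rate u -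
  \int[lebesgue_measure]_(u in `[c, x]) rate u = \int[lebesgue_measure]_(u in `[x, y]) rate u.
  move=> cx xy; rewrite Rintegral_itvB// ?bnd_simp//.
  apply: Rintegral_itv_obnd_cbnd.
  by apply: integrableS (ir y) => //; apply: subset_itvr; rewrite bnd_simp.
case: ifPn => [tz|]; first by rewrite split.
by rewrite -ltNge => zt; rewrite -opprB split// ltW.
Qed.

Lemma oriented_integral_theta : oriented_integral theta theta rate = 0.
Proof. by rewrite /oriented_integral lexx set_itv1 Rintegral_set1. Qed.

Lemma is_derive_oriented_integral (z : R) : q < z ->
  is_derive z 1 (fun y => oriented_integral theta y rate) (rate z).
Proof.
move=> qz; pose c : R := (q + Num.min z theta) / 2.
have [h1 h2] : Num.min z theta <= z /\ Num.min z theta <= theta.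
  by rewrite !ge_min !lexx orbT.
have h3 : q < Num.min z theta by rewrite lt_min qz.
have [qc [cz ct]] : q < c /\ (c < z /\ c < theta) by rewrite /c; lra.
have D : is_derive z 1 (fun y => \int[lebesgue_measure]_(u in `[c, y]) rate u -
  \int[lebesgue_measure]_(u in `[c, theta]) rate u) (rate z).
  have := @is_derive_Rintegral _ rate c (z + 1) z.
  rewrite cz /= ltrDl ltr01 => /(_ isT) H.
  have {}H := H (fun u hu => rate_cont (lt_le_trans qc (andP hu).1)).
  by rewrite -[rate z]subr0; apply: is_deriveB.
apply: near_eq_is_derive D.
near=> y; rewrite /= (oriented_integralE qc (ltW ct))//.
by apply: ltW; near: y; exact: lt_nbhsr.
Unshelve. all: by end_near. Qed.

Lemma scale_gt0 (z : R) : 0 < scale z.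
Proof. exact: expR_gt0. Qed.

Lemma density_gt0 (z : R) : q < z -> 0 < density z.
Proof. by move=> qz; rewrite divr_gt0 ?scale_gt0// subr_gt0 psi_gt_root. Qed.

Lemma is_derive_scale (z : R) : q < z ->
  is_derive z 1 scale ((phi z + lambda) * density z).
Proof.
move=> qz; have D := is_derive_oriented_integral qz.
have -> : (phi z + lambda) * density z = scale z * rate z.
  by rewrite /density /rate; ring.
exact: (is_derive1_comp (is_derive_expR _) D).
Qed.

Lemma density_continuous (z : R) : q < z -> {for z, continuous density}.
Proof.
move=> qz; have z0 : 0 < z by apply: le_lt_trans qz; exact: largest_root_ge0.
apply: cvgM; first exact: (is_derive_continuous (is_derive_scale qz)).
apply: cvgV; first by rewrite subr_eq0 gt_eqF// psi_gt_root.
by apply: cvgB; [exact: psi_cont|exact: cvg_cst].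
Qed.

(* Near the root, [rate z >= (lambda / slope) / (z - q)], which is not
   integrable, hence [scale] vanishes there. *)
Lemma scale_near_root (e : R) : 0 < e ->
  exists2 d : R, 0 < d & forall z, q < z -> z < q + d -> scale z < e.
Proof.
move=> e0; pose p : R := lambda / slope.
have p0 : 0 < p by rewrite divr_gt0.
have H z : q < z -> z <= theta ->
    oriented_integral theta z rate <= p * (ln (z - q) - ln (theta - q)).
  move=> qz zt.
  have := @is_derive_ndecr _ (fun y => oriented_integral theta y rate - p * ln (y - q))
    (fun y => rate y - p * (y - q)^-1) z theta zt.
  rewrite oriented_integral_theta => H; rewrite mulrBr; suff :
    oriented_integral theta z rate - p * ln (z - q) <= 0 - p * ln (theta - q) by lra.
  apply: H => y /andP[zy yt].
    have qy : q < y by lra.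
    have yq0 : 0 < y - q by lra.
    have D1 := is_derive_oriented_integral qy.
    have D2 : is_derive y 1 (fun y : R => y - q) 1.
      by rewrite -[X in is_derive _ _ _ X]subr0; apply: is_deriveB.
    have D3 := @is_derive1_comp _ (@ln R) (fun y : R => y - q) y _ _ (is_derive1_ln yq0) D2.
    apply: is_deriveB; apply: is_derive_mull.
    by move: D3; rewrite mulr1.
  have qy : q < y by lra.
  have yq0 : 0 < y - q by lra.
  rewrite subr_ge0 /rate /p -mulrA -invfM.
  rewrite ler_pM ?(ltW hlambda)//.
  - by rewrite invr_ge0 mulr_ge0 ?ltW.
  - by rewrite lerDr phi_ge0// (le_trans largest_root_ge0)// ltW.
  - rewrite lef_pV2 ?posrE ?subr_gt0 ?psi_gt_root ?(mulr_gt0 slope_gt0)//.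
    by apply: psi_le_slope; rewrite qy.
(* The second bound makes p (ln (z - q) - ln (theta - q)) smaller than ln e - p; the first keeps z
   below theta, where the comparison [H] holds. *)
exists (Num.min (theta - q) ((theta - q) * expR (ln e / p - 1))).
  by rewrite lt_min subr_gt0 htheta/= mulr_gt0 ?expR_gt0// subr_gt0.
move=> z qz; rewrite -ltrBlDl lt_min => /andP[h1 h2].
have tq0 : 0 < theta - q by rewrite subr_gt0.
have zq0 : 0 < z - q by rewrite subr_gt0.
rewrite -[ltRHS](lnK e0) /scale ltr_expR.
apply: le_lt_trans (H _ qz _) _; first lra.
have : ln (z - q) < ln (theta - q) + (ln e / p - 1).
  rewrite -[X in _ < _ + X]expRK -lnM ?posrE ?expR_gt0//.
  by rewrite ltr_ln ?posrE ?mulr_gt0 ?expR_gt0.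
move=> h3; have : p * (ln (z - q) - ln (theta - q)) < p * (ln e / p - 1).
  by rewrite ltr_pM2l//; lra.
have -> : p * (ln e / p - 1) = ln e - p by field; rewrite gt_eqF.
lra.
Qed.

(** * Growth of the scale function at infinity *)

Section At_infinity.
Variables (a c M : R).
Hypotheses (ca : 0 <= c < a) (M0 : 0 <= M).
Hypothesis ratio : forall u, M <= u ->
  0 < psi u - mu /\ phi u + lambda <= c * (psi u - mu).

(** Beyond [M] the logarithmic derivative of [scale] is at most c, and up to [m] the increasing
    function [scale] is at most its value at [m], which serves as K. *)
Lemma scale_le_exp : exists2 K : R, 0 < K &
  forall z, q < z -> scale z * expR (- (a * z)) <= K * expR (- ((a - c) * z)).
Proof.
pose m : R := q + M + 1.
have hM0 := M0; have hca := ca; have qm : q < m by rewrite /m; lra.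
have Mm : M <= m by rewrite /m; have := largest_root_ge0; lra.
have H z : m <= z -> oriented_integral theta z rate - c * z <= oriented_integral theta m rate - c * m.
  move=> mz; rewrite -lerN2.
  apply: (@is_derive_ndecr _ (fun y => - (oriented_integral theta y rate - c * y))
    (fun y => - (rate y - c * 1)) m z mz) => y /andP[my yz].
    apply: is_deriveN; apply: is_deriveB; first by apply: is_derive_oriented_integral; lra.
  have [h1 h2] := ratio (le_trans Mm my).
  by rewrite mulr1 oppr_ge0 subr_le0 ler_pdivrMr.
have H2 z : q < z -> z <= m -> oriented_integral theta z rate <= oriented_integral theta m rate.
  move=> qz zm.
  apply: (@is_derive_ndecr _ (fun y => oriented_integral theta y rate) rate z m zm) => y /andP[zy ym].
    by apply: is_derive_oriented_integral; lra.
  by apply: ltW; apply: rate_gt0; lra.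
have H3 z : q < z ->
    oriented_integral theta z rate + - (a * z) <= oriented_integral theta m rate + - ((a - c) * z).
  move=> qz; have [zm|/ltW mz] := leP z m.
    have := H2 _ qz zm; have : 0 <= c * z.
      by rewrite mulr_ge0//; [lra|have := largest_root_ge0; lra].
    lra.
  have := H _ mz; have : 0 <= c * m by rewrite mulr_ge0//; [lra|have := largest_root_ge0; lra].
  lra.
exists (expR (oriented_integral theta m rate)); first exact: expR_gt0.
move=> z qz.
have : expR (oriented_integral theta z rate + - (a * z)) <=
       expR (oriented_integral theta m rate + - ((a - c) * z)) by rewrite ler_expR; exact: H3.
by rewrite (expRD (oriented_integral theta z rate)) (expRD (oriented_integral theta m rate)).
Qed.

Lemma scale_exp_cvg0 (e : R) : 0 < e ->
  exists Z : R, forall z, Z <= z -> q < z -> scale z * expR (- (a * z)) < e.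
Proof.
move=> e0; have [K K0 HK] := scale_le_exp.
have hca := ca; have ac : 0 < a - c by lra.
exists ((1 - ln (e / K)) / (a - c)) => z hz qz; apply: le_lt_trans (HK _ qz) _.
rewrite mulrC -ltr_pdivlMr// -[ltRHS]lnK ?posrE ?divr_gt0// ltr_expR.
by move: hz; rewrite ler_pdivrMr//; lra.
Qed.

Let weight (z : R) : R := density z * expR (- (a * z)).

Let weight_continuous (z : R) : q < z -> {for z, continuous weight}.
Proof.
move=> qz; apply: cvgM; first exact: density_continuous.
by apply: continuous_comp; [apply: cvgN; exact: mulrl_continuous|exact: continuous_expR].
Qed.

(** [density] may blow up near q, where Psi - mu vanishes. But lambda [density] is at most the
    derivative of [scale], so the integral is controlled by the increment of scale z exp (- a z), up
    to the integral of a scale z exp (- a z), which [scale_le_exp] bounds. *)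
Lemma density_exp_bounded : exists C : R, forall z0 z1, q < z0 -> z0 <= z1 ->
  \int[lebesgue_measure]_(z in `[z0, z1]) (density z * expR (- (a * z))) <= C.
Proof.
have [K K0 HK] := scale_le_exp.
have hca := ca; have ac : 0 < a - c by lra.
have a0 : 0 <= a by lra.
(* The second term is an antiderivative of the exponential that dominates a scale z exp (- a z);
   hence the derivative [dF] dominates the integrand while [F] stays bounded. *)
pose F (z : R) : R := lambda^-1 * (scale z * expR (- (a * z)) -
   a * K / (a - c) * expR (- ((a - c) * z))).
have DE (k z : R) : is_derive z 1 (fun z : R => expR (- (k * z))) (- k * expR (- (k * z))).
  have D : is_derive z 1 (fun z : R => - (k * z)) (- (k * 1)).
    by apply: is_deriveN; apply: is_derive_mull; exact: is_derive_id.
  have -> : - k * expR (- (k * z)) = expR (- (k * z)) * - (k * 1) by ring.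
  exact: (is_derive1_comp (is_derive_expR _) D).
pose dF (z : R) : R := lambda^-1 * ((scale z * (- a * expR (- (a * z))) +
   expR (- (a * z)) * ((phi z + lambda) * density z)) -
   a * K / (a - c) * (- (a - c) * expR (- ((a - c) * z)))).
have DF z : q < z -> is_derive z 1 F (dF z).
  move=> qz; apply: is_derive_mull.
  apply: is_deriveB (is_derive_mull _ (DE _ _)).
  exact: (is_deriveM (is_derive_scale qz) (DE _ _)).
have dFge z : q < z -> weight z <= dF z.
  move=> qz; rewrite /weight /dF.
  have -> : a * K / (a - c) * (- (a - c) * expR (- ((a - c) * z))) =
    - (a * (K * expR (- ((a - c) * z)))) by field; rewrite gt_eqF.
  rewrite ler_pdivlMl//.
  have h1 := HK _ qz; have h2 : 0 <= phi z.
    by apply: phi_ge0; apply: ltW; apply: le_lt_trans qz; exact: largest_root_ge0.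
  have h3 := density_gt0 qz; have h4 := expR_gt0 (- (a * z)).
  have h5 : 0 <= phi z * (density z * expR (- (a * z))) by rewrite mulr_ge0// mulr_ge0// ltW.
  have h6 : a * (scale z * expR (- (a * z))) <= a * (K * expR (- ((a - c) * z))).
    by rewrite ler_wpM2l.
  move: (expR (- ((a - c) * z))) (expR (- (a * z))) h1 h4 h5 h6 => E1 E2 h1 h4 h5 h6.
  lra.
have Fb z : q < z -> `|F z| <= lambda^-1 * (K + a * K / (a - c)).
  move=> qz; have li : 0 <= lambda^-1 by rewrite invr_ge0 ltW.
  rewrite normrM (ger0_norm li) ler_wpM2l//.
  have e1 : expR (- ((a - c) * z)) <= 1.
    by rewrite expR_le1 oppr_le0 mulr_ge0 ?(ltW ac)// (le_trans largest_root_ge0)// ltW.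
  have e0 := expR_ge0 (- ((a - c) * z)).
  have h0 : 0 <= scale z * expR (- (a * z)) by rewrite mulr_ge0// expR_ge0.
  have h1 := HK _ qz.
  have h2 : K * expR (- ((a - c) * z)) <= K by rewrite ler_piMr// ltW.
  have B0 : 0 <= a * K / (a - c) by rewrite !mulr_ge0 ?invr_ge0 ?ltW//; lra.
  have h3 : 0 <= a * K / (a - c) * expR (- ((a - c) * z)) <= a * K / (a - c).
    by rewrite mulr_ge0//= ler_piMr.
  by rewrite ler_norml; apply/andP; split; lra.
exists (2 * (lambda^-1 * (K + a * K / (a - c)))) => z0 z1 qz0 z01.
pose qz := (q + z0) / 2.
have [qqz qzz] : q < qz /\ qz < z0 by rewrite /qz; lra.
have cw z : qz <= z <= z1 + 1 -> {for z, continuous weight}.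
  by move=> /andP[h _]; apply: weight_continuous; lra.
pose G (y : R) : R := \int[lebesgue_measure]_(t in `[qz, y]) weight t.
have DG z : z0 <= z <= z1 -> is_derive z 1 G (weight z).
  by move=> /andP[h1 h2]; apply: (@is_derive_Rintegral _ _ qz (z1 + 1)) => //; lra.
have GF : G z1 - G z0 <= F z1 - F z0.
  have : F z0 - G z0 <= F z1 - G z1.
    refine (@is_derive_ndecr _ (fun z => F z - G z) (fun z => dF z - weight z) z0 z1 z01 _ _) => z hz.
      by apply: is_deriveB; [apply: DF; lra|exact: DG].
    by rewrite subr_ge0; apply: dFge; lra.
  lra.
have E : \int[lebesgue_measure]_(z in `[z0, z1]) (density z * expR (- (a * z))) = G z1 - G z0.
  have iw : lebesgue_measure.-integrable `[qz, z1] (EFin \o weight).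
    by apply: integrable_continuous_itv => z hz; apply: cw; lra.
  rewrite /G Rintegral_itvB// ?bnd_simp ?(ltW qzz)//.
  apply/esym; apply: Rintegral_itv_obnd_cbnd.
  by apply: integrableS iw => //; apply: subset_itvr; rewrite bnd_simp ltW.
rewrite E (le_trans GF)//.
have := Fb z1 (lt_le_trans qz0 z01); have := Fb z0 qz0; rewrite !ler_norml; lra.
Qed.

End At_infinity.

(** * Exhaustion of ]q(mu), oo[ by compact intervals *)

Let I (n : nat) : set R := `[q + n.+1%:R^-1, q + 1 + n%:R]%classic.

Let I_gt (n : nat) z : I n z -> q < z.
Proof.
rewrite /I /= in_itv /= => /andP[h _]; apply: lt_le_trans h.
by rewrite ltrDl invr_gt0.
Qed.

Let weight (x z : R) : R := density z * expR (- (x * z)).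

Let weight_continuous x (z : R) : q < z -> {for z, continuous (weight x)}.
Proof.
move=> qz; apply: cvgM; first exact: density_continuous.
by apply: continuous_comp; [apply: cvgN; exact: mulrl_continuous|exact: continuous_expR].
Qed.

Let weight_gt0 x z : q < z -> 0 < weight x z.
Proof. by move=> qz; rewrite mulr_gt0 ?expR_gt0// density_gt0. Qed.

Lemma integrable_density_exp x (z0 z1 : R) : q < z0 ->
  lebesgue_measure.-integrable `[z0, z1] (EFin \o (fun z => density z * expR (- (x * z)))).
Proof.
move=> qz0; apply: integrable_continuous_itv => z /andP[hz _].
by apply: weight_continuous; exact: lt_le_trans hz.
Qed.

Let integrable_weight x n : lebesgue_measure.-integrable (I n) (EFin \o weight x).
Proof. by apply: integrable_density_exp; rewrite ltrDl invr_gt0. Qed.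

Let I_cover : `]q, +oo[%classic = \bigcup_n I n.
Proof.
apply/seteqP; split => z /=.
  rewrite in_itv /= andbT => qz.
  exists (maxn (Num.truncn (z - q)^-1) (Num.truncn `|z - q|)) => //; rewrite /I /= in_itv /=.
  set N := maxn _ _; have zq : 0 < z - q by rewrite subr_gt0.
  have h1 : (z - q)^-1 < (Num.truncn (z - q)^-1).+1%:R := truncnS_gt _.
  have h2 : `|z - q| < (Num.truncn `|z - q|).+1%:R := truncnS_gt _.
  have g1 : (Num.truncn (z - q)^-1).+1%:R <= N.+1%:R :> R by rewrite ler_nat ltnS leq_maxl.
  have g2 : (Num.truncn `|z - q|).+1%:R <= N.+1%:R :> R by rewrite ler_nat ltnS leq_maxr.
  apply/andP; split; last first.
    have : z - q <= `|z - q| := ler_norm _.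
    have : N.+1%:R = 1 + N%:R :> R by rewrite -natr1 addrC.
    lra.
  rewrite addrC -lerBrDr -[leRHS]invrK lef_pV2 ?posrE ?invr_gt0//; lra.
by move=> [n _ /I_gt]; rewrite in_itv /= andbT.
Qed.

Lemma hitting_integralE x : hitting_integral psi phi lambda mu theta x =
  (\int[lebesgue_measure]_(z in `]q, +oo[) (density z * expR (- (x * z)))%:E)%E.
Proof.
apply: eq_integral => z _; congr EFin.
by rewrite expRD mulrC /density /scale [RHS]mulrAC; congr (_ * _); exact: mulrC.
Qed.

Lemma hitting_integral_ge0 x : (0 <= hitting_integral psi phi lambda mu theta x)%E.
Proof.
rewrite hitting_integralE; apply: integral_ge0 => z /=.
by rewrite in_itv /= andbT => qz; rewrite lee_fin ltW// weight_gt0.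
Qed.

Let weight_int x n : (\int[lebesgue_measure]_(z in I n) weight x z)%:E =
  (\int[lebesgue_measure]_(z in I n) (weight x z)%:E)%E.
Proof.
rewrite /Rintegral fineK//.
by apply: integrable_fin_num; [exact: measurable_itv|exact: integrable_weight].
Qed.

Let measurable_weight x : measurable_fun `]q, +oo[%classic (fun z => (weight x z)%:E).
Proof.
apply/measurable_EFinP; apply: open_continuous_measurable_fun; first exact: interval_open.
by move=> z; rewrite inE /= in_itv /= andbT => qz; exact: weight_continuous.
Qed.

Lemma hitting_integral_cvg x : (\int[lebesgue_measure]_(z in I n) weight x z)%:E @[n --> \oo] -->
  hitting_integral psi phi lambda mu theta x.
Proof.
rewrite hitting_integralE I_cover; under eq_fun do rewrite weight_int.
apply: ge0_nondecreasing_set_cvg_integral.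
- apply/nondecreasing_seqP => n; rewrite subsetEset => z; rewrite /I /= !in_itv /= => /andP[h1 h2].
  apply/andP; split.
    apply: le_trans h1; rewrite lerD2l lef_pV2 ?posrE//.
    by rewrite ler_nat.
  by apply: (le_trans h2); rewrite lerD2l ler_nat.
- by move=> n; exact: measurable_itv.
- by move=> n; exact: measurable_int (integrable_weight x n).
- by move=> n z /I_gt qz; rewrite lee_fin ltW// weight_gt0.
Qed.

(** On the compact interval [I 1] the continuous weight has a positive minimum. *)
Lemma hitting_integral_gt0 x : (0 < hitting_integral psi phi lambda mu theta x)%E.
Proof.
have h : ((\int[lebesgue_measure]_(z in I 1) weight x z)%:E <=
  hitting_integral psi phi lambda mu theta x)%E.
  rewrite hitting_integralE weight_int; apply: ge0_subset_integral => //; [exact: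
    measurable_itv|exact: measurable_weight| |].
  - by move=> z; rewrite /= in_itv /= andbT => qz; rewrite lee_fin ltW// weight_gt0.
  - by move=> z /I_gt qz; rewrite /= in_itv /= andbT.
apply: lt_le_trans h; rewrite lte_fin.
have le01 : q + 2%:R^-1 <= q + 1 + 1%:R by lra.
have cw : {within I 1, continuous (weight x)}.
  by apply/continuous_in_subspaceT => z; rewrite inE => /I_gt; exact: weight_continuous.
have [c cI cmin] := EVT_min le01 cw.
have wc : 0 < weight x c by apply: weight_gt0; apply: (@I_gt 1).
have : \int[lebesgue_measure]_(z in I 1) weight x c <= \int[lebesgue_measure]_(z in I 1) weight x z.
  apply: le_Rintegral; first exact: measurable_itv.
  - by apply: integrable_continuous_itv => z _; exact: cvg_cst.
  - exact: integrable_weight.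
  - by move=> z Iz; apply: cmin.
apply: lt_le_trans; rewrite Rintegral_cst; last exact: measurable_itv.
rewrite mulr_gt0// [X in fine X](_ : _ = (q + 1 + 1 - (q + 2^-1))%:E)/=; first by lra.
by apply: (etrans (lebesgue_measure_itv _)); rewrite /= lte_fin ifT//; lra.
Qed.

Section Finite.
Variables (a c M : R).
Hypotheses (ca : 0 <= c < a) (M0 : 0 <= M).
Hypothesis ratio : forall u, M <= u ->
  0 < psi u - mu /\ phi u + lambda <= c * (psi u - mu).

Lemma hitting_integral_lty : (hitting_integral psi phi lambda mu theta a < +oo)%E.
Proof.
have [C HC] := density_exp_bounded ca M0 ratio.
apply: (@le_lt_trans _ _ C%:E); last exact: ltry.
have := @hitting_integral_cvg a => cv.
rewrite -(cvg_lim _ cv)//; apply: lime_le; first by apply/cvg_ex;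
  exists (hitting_integral psi phi lambda mu theta a).
apply: nearW => n; rewrite lee_fin; apply: HC; first by rewrite ltrDl invr_gt0.
rewrite -addrA lerD2l (@le_trans _ _ 1)//; first by rewrite invf_le1// ler1n.
by rewrite lerDl.
Qed.

(** The second hypothesis is the integrated form of the differential equation in z. Along [I n] its
    right side vanishes, by [scale_near_root] on the left and [scale_exp_cvg0] on the right. *)
Lemma hitting_integral_ratio (x L C : R) : a <= x ->
  (forall z0 z1, q < z0 -> z0 <= z1 ->
    `|\int[lebesgue_measure]_(z in `[z0, z1])
       (density z * (expR (- (x * z)) - L * expR (- (a * z))))| <=
    C * (scale z0 + scale z1 * expR (- (a * z1)))) ->
  hitting_integral psi phi lambda mu theta x =
    (L%:E * hitting_integral psi phi lambda mu theta a)%E.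
Proof.
move=> ax H.
have fa := hitting_integral_lty.
have fa' : hitting_integral psi phi lambda mu theta a \is a fin_num.
  by rewrite ge0_fin_numE// hitting_integral_ge0.
pose E y n : R := \int[lebesgue_measure]_(z in I n) weight y z.
have I_le n : q + n.+1%:R^-1 <= q + 1 + n%:R.
  rewrite -addrA lerD2l (@le_trans _ _ 1)//; first by rewrite invf_le1// ler1n.
  by rewrite lerDl.
have dE n : `|E x n - L * E a n| <= C * (scale (q + n.+1%:R^-1) +
    scale (q + 1 + n%:R) * expR (- (a * (q + 1 + n%:R)))).
  have := H _ _ (_ : q < q + n.+1%:R^-1) (I_le n).
  rewrite ltrDl invr_gt0 ltr0Sn => /(_ isT); congr (`|_| <= _).
  rewrite /E -RintegralZl; [|exact: measurable_itv|exact: integrable_weight].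
  rewrite -RintegralB; [|exact: measurable_itv|exact: integrable_weight|]; last first.
    by apply: integrable_EFinZl; [exact: measurable_itv|exact: integrable_weight].
  by apply: eq_Rintegral => z _; rewrite /weight; ring.
have cv0 : E x n - L * E a n @[n --> \oo] --> 0.
  have C0 : 0 <= `|C| + 1 by rewrite addr_ge0.
  apply/cvgrPdist_le => /= e e0.
  have e'0 : 0 < e / (2 * (`|C| + 1)) by rewrite divr_gt0// mulr_gt0// ltr_wpDl.
  have [d d0 Hd] := scale_near_root e'0.
  have [Z HZ] := scale_exp_cvg0 ca M0 ratio e'0.
  near=> n; rewrite sub0r normrN; apply: (le_trans (dE n)).
  have h1 : scale (q + n.+1%:R^-1) < e / (2 * (`|C| + 1)).
    apply: Hd; first by rewrite ltrDl invr_gt0.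
    rewrite ltrD2l; near: n.
    by apply: (cvgr_lt (0 : R)) => //; exact: cvg_harmonic.
  have h2 : scale (q + 1 + n%:R) * expR (- (a * (q + 1 + n%:R))) < e / (2 * (`|C| + 1)).
    apply: HZ; last by rewrite -addrA ltrDl ltr_wpDr.
    rewrite -lerBlDl; near: n; exact: nbhs_infty_ger.
  have s0 := scale_gt0 (q + n.+1%:R^-1).
  have s1 : 0 <= scale (q + 1 + n%:R) * expR (- (a * (q + 1 + n%:R))).
    by rewrite mulr_ge0 ?expR_ge0// ltW// scale_gt0.
  move: (scale (q + n.+1%:R^-1)) (scale (q + 1 + n%:R) * _) h1 h2 s0 s1 => A B h1 h2 s0 s1.
  apply: (@le_trans _ _ ((`|C| + 1) * (2 * (e / (2 * (`|C| + 1)))))).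
    apply: (@le_trans _ _ ((`|C| + 1) * (A + B))); last by rewrite ler_wpM2l//; lra.
    by rewrite ler_wpM2r//; [lra|rewrite (le_trans (ler_norm _))// lerDl].
  by rewrite le_eqVlt; apply/orP; left; apply/eqP; field; rewrite gt_eqF// ltr_wpDl.
have ca' : E a n @[n --> \oo] --> fine (hitting_integral psi phi lambda mu theta a).
  have /fine_cvgP[_ h] : (E a n)%:E @[n --> \oo] -->
      (fine (hitting_integral psi phi lambda mu theta a))%:E.
    by rewrite fineK//; exact: hitting_integral_cvg.
  exact: h.
have cx : E x n @[n --> \oo] --> 0 + L * fine (hitting_integral psi phi lambda mu theta a).
  have -> : (fun n => E x n) = (fun n => (E x n - L * E a n) + L * E a n).
    by apply/funext => n; rewrite subrK.
  by apply: cvgD => //; apply: cvgMr.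
have := @hitting_integral_cvg x.
move=> /cvg_lim <-//; apply/cvg_lim => //.
rewrite -[X in (_ * X)%E]fineK// -EFinM -[X in X%:E]add0r.
by apply: cvg_EFin => //; exact: nearW.
Unshelve. all: by end_near. Qed.

End Finite.

(** The integrands increase as [a_] decreases, so monotone convergence applies, also when the
    integral at [a] is infinite, as may happen for a = v. *)
Lemma hitting_integral_right_continuous (a_ : nat -> R) (a : R) :
  nonincreasing_seq a_ -> a_ n @[n --> \oo] --> a ->
  hitting_integral psi phi lambda mu theta (a_ n) @[n --> \oo] -->
  hitting_integral psi phi lambda mu theta a.
Proof.
move=> ni cva; rewrite hitting_integralE.
under eq_fun do rewrite hitting_integralE.
have -> : (\int[lebesgue_measure]_(z in `]q, +oo[) (density z * expR (- (a * z)))%:E =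
  \int[lebesgue_measure]_(z in `]q, +oo[)
    limn (fun n => (density z * expR (- (a_ n * z)))%:E))%E.
  apply: eq_integral => z _; apply/esym/cvg_lim => //; apply: cvg_EFin; first exact: nearW.
  apply: cvgMr => //; apply: continuous_cvg; first exact: continuous_expR.
  by apply: cvgN; apply: cvgMl.
apply: cvg_monotone_convergence => //.
- by move=> n; exact: measurable_weight.
- by move=> n z; rewrite /= in_itv /= andbT => qz; rewrite lee_fin ltW// weight_gt0.
- move=> z; rewrite /= in_itv /= andbT => qz n m nm; rewrite lee_fin.
  rewrite ler_pM2l ?density_gt0// ler_expR lerN2 ler_wpM2r ?ni//.
  by rewrite (le_trans largest_root_ge0)// ltW.
Qed.

End Scale.

(** * Cumulant flow over a short time *)

(** The flow is given as differentiable for t > 0 and continuous up to 0, hence derivatives on the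
    open interval and continuity on the closed one. *)
Lemma within_derive_bounded (R : realType) (f df : R -> R) (a b c : R) : a <= b ->
  {within `[a, b], continuous f} ->
  (forall z : R, a < z < b -> is_derive z 1 f (df z)) ->
  (forall z : R, a < z < b -> `|df z| <= c) -> `|f b - f a| <= c * (b - a).
Proof.
rewrite le_eqVlt => /predU1P[<- _ _ _|ab cf dfz dfc]; first by rewrite !subrr normr0 mulr0.
have dfz' z : z \in `]a, b[ -> is_derive z 1 f (df z) by rewrite in_itv /=; exact: dfz.
have [z zab ->] := MVT ab dfz' cf.
rewrite normrM (gtr0_norm (_ : 0 < b - a)) ?subr_gt0//.
by rewrite ler_pM2r ?subr_gt0// dfc//; move: zab; rewrite in_itv.
Qed.

Section Flow.
Context {R : realType}.
Variables (psi phi : R -> R) (v : R -> R -> R).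
Hypothesis psi_lip : forall a b : R, 0 < a -> exists2 c : R, 0 <= c &
  forall x y, a <= x <= b -> a <= y <= b -> `|psi x - psi y| <= c * `|x - y|.
Hypothesis phi_lip : forall a b : R, 0 < a -> exists2 c : R, 0 <= c &
  forall x y, a <= x <= b -> a <= y <= b -> `|phi x - phi y| <= c * `|x - y|.
Hypothesis hv : cumulant_flow psi v.

Let v_within (z a b : R) : 0 < z -> 0 <= a -> {within `[a, b], continuous (fun t => v t z)}.
Proof.
move=> z0 a0; have [_ _ cv _] := hv z0.
apply: continuous_subspaceW cv => t /=; rewrite in_itv /= => /andP[at_ _].
exact: le_trans at_.
Qed.

(** A bootstrap: as long as the flow stays within [del] of z, its speed is at most B, so that it has
    moved by at most B s <= del / 2. By continuity it cannot leave the [del]-neighbourhood from its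
    inner half. *)
Lemma cumulant_flow_near (z0 z1 : R) : 0 < z0 ->
  exists B h0 : R, [/\ 0 <= B, 0 < h0, B * h0 <= Num.min (z0 / 2) 1 &
    forall z s : R, z0 <= z <= z1 -> 0 <= s <= h0 -> `|v s z - z| <= B * s].
Proof.
move=> z00; pose del : R := Num.min (z0 / 2) 1.
have del0 : 0 < del by rewrite lt_min divr_gt0//=.
have del1 : del <= z0 / 2 by rewrite ge_min lexx.
have del2 : del <= 1 by rewrite ge_min lexx orbT.
have z020 : 0 < z0 / 2 by rewrite divr_gt0.
have [l l0 Hl] := @psi_lip (z0 / 2) (z1 + 1) z020.
have [z10|z01] := ltP z1 z0.
  exists 0, 1; split => //; first by rewrite mul0r ltW.
  by move=> z s /andP[h1 h2]; lra.
pose B : R := `|psi z0| + l * (z1 + 1).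
have B0 : 0 <= B by rewrite addr_ge0// mulr_ge0//; lra.
have HB y : z0 / 2 <= y <= z1 + 1 -> `|psi y| <= B.
  move=> hy; have := Hl y z0 hy; have -> : z0 / 2 <= z0 <= z1 + 1 by lra.
  move=> /(_ isT) h; have : `|y - z0| <= z1 + 1 by rewrite ler_norml; lra.
  move=> h2; have h3 : l * `|y - z0| <= l * (z1 + 1) by rewrite ler_wpM2l.
  rewrite -[psi y](subrK (psi z0)); apply: (le_trans (ler_normD _ _)).
  by rewrite /B addrC lerD2l; exact: (le_trans h).
pose h0 : R := del / (2 * (B + 1)).
have h00 : 0 < h0 by rewrite divr_gt0// mulr_gt0// ltr_wpDl.
have Bh0 : B * h0 <= del / 2.
  have : (B + 1) * h0 = del / 2 by rewrite /h0; field; rewrite gt_eqF// ltr_wpDl.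
  lra.
exists B, h0; split => //; first by rewrite -/del; lra.
move=> z s /andP[zz0 zz1] /andP[s0 sh0].
have z_gt0 : 0 < z by lra.
have [vz0 vge0 vc vd] := hv z_gt0.
pose f (r : R) : R := `|v r z - z|.
have in_range r : f r < del -> z0 / 2 <= v r z <= z1 + 1.
  by rewrite /f ltr_norml => /andP[h1 h2]; apply/andP; split; lra.
have bound r : 0 <= r -> (forall t, 0 < t < r -> f t < del) -> f r <= B * r.
  move=> r0 hr; rewrite /f -[X in v r z - X]vz0 -[X in B * X]subr0.
  apply: (@within_derive_bounded _ (fun t => v t z) (fun t => - psi (v t z))) => //.
  - exact: v_within.
  - by move=> t /andP[t0 _]; exact: vd.
  - by move=> t ht; rewrite normrN; apply: HB; apply: in_range; exact: hr.
suff H : forall r, 0 <= r <= h0 -> f r < del.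
  by apply: bound => // t /andP[t0 ts]; apply: H; lra.
apply: contrapT => /existsNP[r1 /not_implyP[hr1 /negP]]; rewrite -leNgt => fr1.
pose A := [set r | 0 <= r <= h0 /\ del <= f r].
have A1 : A r1 by [].
have lbA : has_lbound A by exists 0 => r [/andP[]].
(* [m] would be the first time at distance [del]. At [m] the distance is at most del / 2, yet [A]
   contains times arbitrarily close to [m]. *)
pose m := inf A.
have m0 : 0 <= m by apply: lb_le_inf; [exists r1|move=> r [/andP[]]].
have mr1 : m <= r1 by apply: ge_inf.
have before r : 0 <= r -> r < m -> f r < del.
  move=> r0 rm; rewrite ltNge; apply/negP => fr.
  have : m <= r by apply: ge_inf => //; split => //; lra.
  by rewrite leNgt rm.
have fm : f m <= del / 2.
  apply: (@le_trans _ _ (B * m)); first by apply: bound => // t /andP[t0 tm]; apply: before =>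
    //; exact: ltW.
  by apply: le_trans Bh0; rewrite ler_wpM2l//; lra.
have cm : f r @[r --> within [set t : R | 0 <= t] (nbhs m)] --> f m.
  apply: cvg_norm; apply: cvgB; last exact: cvg_cst.
  exact: (subspace_continuousP _ _).1 vc m m0.
move/cvgrPdist_lt: cm => /(_ (del / 4)).
rewrite divr_gt0// => /(_ isT) [e /= e0 He].
have [r Ar rme] := inf_adherent e0 (conj (ex_intro _ r1 A1) lbA).
have mr : m <= r by apply: ge_inf.
have [/andP[r0 _] fr] := Ar.
have : `|f m - f r| < del / 4.
  by apply: He => //=; rewrite distrC ger0_norm ?subr_ge0// ltrBlDl.
by rewrite ltr_norml; lra.
Qed.

(** The constants are uniform in z because the expansion is integrated over an interval of z. C is a
    sum of Lipschitz constants times the speed bound [B] of the flow. *)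
Lemma cumulant_flow_estimate (z0 z1 : R) : 0 < z0 ->
  exists C h0 : R, [/\ 0 <= C, 0 < h0 & forall z h : R, z0 <= z <= z1 -> 0 < h <= h0 ->
    [/\ z0 / 2 <= v h z, `|v h z - z + h * psi z| <= C * h ^+ 2 &
     `|\int[lebesgue_measure]_(s in `[0, h]) phi (v s z) - h * phi z| <= C * h ^+ 2]].
Proof.
move=> z00; have [B [h0 [B0 h00 Bh0 HB]]] := cumulant_flow_near z1 z00.
have z020 : 0 < z0 / 2 by rewrite divr_gt0.
have [l l0 Hl] := @psi_lip (z0 / 2) (z1 + 1) z020.
have [k k0 Hk] := @phi_lip (z0 / 2) (z1 + 1) z020.
exists ((l + k) * B), h0; split => //; first by rewrite mulr_ge0// addr_ge0.
move=> z h /andP[zz0 zz1] /andP[hh0 hh1].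
have z_gt0 : 0 < z by lra.
have [vz0 vge0 vc vd] := hv z_gt0.
have HB' s : 0 <= s <= h -> `|v s z - z| <= B * h.
  move=> /andP[s0 sh]; apply: (@le_trans _ _ (B * s)); last by rewrite ler_wpM2l.
  by apply: HB; apply/andP; split; lra.
have Bhm : B * h <= Num.min (z0 / 2) 1.
  by apply: le_trans Bh0; rewrite ler_wpM2l.
have {}Bhm : B * h <= z0 / 2 /\ B * h <= 1 by move: Bhm; rewrite le_min => /andP[].
have rng s : 0 <= s <= h -> z0 / 2 <= v s z <= z1 + 1.
  by move=> hs; have := HB' s hs; rewrite ler_norml => /andP[h1 h2]; apply/andP; split; lra.
have rngz : z0 / 2 <= z <= z1 + 1 by apply/andP; split; lra.
split.
- by have /rng/andP[] : 0 <= h <= h by rewrite lexx ltW.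
- have cf : {within `[0, h], continuous (fun s => v s z + s * psi z)}.
    move=> s; apply: cvgD; first exact: v_within.
    exact: (continuous_subspaceT (@mulrr_continuous _ (psi z))).
  have := @within_derive_bounded _ (fun s => v s z + s * psi z)
    (fun s => - psi (v s z) + psi z) 0 h (l * (B * h)) (ltW hh0) cf.
  rewrite vz0 mul0r addr0 subr0 => H.
  have -> : v h z - z + h * psi z = v h z + h * psi z - z by ring.
  apply: (@le_trans _ _ (l * (B * h) * h)).
    apply: H => s /andP[s0 sh].
      apply: is_deriveD; first exact: vd.
      have := is_derive_mull (psi z) (is_derive_id s (1 : R)); rewrite mulr1.
      by under eq_fun do rewrite mulrC.
    rewrite addrC; have hs : 0 <= s <= h by rewrite !ltW.
    apply: (le_trans (Hl _ _ rngz (rng _ hs))).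
    by rewrite ler_wpM2l// distrC; exact: HB'.
  have : 0 <= k * B * h ^+ 2 by rewrite mulr_ge0 ?sqr_ge0// mulr_ge0.
  lra.
- have cphi : {within `[0, h], continuous (fun s => phi (v s z))}.
    apply/subspace_continuousP => s; rewrite /= in_itv /= => hs.
    have vs : 0 < v s z by have /andP[h1 _] := rng s hs; exact: lt_le_trans h1.
    have c1 := (subspace_continuousP _ _).1 (@v_within z 0 h z_gt0 (lexx 0)) s hs.
    exact: (cvg_comp _ phi c1 (locally_lipschitz_continuous phi_lip vs)).
  have iphi : lebesgue_measure.-integrable `[0, h] (EFin \o (fun s => phi (v s z))).
    by apply: continuous_compact_integrable => //; exact: segment_compact.
  have icst (c : R) : lebesgue_measure.-integrable `[0, h] (EFin \o (fun=> c)).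
    by apply: integrable_continuous_itv => s _; exact: cvg_cst.
  have Ecst (c : R) : \int[lebesgue_measure]_(s in `[0, h]) c = c * h.
    rewrite Rintegral_cst; last exact: measurable_itv.
    rewrite [X in fine X](_ : _ = h%:E)//.
    by apply: (etrans (lebesgue_measure_itv _)); rewrite /= lte_fin hh0 -EFinB subr0.
  have E : h * phi z = \int[lebesgue_measure]_(s in `[0, h]) phi z by rewrite Ecst mulrC.
  rewrite E -RintegralB; [|exact: measurable_itv|exact: iphi|exact: icst].
  have isub : lebesgue_measure.-integrable `[0, h] (EFin \o (fun s => phi (v s z) - phi z)).
    exact: (integrableB _ iphi (icst (phi z))).
  apply: (le_trans (le_normr_Rintegral _ isub)); first exact: measurable_itv.
  apply: (@le_trans _ _ (\int[lebesgue_measure]_(s in `[0, h]) (k * (B * h)))).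
    apply: le_Rintegral; [exact: measurable_itv|exact: integrable_norm|exact: icst|].
    move=> s; rewrite /= in_itv /= => hs.
    by apply: (le_trans (Hk _ _ (rng _ hs) rngz)); rewrite ler_wpM2l// HB'.
  rewrite Ecst; have : 0 <= l * B * h ^+ 2 by rewrite mulr_ge0 ?sqr_ge0// mulr_ge0.
  lra.
Qed.

End Flow.

(** * Expansion of the Laplace weight over one time step *)

Section OneStep.
Context {R : realType}.

(** [vh], [I], [p], [f] and [c] stand for v_h(z), the integral of Phi along the flow, Psi(z), Phi(z)
    and the capped state. The remainder grows like (1 + y)^2 h^2, and half of the decay exp (- z0 y)
    makes it uniform in the state y. *)
Lemma one_step_bound (z0 lambda mu B C : R) : 0 < z0 -> 0 <= lambda -> 0 <= mu ->
  0 <= B -> 0 <= C ->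
  exists K h0 : R, [/\ 0 <= K, 0 < h0 & forall h z y c vh I p f : R, 0 < h <= h0 -> z0 <= z ->
    0 <= c <= y -> `|p| <= B -> `|f| <= B ->
    `|vh - z + h * p| <= C * h ^+ 2 -> `|I - h * f| <= C * h ^+ 2 ->
    `|expR (- (lambda * h + mu * h * c)) * (expR (- (vh * y)) * expR (- I)) - expR (- (z * y)) -
      h * (expR (- (z * y)) * (y * p - mu * c - f - lambda))| <= K * h ^+ 2].
Proof.
(* [D] collects the coefficients of the exponent. With h D <= min (z0 / 2, 1), the exponent is at
   most 1 + z0 y / 2, which half of the decay compensates. *)
move=> z00 l0 mu0 B0 C0; pose D : R := lambda + mu + 2 * B + 2 * C + 1.
have D1 : 1 <= D by rewrite /D -!addrA; lra.
have D0 : 0 < D by lra.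
pose h0 : R := Num.min 1 (Num.min (z0 / 2) 1 / D).
have m0 : 0 < Num.min (z0 / 2) 1 by rewrite lt_min divr_gt0//=.
have h00 : 0 < h0 by rewrite lt_min ltr01/= divr_gt0.
pose S1 : R := (1 + 2 / (z0 / 2)) ^+ 2.
have S10 : 0 <= S1 by exact: sqr_ge0.
exists (D ^+ 2 * (expR 1 * S1) + 2 * C * S1), h0; split => //.
  apply: addr_ge0; last by apply: mulr_ge0 => //; apply: mulr_ge0.
  by apply: mulr_ge0; [exact: sqr_ge0|rewrite mulr_ge0 ?expR_ge0].
move=> h z y c vh I p f /andP[hh0 hh1] zz /andP[c0 cy] pB fB Hv HI.
have y0 : 0 <= y by lra.
have h1 : h <= 1 by apply: (le_trans hh1); rewrite ge_min lexx.
have hD : h * D <= z0 / 2 /\ h * D <= 1.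
  have : h * D <= Num.min (z0 / 2) 1.
    by rewrite -ler_pdivlMr//; apply: (le_trans hh1); rewrite ge_min lexx orbT.
  by rewrite le_min => /andP[].
(* [del] is the increment of the exponent over one step, [lin] its part of first order in h. *)
pose del := lambda * h + mu * h * c + (vh - z) * y + I.
pose lin := h * (lambda + mu * c - y * p + f).
have -> : expR (- (lambda * h + mu * h * c)) * (expR (- (vh * y)) * expR (- I)) =
    expR (- (z * y)) * expR (- del).
  by rewrite -!expRD; congr expR; rewrite /del; ring.
have -> : expR (- (z * y)) * expR (- del) - expR (- (z * y)) -
   h * (expR (- (z * y)) * (y * p - mu * c - f - lambda)) =
   expR (- (z * y)) * (expR (- del) - 1 + del) - expR (- (z * y)) * (del - lin).
  by rewrite /lin; ring.
have hh : 0 <= h ^+ 2 by exact: sqr_ge0.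
have E1 : `|del - lin| <= 2 * C * h ^+ 2 * (1 + y).
  have -> : del - lin = (vh - z + h * p) * y + (I - h * f) by rewrite /del /lin; ring.
  apply: (le_trans (ler_normD _ _)); rewrite normrM (ger0_norm y0).
  have : `|vh - z + h * p| * y <= C * h ^+ 2 * y by rewrite ler_wpM2r.
  have : 0 <= C * h ^+ 2 by rewrite mulr_ge0.
  have : 0 <= C * h ^+ 2 * y by rewrite mulr_ge0// mulr_ge0.
  lra.
have E2 : `|del| <= h * D * (1 + y).
  have -> : del = (del - lin) + lin by rewrite subrK.
  apply: (le_trans (ler_normD _ _)).
  have L : `|lin| <= h * (lambda + mu * y + y * B + B).
    rewrite normrM (gtr0_norm hh0) ler_pM2l//.
    apply: (le_trans (ler_normD _ _)); apply: lerD => //.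
    apply: (le_trans (ler_normB _ _)); apply: lerD.
      rewrite ger0_norm ?addr_ge0 ?mulr_ge0// lerD2l ler_wpM2l//.
    by rewrite normrM ger0_norm// ler_wpM2l.
  have : h ^+ 2 <= h by rewrite expr2 ler_piMl// ltW.
  move=> h2; have E1' : 2 * C * h ^+ 2 * (1 + y) <= h * (2 * C * (1 + y)).
    rewrite mulrAC [leRHS]mulrC ler_wpM2l// mulr_ge0//; lra.
  apply: (le_trans (lerD (le_trans E1 E1') L)).
  rewrite -(mulrDr h) -(mulrA h D) ler_pM2l// /D.
  have : 0 <= mu + B + 1 + lambda * y + B * y + y by rewrite !addr_ge0 ?mulr_ge0.
  lra.
have ez : expR (- (z * y)) <= expR (- (z0 * y)).
  by rewrite ler_expR lerN2 ler_wpM2r.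
have S1y : (1 + y) ^+ 2 * expR (- (z0 / 2 * y)) <= S1.
  by apply: sqr_expRN_le; rewrite ?divr_gt0.
have ez2 : expR (- (z0 * y)) = expR (- (z0 / 2 * y)) * expR (- (z0 / 2 * y)).
  by rewrite -expRD; congr expR; field.
have e21 : expR (- (z0 / 2 * y)) <= 1 by rewrite expR_le1 oppr_le0 mulr_ge0// divr_ge0// ltW.
have e20 := expR_ge0 (- (z0 / 2 * y)).
rewrite mulrDl; apply: (le_trans (ler_normB _ _)); apply: lerD.
  rewrite normrM (ger0_norm (expR_ge0 _)).
  apply: (@le_trans _ _ (expR (- (z0 * y)) * ((h * D * (1 + y)) ^+ 2 * expR (h * D * (1 + y))))).
    rewrite ler_pM ?expR_ge0//; apply: (le_trans (expRN_remainder2_abs _)).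
    rewrite ler_pM ?sqr_ge0 ?expR_ge0// ?ler_expR//.
    by rewrite -[del ^+ 2]real_normK ?num_real// ler_pXn2r ?nnegrE// mulr_ge0//;
      [rewrite mulr_ge0// ltW|lra].
  have e3 : expR (h * D * (1 + y)) <= expR 1 * expR (z0 / 2 * y).
    rewrite -expRD ler_expR mulrDr mulr1; apply: lerD; first exact: hD.2.
    by rewrite ler_wpM2r// hD.1.
  have e4 : expR (z0 / 2 * y) * expR (- (z0 / 2 * y)) = 1 by rewrite expRxMexpNx_1.
  apply: (@le_trans _ _ (expR (- (z0 * y)) * ((h * D * (1 + y)) ^+ 2 * (expR 1 * expR (z0 / 2 * y))))).
    by rewrite ler_wpM2l ?expR_ge0// ler_wpM2l ?sqr_ge0.
  have -> : expR (- (z0 * y)) * ((h * D * (1 + y)) ^+ 2 * (expR 1 * expR (z0 / 2 * y))) =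
    D ^+ 2 * (expR 1 * ((1 + y) ^+ 2 * expR (- (z0 / 2 * y)))) * h ^+ 2 *
      (expR (z0 / 2 * y) * expR (- (z0 / 2 * y))).
    by rewrite ez2; ring.
  rewrite e4 mulr1 ler_wpM2r// ler_wpM2l ?sqr_ge0// ler_wpM2l ?expR_ge0//.
rewrite normrM (ger0_norm (expR_ge0 _)).
apply: (@le_trans _ _ (expR (- (z0 / 2 * y)) * (2 * C * h ^+ 2 * (1 + y)))).
  rewrite ler_pM ?expR_ge0//; apply: (le_trans ez); rewrite ez2.
  by rewrite ler_piMl.
have -> : expR (- (z0 / 2 * y)) * (2 * C * h ^+ 2 * (1 + y)) =
  2 * C * ((1 + y) * expR (- (z0 / 2 * y))) * h ^+ 2 by ring.
rewrite ler_wpM2r// ler_wpM2l ?mulr_ge0//; apply: le_trans S1y.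
by rewrite ler_wpM2r// expr2 ler_peMl//; lra.
Qed.

End OneStep.

(** * Weights measurable for a sub-sigma-algebra *)

Section MonotoneClass.
Context d (T : measurableType d) (R : realType).
Local Open Scope ereal_scope.
Import HBNNSimple.

(** The monotone class argument as an induction principle. It is applied once to a sub-sigma-algebra
    and once to the Borel sets of the extended line. *)
Lemma ge0_mfun_ind (C : (T -> \bar R) -> Prop) :
  (forall A, measurable A -> C (fun x => (\1_A x)%:E)) ->
  (forall (k : R) f, (0 <= k)%R -> measurable_fun setT f -> (forall x, 0 <= f x) ->
     C f -> C (fun x => k%:E * f x)) ->
  (forall f g, measurable_fun setT f -> measurable_fun setT g ->
     (forall x, 0 <= f x) -> (forall x, 0 <= g x) -> C f -> C g -> C (fun x => f x + g x)) ->
  (forall (f_ : (T -> \bar R)^nat) f, (forall n, measurable_fun setT (f_ n)) ->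
     (forall n x, 0 <= f_ n x) -> (forall x, nondecreasing_seq (f_ ^~ x)) ->
     (forall x, f_ ^~ x @ \oo --> f x) -> (forall n, C (f_ n)) -> C f) ->
  forall f, measurable_fun setT f -> (forall x, 0 <= f x) -> C f.
Proof.
move=> Cind Cscale Cadd Clim f mf f0.
pose f_ := nnsfun_approx measurableT mf.
have Csimple (g : {nnsfun T >-> R}) : C (EFin \o g).
  pose s : seq R := finmap.enum_fset (fset_set (range g)).
  have -> : EFin \o g = (fun x => \sum_(i < size s) (s`_i)%:E * (\1_(g @^-1` [set s`_i]) x)%:E).
    apply/funext => x /=; rewrite fimfunEord -sumEFin.
    by apply: eq_bigr => i _; rewrite EFinM.
  have s0 (i : 'I_(size s)) : (0 <= s`_i)%R.
    have si : s`_i \in s by apply: mem_nth.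
    have : s`_i \in range g by rewrite -(in_fset_set (fimfunP g)); exact: si.
    by move=> /set_mem[x _ <-].
  have mA (i : 'I_(size s)) : measurable (g @^-1` [set s`_i]) by apply: measurable_sfunP.
  (* Measurability and nonnegativity of the partial sums are carried along because [Cadd] asks for
     them. *)
  have H (r : seq 'I_(size s)) : measurable_fun setT
       (fun x => \sum_(i <- r) (s`_i)%:E * (\1_(g @^-1` [set s`_i]) x)%:E) /\
     (forall x, 0 <= \sum_(i <- r) (s`_i)%:E * (\1_(g @^-1` [set s`_i]) x)%:E) /\
     C (fun x => \sum_(i <- r) (s`_i)%:E * (\1_(g @^-1` [set s`_i]) x)%:E).
    elim: r => [|i r [mr [r0 Cr]]].
      under eq_fun do rewrite big_nil; split; first exact: measurable_cst.
      split => [x|]; first by rewrite big_nil.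
      have -> : (fun=> 0) = (fun x => 0%:E * (\1_(@set0 T) x)%:E) :> (T -> \bar R).
        by apply/funext => x; rewrite mul0e.
      by apply: Cscale => //; [exact/measurable_EFinP|exact: Cind].
    have mi : measurable_fun setT (fun x => (s`_i)%:E * (\1_(g @^-1` [set s`_i]) x)%:E).
      apply: emeasurable_funM; first exact: measurable_cst.
      by apply/measurable_EFinP; exact: measurable_indic.
    have i0 x : 0 <= (s`_i)%:E * (\1_(g @^-1` [set s`_i]) x)%:E.
      by rewrite mule_ge0// lee_fin.
    split; first by under eq_fun do rewrite big_cons; exact: emeasurable_funD.
    split => [x|]; first by rewrite big_cons adde_ge0.
    under eq_fun do rewrite big_cons; apply: Cadd => //.
    apply: Cscale => //; [|exact: Cind].
    by apply/measurable_EFinP; exact: measurable_indic.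
  exact: (H (index_enum _)).2.2.
apply: (Clim (fun n => EFin \o f_ n)) => //.
- by move=> n; exact/measurable_EFinP.
- by move=> n x; rewrite lee_fin.
- by move=> x m n mn; rewrite lee_fin; exact/lefP/nd_nnsfun_approx.
- by move=> x; apply: cvg_nnsfun_approx => //= y _; exact: f0.
Qed.

Lemma ge0_cvg_integral (mu : {measure set T -> \bar R}) (D : set T) (f_ : (T -> \bar R)^nat) f :
  measurable D -> (forall n, measurable_fun D (f_ n)) -> (forall n x, 0 <= f_ n x) ->
  (forall x, nondecreasing_seq (f_ ^~ x)) -> (forall x, f_ ^~ x @ \oo --> f x) ->
  \int[mu]_(x in D) f_ n x @[n --> \oo] --> \int[mu]_(x in D) f x.
Proof.
move=> mD mf f0 fn ff.
have -> : \int[mu]_(x in D) f x = \int[mu]_(x in D) limn (f_ ^~ x).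
  by apply: eq_integral => x _; apply/esym/cvg_lim => //; exact: ff.
by apply: cvg_monotone_convergence => // x _; exact: fn.
Qed.

End MonotoneClass.

(** [f1] and [f2] have the same conditional expectation given the sigma-algebra generated by [G];
    here it is tested against a weight measurable for that sigma-algebra rather than against an
    event. *)
Lemma sub_sigma_algebra_weight d (T : measurableType d) (R : realType)
    (G : set (set T)) (mu : {measure set T -> \bar R}) (f1 f2 : T -> R)
    (Z : T -> \bar R) :
  (forall A, <<s G >> A -> measurable A) ->
  measurable_fun setT f1 -> measurable_fun setT f2 ->
  (forall x, 0 <= f1 x) -> (forall x, 0 <= f2 x) ->
  (forall A, <<s G >> A -> \int[mu]_(x in A) (f1 x)%:E = \int[mu]_(x in A) (f2 x)%:E)%E ->
  measurable_fun [set: g_sigma_algebraType G] (Z : g_sigma_algebraType G -> \bar R) ->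
  (forall x, (0 <= Z x)%E) ->
  (\int[mu]_x (Z x * (f1 x)%:E) = \int[mu]_x (Z x * (f2 x)%:E))%E.
Proof.
move=> GT mf1 mf2 f10 f20 f12 mZ Z0.
have {}mf1 : measurable_fun setT (EFin \o f1) by exact/measurable_EFinP.
have {}mf2 : measurable_fun setT (EFin \o f2) by exact/measurable_EFinP.
have sub (h : T -> \bar R) : measurable_fun [set: g_sigma_algebraType G] (h :
  g_sigma_algebraType G -> \bar R) ->
    measurable_fun [set: T] h.
  move=> mh _ B mB; have := mh measurableT B mB; rewrite !setTI => h1.
  exact: GT.
have H := @ge0_mfun_ind _ (g_sigma_algebraType G) R
  (fun h : T -> \bar R => \int[mu]_x (h x * (f1 x)%:E) = \int[mu]_x (h x * (f2 x)%:E))%E.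
apply: H => //.
- move=> A mA; have := f12 A mA; rewrite integral_mkcond [in X in _ = X -> _]integral_mkcond.
  congr (_ = _); apply: eq_integral => x _; rewrite patchE indicE;
    by case: (x \in A); rewrite ?mul1e ?mul0e.
- move=> k h k0 /sub mh h0 E.
  under eq_integral do rewrite -muleA.
  under [RHS]eq_integral do rewrite -muleA.
  rewrite !ge0_integralZl//.
  + by congr (_ * _)%E.
  + by apply: emeasurable_funM.
  + by move=> x _; rewrite mule_ge0 ?lee_fin.
  + by apply: emeasurable_funM.
  + by move=> x _; rewrite mule_ge0 ?lee_fin.
- move=> h g /sub mh /sub mg h0 g0 Eh Eg.
  under eq_integral do rewrite ge0_muleDl//.
  under [RHS]eq_integral do rewrite ge0_muleDl//.
  rewrite !ge0_integralD//; try by [apply: emeasurable_funM|move=> x _; rewrite mule_ge0 ?lee_fin].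
  by congr (_ + _)%E.
- move=> h_ h mh h0 nh hh E.
  have L (f : T -> R) : measurable_fun setT (EFin \o f) -> (forall x, 0 <= f x) ->
      (\int[mu]_x (h_ n x * (f x)%:E) @[n --> \oo] --> \int[mu]_x (h x * (f x)%:E))%E.
    move=> mf f0; apply: ge0_cvg_integral => //.
    + by move=> n; apply: emeasurable_funM => //; exact: sub.
    + by move=> n x; rewrite mule_ge0 ?lee_fin.
    + by move=> x m n mn; rewrite lee_wpmul2r ?lee_fin// nh.
    + by move=> x; exact: cvgeZr.
  have := L f1 mf1 f10; under eq_fun do rewrite E.
  by move=> /cvg_lim <-//; apply/cvg_lim => //; exact: L.
Qed.

(** * Exponential and truncation on [0, +oo] *)

Section LaplaceKernel.
Context {R : realType}.

(* [lexp 0 +oo = 0], whereas [expeR (- (0 * +oo)) = 1]. *)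
Definition lexp (z : R) (y : \bar R) : R := if y is r%:E then expR (- (z * r)) else 0.
Definition ecap (K : R) (y : \bar R) : R := if y is r%:E then Num.min r K else K.

Lemma lexp_ge0 z y : 0 <= lexp z y.
Proof. by case: y => //= r; rewrite expR_ge0. Qed.

Lemma lexp_le1 z y : 0 <= z -> (0 <= y)%E -> lexp z y <= 1.
Proof.
move=> z0; case: y => //= r; rewrite lee_fin => r0.
by rewrite expR_le1 oppr_le0 mulr_ge0.
Qed.

Lemma expeR_lexp z y : 0 < z -> (0 <= y)%E -> expeR (- (z%:E * y)) = (lexp z y)%:E.
Proof. by move=> z0; case: y => //= _; rewrite gt0_muley ?lte_fin. Qed.

Lemma ecap_ge0 K y : 0 <= K -> (0 <= y)%E -> 0 <= ecap K y.
Proof. by move=> K0; case: y => //= r; rewrite lee_fin => r0; rewrite le_min r0. Qed.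

Lemma ecap_le K y : ecap K y <= K.
Proof. by case: y => //= r; rewrite ge_min lexx orbT. Qed.

Lemma measurable_lexp z : measurable_fun [set: \bar R] (lexp z).
Proof.
have -> : lexp z = (fun y => expR (- (z * fine y)) * \1_(~` ([set +oo%E] `|` [set -oo%E])) y).
  apply/funext => -[r| |] /=; rewrite indicE.
  - by rewrite mem_set ?mulr1//= => -[].
  - by rewrite memNset ?mulr0//= => /(_ (or_introl erefl)).
  - by rewrite memNset ?mulr0//= => /(_ (or_intror erefl)).
apply: measurable_funM.
  apply: measurableT_comp => //; apply: measurableT_comp => //.
  by apply: measurable_funM => //; exact: fine_measurable.
by apply: measurable_indic; apply: measurableC; exact: measurableU.
Qed.

Lemma measurable_ecap K : measurable_fun [set: \bar R] (ecap K).
Proof.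
have -> : ecap K = (fun y => if y \in ([set +oo%E] `|` [set -oo%E] :
  set (\bar R)) then K else Num.min (fine y) K).
  apply/funext => -[r| |] /=.
  - by rewrite memNset//= => -[].
  - by rewrite mem_set//; left.
  - by rewrite mem_set//; right.
apply: measurable_fun_if => //.
- apply: (measurable_fun_bool true); rewrite setTI.
  rewrite [X in measurable X](_ : _ = [set +oo%E] `|` [set -oo%E]); first exact: measurableU.
  by apply/seteqP; split => y /= h; [exact: set_mem h|exact: mem_set h].
- by apply: measurable_funTS; apply: measurable_minr => //; exact: fine_measurable.
Qed.

Lemma lexp_cvg z (F : nat -> \bar R) (l : \bar R) : 0 < z -> (forall n, (0 <= F n)%E) ->
  (0 <= l)%E -> F n @[n --> \oo] --> l -> lexp z (F n) @[n --> \oo] --> lexp z l.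
Proof.
move=> z0 F0; case: l => [r r0|_|//] Fl.
  have /fine_cvgP[Ffin Ffine] := Fl.
  have : expR (- (z * fine (F n))) @[n --> \oo] --> expR (- (z * r)).
    by apply: continuous_cvg; [exact: continuous_expR|apply: cvgN; exact: cvgMr].
  apply: cvg_trans; apply: near_eq_cvg; near=> n.
  have : F n \is a fin_num by near: n.
  by case: (F n).
apply/cvgrPdist_lt => /= e e0; near=> n.
have /= : ((- ln e / z)%:E < F n)%E by near: n; move/cvgeyPgt : Fl; apply.
have := F0 n; case: (F n) => //= [r _|_ _]; last by rewrite subrr normr0.
rewrite lte_fin ltr_pdivrMr// => h.
rewrite sub0r normrN ger0_norm ?expR_ge0// -[ltRHS]lnK ?posrE// ltr_expR; lra.
Unshelve. all: by end_near. Qed.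

Lemma ecap_cvg K (F : nat -> \bar R) (l : \bar R) : 0 <= K -> (forall n, (0 <= F n)%E) ->
  (0 <= l)%E -> F n @[n --> \oo] --> l -> ecap K (F n) @[n --> \oo] --> ecap K l.
Proof.
move=> K0 F0; case: l => [r r0|_|//] Fl.
  have /fine_cvgP[Ffin Ffine] := Fl.
  have : Num.min (fine (F n)) K @[n --> \oo] --> Num.min r K.
    under eq_fun do rewrite minr_absE; rewrite minr_absE.
    apply: cvgMl; apply: cvgB; first by apply: cvgD => //; exact: cvg_cst.
    by apply: cvg_norm; apply: cvgB => //; exact: cvg_cst.
  apply: cvg_trans; apply: near_eq_cvg; near=> n.
  have : F n \is a fin_num by near: n.
  by case: (F n).
apply: cvg_near_cst; near=> n.
have /= : (K%:E < F n)%E by near: n; move/cvgeyPgt : Fl; apply.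
have := F0 n; case: (F n) => //= r _; rewrite lte_fin => h.
by apply/min_idPr; exact: ltW.
Unshelve. all: by end_near. Qed.

End LaplaceKernel.

(** * The Markov property for functions of the state *)

Section Markov.
Context (R : realType) d (T : measurableType d).
Variables (Pr : \bar R -> probability T R) (X : R -> T -> \bar R).
Hypothesis hM : markov_process Pr X.
Hypothesis X0 : forall (t : R) w, 0 <= t -> (0 <= X t w)%E.

Lemma natural_filtration_measurable s A : natural_filtration X s A -> measurable A.
Proof.
move=> FA; apply: (FA measurable); split; first exact: sigma_algebra_measurable.
move=> _ [u [B [/andP[u0 us] mB ->]]]; rewrite -[X in measurable X]setTI.
exact: (markov_measurable hM u0).
Qed.

Lemma markov_expectation (y : \bar R) (s t : R) (A : set T) (g : \bar R -> \bar R) :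
  (0 <= y)%E -> 0 <= s -> 0 <= t -> natural_filtration X s A ->
  measurable_fun setT g -> (forall z, (0 <= g z)%E) ->
  (\int[Pr y]_(w in A) g (X (s + t) w) =
   \int[Pr y]_(w in A) \int[Pr (X s w)]_w' g (X t w'))%E.
Proof.
move=> y0 s0 t0 FA mg g0.
have mA := natural_filtration_measurable FA.
have mX u : 0 <= u -> measurable_fun setT (X u) := markov_measurable hM (t := u).
have mXst := mX _ (addr_ge0 s0 t0); have mXt := mX _ t0; have mXs := mX _ s0.
have mgX (h : \bar R -> \bar R) u : 0 <= u -> measurable_fun setT h ->
  measurable_fun setT (fun w => h (X u w)).
  by move=> u0 mh; exact: measurableT_comp mh (mX _ u0).
(* Measurability of the inner integral is proved in the same induction, because additivity and
   monotone limits of the outer integral rely on it. *)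
suff H : measurable_fun setT (fun w => \int[Pr (X s w)]_w' g (X t w'))%E /\
  (\int[Pr y]_(w in A) g (X (s + t) w) =
   \int[Pr y]_(w in A) \int[Pr (X s w)]_w' g (X t w'))%E by exact: H.2.
move: g mg g0; apply: ge0_mfun_ind.
- move=> B mB.
  have E w : (\int[Pr (X s w)]_w' (\1_B (X t w'))%:E = Pr (X s w) (X t @^-1` B))%E.
    transitivity (\int[Pr (X s w)]_w' (\1_(X t @^-1` B) w')%:E)%E; first exact: eq_integral.
    by rewrite integral_indic ?setIT// -[X in measurable X]setTI; exact: mXt.
  under eq_fun do rewrite E.
  split.
    have mk := markov_kernel hM t0 mB.
    apply: (measurable_comp (F := [set y : \bar R | (0 <= y)%E]) _ _ mk) => //.
    + rewrite [X in measurable X](_ : _ = [set` `[0%E, +oo[%O] `|` [set +oo%E])//.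
        apply: measurableU; [exact: emeasurable_itv|exact: emeasurable_set1].
      apply/seteqP; split => z /=; rewrite in_itv /= andbT.
        by left.
      by case => [//|->].
    + by move=> _ [w _ <-] /=; exact: X0.
  rewrite -(markov_property hM y0 s0 t0 FA mB) setIC.
  transitivity (\int[Pr y]_(w in A) (\1_(X (s + t) @^-1` B) w)%:E)%E; first exact: eq_integral.
  by rewrite integral_indic// -[X in measurable X]setTI; exact: mXst.
- move=> k f k0 mf f0 [mI E].
  have Ek w : (\int[Pr (X s w)]_w' (k%:E * f (X t w')) = k%:E * \int[Pr (X s w)]_w' f (X t w'))%E.
    by rewrite ge0_integralZl//; exact: mgX.
  under eq_fun do rewrite Ek.
  split; first exact: emeasurable_funM.
  rewrite !ge0_integralZl// ?E//.
  + exact: measurable_funTS.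
  + by move=> w _; exact: integral_ge0.
  + by apply: measurable_funTS; apply: mgX => //; exact: addr_ge0.
- move=> f g mf mg f0 g0 [mIf Ef] [mIg Eg].
  have Ek w : (\int[Pr (X s w)]_w' (f (X t w') + g (X t w')) =
     \int[Pr (X s w)]_w' f (X t w') + \int[Pr (X s w)]_w' g (X t w'))%E.
    by rewrite ge0_integralD//; exact: mgX.
  under eq_fun do rewrite Ek.
  split; first exact: emeasurable_funD.
  have mfX : measurable_fun A (fun w => f (X (s + t) w)).
    by apply: measurable_funTS; apply: mgX => //; exact: addr_ge0.
  have mgX' : measurable_fun A (fun w => g (X (s + t) w)).
    by apply: measurable_funTS; apply: mgX => //; exact: addr_ge0.
  have If0 w : (0 <= \int[Pr (X s w)]_w' f (X t w'))%E by exact: integral_ge0.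
  have Ig0 w : (0 <= \int[Pr (X s w)]_w' g (X t w'))%E by exact: integral_ge0.
  rewrite (ge0_integralD _ mA)// Ef Eg.
  by rewrite [RHS](ge0_integralD _ mA)//; exact: measurable_funTS.
- move=> f_ f mf f0 fn ff IH.
  have cI w : (\int[Pr (X s w)]_w' f_ n (X t w') @[n --> \oo] --> \int[Pr (X s w)]_w' f (X t w'))%E.
    by apply: ge0_cvg_integral => // n; exact: mgX.
  split.
    apply: (emeasurable_fun_cvg (fun n w => \int[Pr (X s w)]_w' f_ n (X t w'))%E).
      by move=> n; exact: (IH n).1.
    by move=> w _; exact: cI.
  have c1 : (\int[Pr y]_(w in A) f_ n (X (s + t) w) @[n --> \oo] --> \int[Pr y]_(w in A) f (X (s
    + t) w))%E.
    apply: ge0_cvg_integral => // n.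
    by apply: measurable_funTS; apply: mgX => //; exact: addr_ge0.
  have c2 : (\int[Pr y]_(w in A) \int[Pr (X s w)]_w' f_ n (X t w') @[n --> \oo] -->
             \int[Pr y]_(w in A) \int[Pr (X s w)]_w' f (X t w'))%E.
    apply: ge0_cvg_integral => //.
    + by move=> n; apply: measurable_funTS; exact: (IH n).1.
    + by move=> n w; exact: integral_ge0.
    + move=> w m n mn; apply: ge0_le_integral => //; try exact: mgX.
      by move=> w' _; exact: fn.
  rewrite -(cvg_lim _ c1)// -(cvg_lim _ c2)//; congr (limn _).
  by apply/funext => n; exact: (IH n).2.
Qed.

End Markov.

(** * Discretised martingale identity *)

Section BoundedExpectation.
Context d (T : measurableType d) (R : realType) (P : probability T R).
Implicit Types f g : T -> R.

Definition bounded_mfun f := measurable_fun setT f /\ exists C : R, forall w, `|f w| <= C.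

Lemma bounded_mfun_integrable f : bounded_mfun f -> P.-integrable setT (EFin \o f).
Proof.
move=> [mf [C fC]]; apply: measurable_bounded_integrable => //.
  by apply: le_lt_trans (probability_le1 P measurableT) _; exact: ltry.
exists C; split; first exact: num_real.
by move=> M CM w _ /=; exact: (le_trans (fC w) (ltW CM)).
Qed.

Lemma bounded_mfunM f g : bounded_mfun f -> bounded_mfun g -> bounded_mfun (fun w => f w * g w).
Proof.
move=> [mf [C fC]] [mg [D gD]]; split; first exact: measurable_funM.
by exists (C * D) => w; rewrite normrM ler_pM.
Qed.

Lemma bounded_mfunD f g : bounded_mfun f -> bounded_mfun g -> bounded_mfun (fun w => f w + g w).
Proof.
move=> [mf [C fC]] [mg [D gD]]; split; first exact: measurable_funD.
by exists (C + D) => w; apply: (le_trans (ler_normD _ _)); exact: lerD.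
Qed.

Lemma bounded_mfun_cst (c : R) : bounded_mfun (fun=> c).
Proof. by split; [exact: measurable_cst|exists `|c|]. Qed.

Lemma bounded_mfunB f g : bounded_mfun f -> bounded_mfun g -> bounded_mfun (fun w => f w - g w).
Proof.
move=> [mf [C fC]] [mg [D gD]]; split; first exact: measurable_funB.
by exists (C + D) => w; apply: (le_trans (ler_normB _ _)); exact: lerD.
Qed.

Lemma bounded_mfun_sum n (F : nat -> T -> R) :
  (forall k, (k < n)%N -> bounded_mfun (F k)) -> bounded_mfun (fun w => \sum_(k < n) F k w).
Proof.
elim: n => [_|n IH H]; first by under eq_fun do rewrite big_ord0; exact: bounded_mfun_cst.
under eq_fun do rewrite big_ord_recr; apply: bounded_mfunD; last exact: H.
by apply: IH => k kn; apply: H; exact: ltnW.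
Qed.

Lemma expectation_sum n (F : nat -> T -> R) : (forall k, (k < n)%N -> bounded_mfun (F k)) ->
  \int[P]_w (\sum_(k < n) F k w) = \sum_(k < n) \int[P]_w F k w.
Proof.
elim: n => [_|n IH H].
  rewrite big_ord0 (@eq_Rintegral _ _ _ _ _ (fun=> 0)) ?Rintegral_cst ?mul0r// => w _.
  by rewrite big_ord0.
rewrite big_ord_recr/= -IH => [|k kn]; last by apply: H; exact: ltnW.
rewrite -RintegralD//.
- by apply: eq_Rintegral => w _; rewrite big_ord_recr.
- apply: bounded_mfun_integrable; apply: bounded_mfun_sum => k kn; apply: H; exact: ltnW.
- by apply: bounded_mfun_integrable; exact: H.
Qed.

Lemma expectation_cst (c : R) : \int[P]_w c = c.
Proof.
rewrite Rintegral_cst// (_ : fine _ = 1) ?mulr1//.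
by have := @probability_setT _ _ _ P => /= ->.
Qed.

Lemma expectation_le f g : bounded_mfun f -> bounded_mfun g -> (forall w, f w <= g w) ->
  \int[P]_w f w <= \int[P]_w g w.
Proof. by move=> bf bg fg; apply: le_Rintegral => //; exact: bounded_mfun_integrable. Qed.

Lemma expectation_norm_le f g : bounded_mfun f -> bounded_mfun g -> (forall w, `|f w| <= g w) ->
  `|\int[P]_w f w| <= \int[P]_w g w.
Proof.
move=> bf bg fg; apply: (le_trans (le_normr_Rintegral _ (bounded_mfun_integrable bf))) => //.
apply: le_Rintegral => //; last exact: bounded_mfun_integrable.
by apply: integrable_norm; exact: bounded_mfun_integrable.
Qed.

Lemma expectation_bounded f (c : R) : bounded_mfun f -> (forall w, `|f w| <= c) ->
  `|\int[P]_w f w| <= c.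
Proof.
move=> bf fc; rewrite -[leRHS]expectation_cst; apply: expectation_norm_le => //.
exact: bounded_mfun_cst.
Qed.

Lemma expectationD f g : bounded_mfun f -> bounded_mfun g ->
  \int[P]_w (f w + g w) = \int[P]_w f w + \int[P]_w g w.
Proof. by move=> bf bg; apply: RintegralD => //; exact: bounded_mfun_integrable. Qed.

Lemma expectationB f g : bounded_mfun f -> bounded_mfun g ->
  \int[P]_w (f w - g w) = \int[P]_w f w - \int[P]_w g w.
Proof. by move=> bf bg; apply: RintegralB => //; exact: bounded_mfun_integrable. Qed.

Lemma expectationZ (c : R) f : bounded_mfun f -> \int[P]_w (c * f w) = c * \int[P]_w f w.
Proof. by move=> bf; apply: RintegralZl => //; exact: bounded_mfun_integrable. Qed.

Lemma bounded_convergence (f_ : nat -> T -> R) f (C : R) :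
  (forall n, measurable_fun setT (f_ n)) -> (forall n w, `|f_ n w| <= C) ->
  (forall w, f_ n w @[n --> \oo] --> f w) ->
  bounded_mfun f /\ \int[P]_w f_ n w @[n --> \oo] --> \int[P]_w f w.
Proof.
move=> mf fC ff.
have mlim : measurable_fun setT f by apply: (measurable_fun_cvg mf) => // w _; exact: ff.
have bf : bounded_mfun f.
  split => //; exists C => w.
  have h : `|f_ n w| @[n --> \oo] --> `|f w| by apply: cvg_norm; exact: ff.
  rewrite -(cvg_lim _ h)//; apply: limr_le; first by apply/cvg_ex; exists `|f w|.
  exact: nearW.
split => //.
have cE : (\int[P]_w (f_ n w)%:E @[n --> \oo] --> \int[P]_w (f w)%:E)%E.
  apply: (@dominated_cvg _ _ _ _ _ measurableT _ _ (EFin \o (fun=> C))) => //.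
  - by move=> n; exact/measurable_EFinP.
  - by move=> w _; apply: cvg_EFin; [exact: nearW|exact: ff].
  - exact: (bounded_mfun_integrable (bounded_mfun_cst C)).
  - by move=> n w _; rewrite lee_fin.
move: cE; have -> : (\int[P]_w (f w)%:E)%E = (\int[P]_w f w)%:E.
  by rewrite /Rintegral fineK//; apply: integrable_fin_num => //; exact: bounded_mfun_integrable.
by move/fine_cvgP => [_].
Qed.

End BoundedExpectation.

(** Summing over a fixed range, with the indicator of j < k, allows expectations of a stopped value
    to be taken term by term, each indicator being known at step j. *)
Lemma stopped_telescope (R : realType) (Y : nat -> R) (k N : nat) : (k <= N)%N ->
  Y k = Y 0%N + \sum_(j < N) (j < k)%N%:R * (Y j.+1 - Y j).
Proof.
move=> kN; have -> : \sum_(j < N) (j < k)%N%:R * (Y j.+1 - Y j) = \sum_(j < k) (Y j.+1 - Y j).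
  rewrite [RHS](big_ord_widen N (fun j => Y j.+1 - Y j))// [RHS]big_mkcond /=.
  by apply: eq_bigr => j _; case: (j < k)%N; rewrite ?mul1r ?mul0r.
by rewrite -(big_mkord xpredT (fun j => Y j.+1 - Y j)) telescope_sumr// addrC subrK.
Qed.

Section Grid.
Context (R : realType) d (T : measurableType d).
Variables (X : R -> T -> \bar R).
Implicit Types (s h : R) (k N : nat).

Definition generators s : set (set T) :=
  [set A | exists (u : R) (B : set (\bar R)),
     [/\ 0 <= u <= s, measurable B & A = X u @^-1` B]].

Definition adapted s (f : T -> R) :=
  measurable_fun [set: g_sigma_algebraType (generators s)]
    (f : g_sigma_algebraType (generators s) -> R).

Lemma adaptedM s f g : adapted s f -> adapted s g -> adapted s (fun w => f w * g w).
Proof. exact: measurable_funM. Qed.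

Lemma adaptedD s f g : adapted s f -> adapted s g -> adapted s (fun w => f w + g w).
Proof. exact: measurable_funD. Qed.

Lemma adapted_cst s (c : R) : adapted s (fun=> c).
Proof. exact: measurable_cst. Qed.

Lemma adapted_sum s n (F : nat -> T -> R) :
  (forall k, (k < n)%N -> adapted s (F k)) -> adapted s (fun w => \sum_(k < n) F k w).
Proof.
elim: n => [_|n IH H]; first by under eq_fun do rewrite big_ord0; exact: adapted_cst.
under eq_fun do rewrite big_ord_recr; apply: adaptedD; last exact: H.
by apply: IH => k kn; apply: H; exact: ltnW.
Qed.

Lemma adapted_comp s f (g : R -> R) : measurable_fun setT g -> adapted s f -> adapted s (fun w =>
  g (f w)).
Proof. by move=> mg af; exact: (measurableT_comp mg af). Qed.

Lemma adapted_X s u (g : \bar R -> R) : 0 <= u <= s -> measurable_fun setT g ->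
  adapted s (fun w => g (X u w)).
Proof.
move=> us mg; apply: (measurableT_comp mg (_ : measurable_fun [set:
  g_sigma_algebraType (generators s)] (X u))).
by move=> _ B mB; rewrite setTI; apply: sub_sigma_algebra; exists u, B.
Qed.

Lemma adapted_indic s (b : T -> bool) : natural_filtration X s [set w | b w] ->
  adapted s (fun w => (b w)%:R).
Proof.
move=> FA; have -> : (fun w => (b w)%:R) = \1_[set w | b w] :> (T -> R).
  apply/funext => w; rewrite indicE.
  by case: (boolP (b w)) => bw; [rewrite mem_set|rewrite memNset//=; exact/negP].
exact: (@measurable_indic _ (g_sigma_algebraType (generators s)) R _ _ FA).
Qed.

(** Discount accumulated over k steps, with a left Riemann sum of the capped state as area: the last
    state used is that of step k - 1. *)
Definition grid_weight (lambda mu K h : R) k (w : T) : R :=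
  expR (- (lambda * (h * k%:R) + mu * (h * \sum_(j < k) ecap K (X (h * j%:R) w)))).

Definition grid_stopping h N (kap : T -> nat) :=
  (forall w, (kap w <= N)%N) /\
  forall k, natural_filtration X (h * k%:R) [set w | (k < kap w)%N].

Lemma grid_weightS lambda mu K h k w : grid_weight lambda mu K h k.+1 w =
  grid_weight lambda mu K h k w * expR (- (lambda * h + mu * h * ecap K (X (h * k%:R) w))).
Proof.
by rewrite /grid_weight -expRD big_ord_recr/= -natr1; congr expR; ring.
Qed.

(** The weight of step k uses states up to step k - 1 only. The slack [h] in the hypothesis
    expresses this: the weight of step k.+1 is already known at time h k. *)
Lemma adapted_grid_weight lambda mu K h k s : 0 <= h -> h * k%:R <= s + h ->
  adapted s (grid_weight lambda mu K h k).
Proof.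
move=> h0 hs; apply: (adapted_comp (g := fun r => expR (- r))); first exact: measurableT_comp.
apply: adaptedD; first exact: adapted_cst.
apply: adaptedM; first exact: adapted_cst.
apply: adaptedM; first exact: adapted_cst.
apply: (@adapted_sum s k (fun j w => ecap K (X (h * j%:R) w))) => j jk.
apply: adapted_X; last exact: measurable_ecap.
rewrite mulr_ge0//=; have : h * j.+1%:R <= h * k%:R by rewrite ler_wpM2l// ler_nat.
by rewrite -natr1; lra.
Qed.

End Grid.

Section OneStepLaplace.
Context (R : realType) d (T : measurableType d).
Variables (Pr : \bar R -> probability T R) (X : R -> T -> \bar R).
Variables (phi : R -> R) (v : R -> R -> R).
Hypothesis hF : cadlag_feller_process Pr X.
Hypothesis hL : forall q x t : R, 0 < q -> 0 <= x -> 0 <= t ->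
  (\int[Pr x%:E]_w expeR (- (q%:E * X t w)))%E =
  (expR (- (x * v t q) - \int[lebesgue_measure]_(s in `[0, t]) phi (v s q)))%:E.

Let X0 t w : 0 <= t -> (0 <= X t w)%E.
Proof. by move=> t0; exact: (cfp_ge0 hF). Qed.

Let hM : markov_process Pr X := cfp_markov hF.

Lemma measurable_X t : 0 <= t -> measurable_fun setT (X t).
Proof. by move=> t0; exact: (markov_measurable hM t0). Qed.

(** The Laplace formula is given for finite starting points. From +oo both sides vanish, because the
    law started there is at +oo at time 0 almost surely and +oo is absorbing. *)
Lemma laplace_step (y : \bar R) (t q : R) : 0 < q -> 0 <= t -> 0 < v t q -> (0 <= y)%E ->
  (\int[Pr y]_w (lexp q (X t w))%:E)%E =
  (lexp (v t q) y * expR (- \int[lebesgue_measure]_(s in `[0, t]) phi (v s q)))%:E.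
Proof.
move=> q0 t0 vt0; case: y => [x x0|_|//].
  rewrite -expRD mulrC -hL//; apply: eq_integral => w _.
  by rewrite expeR_lexp// X0.
rewrite mul0r; apply/eqP; rewrite eq_le; apply/andP; split; last first.
  by apply: integral_ge0 => w _; rewrite lee_fin lexp_ge0.
have mX0 := measurable_X (lexx 0).
have mS : measurable (X 0 @^-1` [set +oo%E]).
  by rewrite -[X in measurable X]setTI; apply: mX0 => //; exact: emeasurable_set1.
have S1 := markov_start hM (leey 0 : (0 <= +oo)%E).
have SC : Pr +oo%E (~` (X 0 @^-1` [set +oo%E])) = 0%E.
  by rewrite probability_setC// S1 subee.
rewrite -[leRHS]SC -[X in (_ <= Pr _ X)%E]setIT -(integral_indic (Pr +oo%E) measurableT
  (measurableC mS)).
apply: ge0_le_integral => //.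
- by move=> w _; rewrite lee_fin lexp_ge0.
- apply/measurable_EFinP; apply: measurableT_comp; first exact: measurable_lexp.
  exact: measurable_X.
- by apply/measurable_EFinP; apply: measurable_indic; exact: measurableC.
move=> w _; rewrite lee_fin indicE; have [Xw|Xw] := eqVneq (X 0 w) +oo%E.
  by rewrite (cfp_absorbing hF (s := 0) (t := t)) ?lexx//= ?lexx.
rewrite mem_set//=; last by move=> h; rewrite h eqxx in Xw.
by apply: lexp_le1; [exact: ltW|exact: X0].
Qed.

Lemma markov_lexp (y : \bar R) (s t q : R) (Z : T -> R) : (0 <= y)%E ->
  0 < q -> 0 <= s -> 0 <= t -> 0 < v t q -> adapted X s Z -> (forall w, 0 <= Z w) ->
  \int[Pr y]_w (Z w * lexp q (X (s + t) w)) =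
  \int[Pr y]_w (Z w * (lexp (v t q) (X s w) *
    expR (- \int[lebesgue_measure]_(r in `[0, t]) phi (v r q)))).
Proof.
move=> y0 q0 s0 t0 vt0 aZ Z0; rewrite /Rintegral; congr fine.
under eq_integral do rewrite EFinM.
under [RHS]eq_integral do rewrite EFinM.
apply: (@sub_sigma_algebra_weight _ T R (generators X s) (Pr y)
  (fun w => lexp q (X (s + t) w)) _ (EFin \o Z)) => //.
- exact: (natural_filtration_measurable hM).
- by apply: measurableT_comp; [exact: measurable_lexp|apply: measurable_X; exact: addr_ge0].
- apply: measurable_funM => //; apply: measurableT_comp; first exact: measurable_lexp.
  exact: measurable_X.
- by move=> w; exact: lexp_ge0.
- by move=> w; rewrite mulr_ge0 ?lexp_ge0 ?expR_ge0.
- move=> A FA.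
  rewrite (markov_expectation hM (fun t w => @X0 t w) y0 s0 t0 FA (g := fun u => (lexp q u)%:E)).
  + by apply: eq_integral => w _; apply: laplace_step => //; exact: X0.
  + by apply/measurable_EFinP; exact: measurable_lexp.
  + by move=> u; rewrite lee_fin lexp_ge0.
- exact/measurable_EFinP.
Qed.

Lemma bounded_mfun_adapted s f : adapted X s f -> (exists C : R, forall w, `|f w| <= C) ->
  bounded_mfun f.
Proof.
move=> af bf; split => // _ B mB; rewrite setTI.
apply: (natural_filtration_measurable hM (s := s)).
by have := af measurableT B mB; rewrite setTI.
Qed.

End OneStepLaplace.

Lemma is_derive_quadratic (R : realType) (f : R -> R) (z d r C : R) : 0 < r ->
  (forall e : R, `|e| <= r -> `|f (z + e) - f z - e * d| <= C * e ^+ 2) -> is_derive z 1 f d.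
Proof.
move=> r0 H.
have cv : h^-1 *: ((f \o shift z) (h *: 1) - f z) @[h --> 0^'] --> d.
  apply/cvgrPdist_le => /= e e0; near=> h.
  have h0 : h != 0 by near: h; exact: nbhs_dnbhs_neq.
  have hr : `|h| <= r by near: h; apply: dnbhs0_le.
  have he : `|h| <= e / (`|C| + 1).
    by near: h; apply: dnbhs0_le; rewrite divr_gt0// ltr_wpDl.
  have -> : d - h^-1 *: (f (h *: 1 + z) - f z) = - (h^-1 * (f (z + h) - f z - h * d)).
    have -> : h *: 1 + z = z + h by rewrite addrC /GRing.scale /= mulr1.
    by rewrite /GRing.scale /=; field.
  rewrite normrN normrM normfV mulrC ler_pdivrMr ?normr_gt0//.
  apply: (le_trans (H h hr)); rewrite -[h ^+ 2]real_normK ?num_real// expr2 mulrA ler_wpM2r//.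
  apply: (@le_trans _ _ ((`|C| + 1) * `|h|)).
    by rewrite ler_wpM2r// (le_trans (ler_norm _))// lerDl.
  by rewrite mulrC -ler_pdivlMr// ltr_wpDl.
by apply: DeriveDef; [apply/cvg_ex; exists d|exact: cvg_lim].
Unshelve. all: by end_near. Qed.

(** * Dynkin identity on the grid *)

Section GridDynkin.
Context (R : realType) d (T : measurableType d).
Variables (Pr : \bar R -> probability T R) (X : R -> T -> \bar R).
Variables (psi phi : R -> R) (v : R -> R -> R).
Hypothesis hF : cadlag_feller_process Pr X.
Hypothesis hL : forall q x t : R, 0 < q -> 0 <= x -> 0 <= t ->
  (\int[Pr x%:E]_w expeR (- (q%:E * X t w)))%E =
  (expR (- (x * v t q) - \int[lebesgue_measure]_(s in `[0, t]) phi (v s q)))%:E.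
Hypothesis psi_lip : forall a b : R, 0 < a -> exists2 c : R, 0 <= c &
  forall x y, a <= x <= b -> a <= y <= b -> `|psi x - psi y| <= c * `|x - y|.
Hypothesis phi_lip : forall a b : R, 0 < a -> exists2 c : R, 0 <= c &
  forall x y, a <= x <= b -> a <= y <= b -> `|phi x - phi y| <= c * `|x - y|.
Hypothesis hv : cumulant_flow psi v.
Variables (x lambda mu : R).
Hypotheses (x0 : 0 <= x) (hlambda : 0 < lambda) (hmu : 0 <= mu).

Let P := Pr x%:E.
Let X0 t w : 0 <= t -> (0 <= X t w)%E.
Proof. by move=> t0; exact: (cfp_ge0 hF). Qed.

(** The generator of the process multiplies exp (- z y) by y Psi(z) - Phi(z); the other two terms
    are the rates of discount. At +oo the factor [lexp] is 0, so the value of [fine] there is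
    harmless. *)
Definition generator (K z : R) (y : \bar R) : R :=
  lexp z y * (fine y * psi z - mu * ecap K y - phi z - lambda).

(** Riemann sum for the expected discounted integral of g (X_s) up to the stopping time, that is,
    for a potential of the killed process. *)
Definition occupation (K h : R) (N : nat) (kap : T -> nat) (g : \bar R -> R) : R :=
  h * \sum_(k < N) \int[P]_w ((k < kap w)%N%:R * grid_weight X lambda mu K h k w * g (X (h * k%:R) w)).

Definition bounded_on_half_line (g : \bar R -> R) :=
  measurable_fun setT g /\ exists C : R, forall y : \bar R, (0 <= y)%E -> `|g y| <= C.

Section Fixed.
Variables (K h : R) (N : nat) (kap : T -> nat).
Hypotheses (K0 : 0 <= K) (h0 : 0 < h) (hkap : grid_stopping X h N kap).
Local Notation W := (grid_weight X lambda mu K h).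

Let hk k : 0 <= h * k%:R.
Proof. by rewrite mulr_ge0// ltW. Qed.

Lemma grid_weight_gt0 k w : 0 < W k w.
Proof. exact: expR_gt0. Qed.

Lemma grid_weight_le k w : W k w <= expR (- (lambda * (h * k%:R))).
Proof.
rewrite ler_expR lerN2 lerDl mulr_ge0// mulr_ge0 ?(ltW h0)// sumr_ge0// => j _.
by apply: ecap_ge0 => //; exact: X0.
Qed.

Lemma grid_weight_le1 k w : W k w <= 1.
Proof.
apply: (le_trans (grid_weight_le k w)).
by rewrite expR_le1 oppr_le0 mulr_ge0// ltW.
Qed.

Lemma bounded_mfun_grid_weight k : bounded_mfun (W k).
Proof.
apply: (bounded_mfun_adapted hF (s := h * k%:R)).
  by apply: adapted_grid_weight; [exact: ltW|rewrite lerDl ltW].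
by exists 1 => w; rewrite ger0_norm ?grid_weight_le1// ltW// grid_weight_gt0.
Qed.

Lemma bounded_mfun_running k : bounded_mfun (fun w : T => (k < kap w)%N%:R : R).
Proof.
apply: (bounded_mfun_adapted hF (s := h * k%:R)).
  by apply: adapted_indic; exact: hkap.2.
by exists 1 => w; case: (k < kap w)%N; rewrite ?normr1 ?normr0.
Qed.

Lemma bounded_mfun_X g t : 0 <= t -> bounded_on_half_line g -> bounded_mfun (fun w => g (X t w)).
Proof.
move=> t0 [mg [C gC]]; split; first by apply: measurableT_comp => //; exact: (measurable_X hF t0).
by exists C => w; apply: gC; exact: X0.
Qed.

Lemma bounded_mfun_occupation k g : bounded_on_half_line g ->
  bounded_mfun (fun w => (k < kap w)%N%:R * W k w * g (X (h * k%:R) w)).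
Proof.
move=> bg; apply: bounded_mfunM; last exact: bounded_mfun_X.
by apply: bounded_mfunM; [exact: bounded_mfun_running|exact: bounded_mfun_grid_weight].
Qed.

(** From (1 + s) exp (- s) <= 1 with s = lambda h. The discount lambda > 0 thus bounds occupations
    uniformly in the number of steps. *)
Lemma geometric_sum_le n : h * \sum_(k < n) expR (- (lambda * (h * k%:R))) <= lambda^-1 + h.
Proof.
pose q : R := expR (- (lambda * h)).
have lh : 0 < lambda * h by rewrite mulr_gt0.
have q1 : (1 + lambda * h) * q <= 1.
  by have := expR_ge1Dx (lambda * h); rewrite /q expRN => hh; rewrite ler_pdivrMr ?expR_gt0// mul1r.
have -> : \sum_(k < n) expR (- (lambda * (h * k%:R))) = \sum_(k < n) q ^+ k.
  by apply: eq_bigr => k _; rewrite /q -expRM_natl; congr expR; ring.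
have q0 : 0 < q by exact: expR_gt0.
have S0 : 0 <= \sum_(k < n) q ^+ k by apply: sumr_ge0 => k _; rewrite exprn_ge0// ltW.
have E : (1 - q) * \sum_(k < n) q ^+ k = 1 - q ^+ n.
  by rewrite -opprB mulNr -subrX1 opprB.
have : (1 - q) * \sum_(k < n) q ^+ k <= 1 by rewrite E gerBl exprn_ge0// ltW.
move: (\sum_(k < n) q ^+ k) S0 => S S0 HS.
have h1 : lambda * h * S <= (1 + lambda * h) * ((1 - q) * S).
  have -> : (1 + lambda * h) * ((1 - q) * S) = (1 + lambda * h - (1 + lambda * h) * q) * S by ring.
  by rewrite ler_wpM2r//; lra.
have h2 : (1 + lambda * h) * ((1 - q) * S) <= 1 + lambda * h.
  by rewrite ler_piMr//; lra.
have -> : lambda^-1 + h = lambda^-1 * (1 + lambda * h) by field; rewrite gt_eqF.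
by rewrite ler_pdivlMl// mulrA; apply: (le_trans h1).
Qed.

Lemma occupation_norm_le g (C : R) : bounded_on_half_line g -> 0 <= C ->
  (forall k w, (k < kap w)%N -> `|g (X (h * k%:R) w)| <= C) ->
  `|occupation K h N kap g| <= C * (lambda^-1 + h).
Proof.
move=> bg C0 gC; rewrite /occupation normrM (gtr0_norm h0).
apply: (@le_trans _ _ (h * \sum_(k < N) (C * expR (- (lambda * (h * k%:R)))))).
  rewrite ler_pM2l//; apply: (le_trans (ler_norm_sum _ _ _)); apply: ler_sum => k _.
  apply: expectation_bounded; first exact: bounded_mfun_occupation.
  move=> w; case: (ltnP k (kap w)) => kw; last first.
    by rewrite !mul0r normr0 mulr_ge0// expR_ge0.
  rewrite mul1r normrM mulrC (gtr0_norm (grid_weight_gt0 _ _)).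
  by rewrite ler_pM// ?gC// ?grid_weight_le// ltW// grid_weight_gt0.
by rewrite -mulr_sumr mulrCA ler_wpM2l// geometric_sum_le.
Qed.

Lemma occupationD f g : bounded_on_half_line f -> bounded_on_half_line g ->
  occupation K h N kap (fun y => f y + g y) = occupation K h N kap f + occupation K h N kap g.
Proof.
move=> bf bg; rewrite /occupation -mulrDr -big_split /=; congr (_ * _); apply: eq_bigr => k _.
rewrite -expectationD; [|exact: bounded_mfun_occupation|exact: bounded_mfun_occupation].
by apply: eq_Rintegral => w _; rewrite mulrDr.
Qed.

Lemma occupationZ c g : bounded_on_half_line g ->
  occupation K h N kap (fun y => c * g y) = c * occupation K h N kap g.
Proof.
move=> bg; rewrite /occupation [RHS]mulrCA; congr (_ * _); rewrite mulr_sumr; apply: eq_bigr => k _.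
rewrite -expectationZ; last exact: bounded_mfun_occupation.
by apply: eq_Rintegral => w _; rewrite mulrCA.
Qed.

Lemma occupation_norm_le_half_line g (C : R) : bounded_on_half_line g -> 0 <= C ->
  (forall y : \bar R, (0 <= y)%E -> `|g y| <= C) ->
  `|occupation K h N kap g| <= C * (lambda^-1 + h).
Proof. by move=> bg C0 gC; apply: occupation_norm_le => // k w _; apply: gC; exact: X0. Qed.

End Fixed.

Lemma bounded_on_half_lineM f g : bounded_on_half_line f -> bounded_on_half_line g ->
  bounded_on_half_line (fun y => f y * g y).
Proof.
move=> [mf [C fC]] [mg [D gD]]; split; first exact: measurable_funM.
by exists (C * D) => y y0; rewrite normrM ler_pM ?fC ?gD.
Qed.

Lemma bounded_on_half_lineD f g : bounded_on_half_line f -> bounded_on_half_line g ->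
  bounded_on_half_line (fun y => f y + g y).
Proof.
move=> [mf [C fC]] [mg [D gD]]; split; first exact: measurable_funD.
by exists (C + D) => y y0; apply: (le_trans (ler_normD _ _)); rewrite lerD ?fC ?gD.
Qed.

Lemma bounded_on_half_lineZ (c : R) g : bounded_on_half_line g ->
  bounded_on_half_line (fun y => c * g y).
Proof.
by move=> bg; apply: bounded_on_half_lineM => //; split; [exact: measurable_cst|exists `|c|].
Qed.

Lemma lexp_bounded z : 0 <= z -> bounded_on_half_line (lexp z).
Proof.
move=> z0; split; first exact: measurable_lexp.
by exists 1 => y y0; rewrite ger0_norm ?lexp_ge0// lexp_le1.
Qed.

Lemma ecap_bounded K : 0 <= K -> bounded_on_half_line (ecap K).
Proof.
move=> K0; split; first exact: measurable_ecap.
by exists K => y y0; rewrite ger0_norm ?ecap_ge0// ecap_le.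
Qed.

(** Minus the derivative of [lexp z] in z, with value 0 at +oo. *)
Definition mul_lexp (z : R) (y : \bar R) : R := fine y * lexp z y.

Lemma mul_lexp_norm_le z (y : \bar R) : 0 < z -> (0 <= y)%E -> 0 <= mul_lexp z y <= z^-1.
Proof.
move=> z0; case: y => [r|_|//]; last by rewrite /mul_lexp mul0r lexx invr_ge0 ltW.
by rewrite lee_fin => r0; rewrite /mul_lexp /= mulr_ge0 ?expR_ge0//= mul_expRN_le.
Qed.

Lemma mul_lexp_bounded z : 0 < z -> bounded_on_half_line (mul_lexp z).
Proof.
move=> z0; split.
  by apply: measurable_funM; [exact: fine_measurable|exact: measurable_lexp].
by exists z^-1 => y y0; have /andP[h1 h2] := mul_lexp_norm_le z0 y0; rewrite ger0_norm.
Qed.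

Lemma generatorE K z : generator K z = (fun y => psi z * mul_lexp z y +
  (- mu * (lexp z y * ecap K y) + - (phi z + lambda) * lexp z y)).
Proof. by apply/funext => y; rewrite /generator /mul_lexp; ring. Qed.

Lemma generator_bounded K z : 0 <= K -> 0 < z -> bounded_on_half_line (generator K z).
Proof.
move=> K0 z0; rewrite generatorE; apply: bounded_on_half_lineD.
  by apply: bounded_on_half_lineZ; exact: mul_lexp_bounded.
apply: bounded_on_half_lineD; apply: bounded_on_half_lineZ; last exact: lexp_bounded (ltW z0).
by apply: bounded_on_half_lineM; [exact: lexp_bounded (ltW z0)|exact: ecap_bounded].
Qed.

Definition stopped (K h : R) (kap : T -> nat) (g : \bar R -> R) (w : T) : R :=
  grid_weight X lambda mu K h (kap w) w * g (X (h * (kap w)%:R) w).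

Lemma expectation_lexp0 z : 0 < z -> \int[P]_w lexp z (X 0 w) = expR (- (z * x)).
Proof.
move=> z0; have [vz _ _ _] := hv z0; have := hL z0 x0 (lexx 0).
rewrite vz set_itv1 Rintegral_set1 subr0 [x * z]mulrC => E.
rewrite /Rintegral -[RHS]/(fine (expR (- (z * x)))%:E) -E; congr fine.
by apply: eq_integral => w _; rewrite expeR_lexp// X0.
Qed.

Lemma stoppedE K h N kap g : (forall w, (kap w <= N)%N) ->
  let Y k w := grid_weight X lambda mu K h k w * g (X (h * k%:R) w) in
  stopped K h kap g =
  fun w => g (X 0 w) + \sum_(k < N) (k < kap w)%N%:R * (Y k.+1 w - Y k w).
Proof.
move=> hk Y; apply/funext => w.
rewrite /stopped -/(Y (kap w) w) (@stopped_telescope _ (Y^~ w) _ N)//; congr (_ + _).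
by rewrite /Y /grid_weight big_ord0 !mulr0 addr0 oppr0 expR0 mul1r.
Qed.

Lemma bounded_mfun_stopped (K h : R) N kap g : 0 <= K -> 0 < h -> grid_stopping X h N kap ->
  bounded_on_half_line g -> bounded_mfun (stopped K h kap g).
Proof.
move=> K0 h0 hkap bg; rewrite (stoppedE _ _ _ hkap.1); apply: bounded_mfunD.
  by have := @bounded_mfun_X g 0 (lexx _) bg.
pose Y k w : R := grid_weight X lambda mu K h k w * g (X (h * k%:R) w).
have bY k : bounded_mfun (Y k).
  apply: bounded_mfunM; first exact: bounded_mfun_grid_weight.
  by apply: bounded_mfun_X => //; rewrite mulr_ge0// ltW.
apply: (@bounded_mfun_sum _ _ _ N (fun k w => (k < kap w)%N%:R * (Y k.+1 w - Y k w))) => k _.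
by apply: bounded_mfunM; [exact: bounded_mfun_running hkap k|exact: bounded_mfunB].
Qed.

(** Each step costs C2 h^2, discounted by exp (- lambda h k). The geometric sum turns N such errors
    into O(h), uniformly in the number of steps, the stopping rule and the cap. *)
Lemma grid_dynkin (z0 z1 : R) : 0 < z0 -> exists C h0 : R, [/\ 0 <= C, 0 < h0 &
  forall K h N kap z, 0 <= K -> 0 < h <= h0 -> grid_stopping X h N kap -> z0 <= z <= z1 ->
  `|\int[P]_w stopped K h kap (lexp z) w - expR (- (z * x)) -
    occupation K h N kap (generator K z)| <= C * h].
Proof.
move=> z00.
have [B B0 [HBp HBf]] : exists2 B : R, 0 <= B & (forall z, z0 <= z <= z1 -> `|psi z| <= B) /\
    (forall z, z0 <= z <= z1 -> `|phi z| <= B).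
  have bnd (f : R -> R) : (forall a b : R, 0 < a -> exists2 c : R, 0 <= c &
      forall x y, a <= x <= b -> a <= y <= b -> `|f x - f y| <= c * `|x - y|) ->
      exists2 B : R, 0 <= B & forall z, z0 <= z <= z1 -> `|f z| <= B.
    move=> f_lip; have [c c0 Hc] := f_lip z0 z1 z00.
    exists (`|f z0| + c * `|z1 - z0|); first by rewrite addr_ge0// mulr_ge0.
    move=> z /andP[h1 h2]; rewrite -[f z](subrK (f z0)) addrC.
    apply: (le_trans (ler_normD _ _)); rewrite lerD2l.
    apply: (le_trans (Hc _ _ _ _)); rewrite ?h1 ?h2 ?lexx ?(le_trans h1)//.
    by rewrite ler_wpM2l// !ger0_norm ?subr_ge0 ?(le_trans h1)// lerB.
  have [B1 B10 H1] := bnd _ psi_lip; have [B2 B20 H2] := bnd _ phi_lip.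
  exists (B1 + B2); first exact: addr_ge0.
  by split => z hz; [apply: (le_trans (H1 z hz)); rewrite lerDl|apply: (le_trans (H2 z hz));
    rewrite lerDr].
have [C1 [h1 [C10 h10 Hflow]]] := cumulant_flow_estimate psi_lip phi_lip hv z1 z00.
have [C2 [h2 [C20 h20 Hstep]]] := one_step_bound z00 (ltW hlambda) hmu B0 C10.
exists (C2 * (lambda^-1 + 1)), (Num.min 1 (Num.min h1 h2)); split.
- by rewrite mulr_ge0// addr_ge0// invr_ge0 ltW.
- by rewrite !lt_min ltr01 h10 h20.
move=> K h N kap z K0 /andP[h_gt0]; rewrite !le_min => /and3P[h_le1 hh1 hh2] hkap hz.
have z_gt0 : 0 < z by case/andP: hz => hz _; exact: lt_le_trans hz.
have [v0 Hv HI] := Hflow z h hz (introT andP (conj h_gt0 hh1)).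
have vh0 : 0 < v h z by apply: lt_le_trans v0; rewrite divr_gt0.
set I := \int[lebesgue_measure]_(s in _) _ in HI.
have hk k : 0 <= h * k%:R by rewrite mulr_ge0// ltW.
pose W := grid_weight X lambda mu K h.
pose Y k w := W k w * lexp z (X (h * k%:R) w).
have bW k : bounded_mfun (W k) by exact: bounded_mfun_grid_weight.
have bl q k : 0 < q -> bounded_mfun (fun w => lexp q (X (h * k%:R) w)).
  by move=> q0; apply: bounded_mfun_X => //; exact: lexp_bounded (ltW q0).
have bY k : bounded_mfun (Y k) by apply: bounded_mfunM => //; exact: bl.
have bR k : bounded_mfun (fun w : T => (k < kap w)%N%:R : R) by exact: bounded_mfun_running hkap k.
pose D k w : R := (k < kap w)%N%:R * (Y k.+1 w - Y k w).
have bD k : bounded_mfun (D k) by apply: bounded_mfunM => //; exact: bounded_mfunB.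
rewrite (stoppedE _ _ _ hkap.1).
rewrite expectationD; first last.
- exact: (@bounded_mfun_sum _ _ _ N D).
- by have := bl z 0%N z_gt0; rewrite mulr0.
rewrite expectation_lexp0// (@expectation_sum _ _ _ _ N D)// [_ + _ - expR _]addrAC subrr add0r.
rewrite /occupation mulr_sumr -sumrB.
apply: (@le_trans _ _ (\sum_(k < N) expR (- (lambda * (h * k%:R))) * (C2 * h ^+ 2))); last first.
  rewrite -mulr_suml.
  have := geometric_sum_le h_gt0 N.
  have -> : (\sum_(k < N) expR (- (lambda * (h * k%:R)))) * (C2 * h ^+ 2) =
     C2 * (h * \sum_(k < N) expR (- (lambda * (h * k%:R)))) * h by ring.
  by move=> hs; rewrite ler_wpM2r// ?(ltW h_gt0)// ler_wpM2l// (le_trans hs)// lerD2l.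
apply: (le_trans (ler_norm_sum _ _ _)); apply: ler_sum => k _.
pose g w : R := expR (- (lambda * h + mu * h * ecap K (X (h * k%:R) w))).
(* The weight of step k.+1 and the event k < kap are known at time h k, so the conditional Laplace
   transform over one step can be inserted. *)
have E1 : \int[P]_w ((k < kap w)%N%:R * Y k.+1 w) =
    \int[P]_w ((k < kap w)%N%:R * W k w * (g w * (lexp (v h z) (X (h * k%:R) w) * expR (- I)))).
  pose Z w : R := (k < kap w)%N%:R * W k.+1 w.
  have aZ : adapted X (h * k%:R) Z.
    apply: adaptedM; first by apply: adapted_indic; exact: hkap.2.
    by apply: adapted_grid_weight; [exact: ltW|rewrite -natr1; lra].
  have Z0 w : 0 <= Z w by rewrite /Z mulr_ge0// ltW// grid_weight_gt0.
  have := markov_lexp hF hL (_ : (0 <= x%:E)%E) z_gt0 (hk k) (ltW h_gt0) vh0 aZ Z0.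
  rewrite lee_fin => /(_ x0) E.
  transitivity (\int[P]_w (Z w * lexp z (X (h * k%:R + h) w))).
    apply: eq_Rintegral => w _; rewrite /Z /Y mulrA; congr (_ * lexp z (X _ w)).
    by rewrite -natr1; ring.
  by rewrite E; apply: eq_Rintegral => w _; rewrite /Z /W grid_weightS -/(g w); ring.
have bg : bounded_mfun g.
  have bE : bounded_mfun (fun w => ecap K (X (h * k%:R) w)).
    by apply: bounded_mfun_X => //; exact: ecap_bounded.
  split.
    apply: measurableT_comp => //; apply: measurableT_comp => //.
    apply: measurable_funD => //; apply: measurable_funM => //; exact: bE.1.
  exists 1 => w; rewrite ger0_norm ?expR_ge0// expR_le1 oppr_le0 addr_ge0//.
    by rewrite mulr_ge0// ltW.
  by rewrite mulr_ge0 ?mulr_ge0// ?ecap_ge0 ?X0// ltW.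
have bgen : bounded_mfun (fun w => generator K z (X (h * k%:R) w)).
  by apply: bounded_mfun_X => //; exact: generator_bounded.
have bRW : bounded_mfun (fun w => (k < kap w)%N%:R * W k w) by exact: bounded_mfunM.
have bG : bounded_mfun (fun w => g w * (lexp (v h z) (X (h * k%:R) w) * expR (- I))).
  by do 2!apply: bounded_mfunM => //; [exact: bl|exact: bounded_mfun_cst].
have -> : \int[P]_w D k w - h * \int[P]_w ((k < kap w)%N%:R * grid_weight X lambda mu K h k w *
      generator K z (X (h * k%:R) w)) =
    \int[P]_w ((k < kap w)%N%:R * W k w *
     (g w * (lexp (v h z) (X (h * k%:R) w) * expR (- I)) - lexp z (X (h * k%:R) w) -
      h * generator K z (X (h * k%:R) w))).
  have -> : \int[P]_w D k w = \int[P]_w ((k < kap w)%N%:R * Y k.+1 w) -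
      \int[P]_w ((k < kap w)%N%:R * W k w * lexp z (X (h * k%:R) w)).
    rewrite -expectationB; [|exact: bounded_mfunM|by apply: bounded_mfunM => //; exact: bl].
    by apply: eq_Rintegral => w _; rewrite /D /Y; ring.
  rewrite E1 -expectationZ; last exact: bounded_mfunM.
  rewrite -!expectationB.
  - by apply: eq_Rintegral => w _; rewrite /W; ring.
  - by apply: bounded_mfunB; apply: bounded_mfunM => //; exact: bl.
  - by apply: bounded_mfunM; [exact: bounded_mfun_cst|exact: bounded_mfunM].
  - exact: bounded_mfunM.
  - by apply: bounded_mfunM => //; exact: bl.
apply: expectation_bounded.
  apply: bounded_mfunM => //; apply: bounded_mfunB; last first.
    by apply: bounded_mfunM => //; exact: bounded_mfun_cst.
  by apply: bounded_mfunB => //; exact: bl.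
move=> w; rewrite normrM; apply: ler_pM => //.
  rewrite ger0_norm ?mulr_ge0// ?(ltW (grid_weight_gt0 _ _ _ _))//.
  have := grid_weight_le K0 h_gt0 k w; rewrite -/(W k w) => hW.
  case: (k < kap w)%N; first by rewrite mul1r.
  by rewrite mul0r expR_ge0.
(* A state +oo contributes 0 to every term, because [lexp] vanishes there. *)
have := X0 w (hk k); rewrite /g; case: (X (h * k%:R) w) => [r|_|//]; last first.
  by rewrite /generator /= !mul0r !mulr0 !subr0 normr0 mulr_ge0// sqr_ge0.
rewrite lee_fin => r0; rewrite /generator /=.
have c_ge0 : 0 <= Num.min r K <= r by rewrite le_min r0 K0 ge_min lexx.
have hh : 0 < h <= h2 by rewrite h_gt0.
have zz : z0 <= z by case/andP: hz.
exact: (Hstep h z r (Num.min r K) (v h z) I (psi z) (phi z) hh zz c_ge0 (HBp z hz) (HBf z hz) Hv HI).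
Qed.

Lemma lexp_diff_le z e (y : \bar R) : 0 < z -> `|e| <= z / 2 -> (0 <= y)%E ->
  `|lexp (z + e) y - lexp z y + e * mul_lexp z y| <= (1 + 2 / (z / 2)) ^+ 2 * e ^+ 2.
Proof.
move=> z0 ez; case: y => [r|_|//]; last first.
  by rewrite /mul_lexp /= mul0r mulr0 subrr addr0 normr0 mulr_ge0// sqr_ge0.
rewrite lee_fin => r0; rewrite /mul_lexp /=.
have -> : expR (- ((z + e) * r)) - expR (- (z * r)) + e * (r * expR (- (z * r))) =
  expR (- (z * r)) * (expR (- (e * r)) - 1 + e * r).
  by rewrite mulrDl opprD expRD; ring.
rewrite normrM (ger0_norm (expR_ge0 _)).
apply: (@le_trans _ _ (expR (- (z * r)) * ((e * r) ^+ 2 * expR `|e * r|))).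
  by rewrite ler_wpM2l ?expR_ge0// expRN_remainder2_abs.
have h1 : expR (- (z * r)) * expR `|e * r| <= expR (- (z / 2 * r)).
  rewrite -expRD ler_expR normrM (ger0_norm r0).
  have : `|e| * r <= z / 2 * r by rewrite ler_wpM2r.
  have -> : z * r = z / 2 * r + z / 2 * r by field.
  lra.
have z20 : 0 < z / 2 by rewrite divr_gt0.
have h2 := @sqr_expRN_le R (z / 2) r z20 r0.
have -> : expR (- (z * r)) * ((e * r) ^+ 2 * expR `|e * r|) =
  (r ^+ 2 * (expR (- (z * r)) * expR `|e * r|)) * e ^+ 2 by ring.
rewrite ler_wpM2r ?sqr_ge0//; apply: le_trans h2; apply: ler_pM => //.
- exact: sqr_ge0.
- by rewrite ler_pXn2r ?nnegrE//; lra.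
Qed.

(** This makes the Dynkin identity a differential equation in z, the term y exp (- z y) of the
    generator being minus a derivative. A quadratic remainder bound uniform in the state stands for
    differentiation under the integral. *)
Lemma is_derive_occupation (K h : R) N kap (z : R) : 0 <= K -> 0 < h ->
  grid_stopping X h N kap -> 0 < z ->
  is_derive z 1 (fun z => occupation K h N kap (lexp z)) (- occupation K h N kap (mul_lexp z)).
Proof.
move=> K0 h0 hkap z0; have z20 : 0 < z / 2 by rewrite divr_gt0.
apply: (@is_derive_quadratic _ _ _ _ (z / 2) ((1 + 2 / (z / 2)) ^+ 2 * (lambda^-1 + h)) z20).
move=> e he; have ze : 0 < z + e by move: he; rewrite ler_norml => /andP[]; lra.
have b1 : bounded_on_half_line (lexp (z + e)) by exact: lexp_bounded (ltW ze).
have b2 : bounded_on_half_line (lexp z) by exact: lexp_bounded (ltW z0).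
have b3 : bounded_on_half_line (mul_lexp z) by exact: mul_lexp_bounded.
have -> : occupation K h N kap (lexp (z + e)) - occupation K h N kap (lexp z) -
    e * - occupation K h N kap (mul_lexp z) =
  occupation K h N kap (fun y => lexp (z + e) y + (-1 * lexp z y + e * mul_lexp z y)).
  have H := occupationD K0 h0 hkap; have HZ := occupationZ K0 h0 hkap.
  by rewrite H ?H ?HZ//; [ring|exact: bounded_on_half_lineZ|exact: bounded_on_half_lineZ|
    apply: bounded_on_half_lineD; exact: bounded_on_half_lineZ].
rewrite mulrAC; apply: occupation_norm_le_half_line => //.
- by apply: bounded_on_half_lineD => //; apply: bounded_on_half_lineD; exact: bounded_on_half_lineZ.
- by rewrite mulr_ge0 ?sqr_ge0.
by move=> y y0; have := lexp_diff_le z0 he y0; rewrite mulN1r addrA.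
Qed.

End GridDynkin.

(** * Passage to continuous time *)

Section HalfLineIntegral.
Context (R : realType).
Implicit Types (c : R -> R) (K s t : R).

Lemma lebesgue_itvco s t : s <= t -> fine (lebesgue_measure (`[s, t[%classic : set R)) = t - s.
Proof.
move=> st; rewrite [X in fine X](_ : _ = (t - s)%:E)//.
apply: (etrans (lebesgue_measure_itv _)); rewrite /= lte_fin.
by case: ltP => // ts; rewrite (_ : t = s) ?subrr//; lra.
Qed.

Lemma integrable_bounded_itv c K s t : 0 <= s -> measurable_fun (`[0%R, +oo[%classic : set R) c ->
  (forall u, 0 <= u -> 0 <= c u <= K) ->
  lebesgue_measure.-integrable `[s, t[ (EFin \o c).
Proof.
move=> s0 mc cK; apply: measurable_bounded_integrable; first exact: measurable_itv.
- rewrite [X in (X < _)%E](_ : _ = (if s < t then t - s else 0)%:E) ?ltry//.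
  by apply: (etrans (lebesgue_measure_itv _)); rewrite /= lte_fin -EFinB; case: ifP.
- apply: (measurable_funS _ _ mc) => // u /=; rewrite !in_itv /= andbT => /andP[su _].
  exact: le_trans su.
- exists K; split; first exact: num_real.
  move=> M KM u /=; rewrite in_itv /= => /andP[su _].
  have /andP[c0 c1] := cK u (le_trans s0 su).
  by rewrite ger0_norm// (le_trans c1)// ltW.
Qed.

Lemma Rintegral_bounded_itv c K s t : 0 <= s <= t -> measurable_fun (`[0%R, +oo[%classic : set R) c ->
  (forall u, 0 <= u -> 0 <= c u <= K) ->
  0 <= \int[lebesgue_measure]_(u in `[s, t[) c u <= K * (t - s).
Proof.
move=> /andP[s0 st] mc cK; apply/andP; split.
  apply: Rintegral_ge0.
  move=> u /=; rewrite in_itv /= => /andP[su _].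
  by have /andP[] := cK u (le_trans s0 su).
rewrite -(lebesgue_itvco st) -Rintegral_cst; last exact: measurable_itv.
apply: le_Rintegral; first exact: measurable_itv.
- exact: integrable_bounded_itv mc cK.
- apply: (@integrable_bounded_itv (fun=> K) K) => // u u0; rewrite lexx andbT.
  by have /andP[c0 c1] := cK 0 (lexx 0); exact: le_trans c1.
- move=> u /=; rewrite in_itv /= => /andP[su _].
  by have /andP[] := cK u (le_trans s0 su).
Qed.

Lemma Rintegral_itv_cat c K s t : 0 <= s <= t -> measurable_fun (`[0%R, +oo[%classic : set R) c ->
  (forall u, 0 <= u -> 0 <= c u <= K) ->
  \int[lebesgue_measure]_(u in `[0, t[) c u =
  \int[lebesgue_measure]_(u in `[0, s[) c u + \int[lebesgue_measure]_(u in `[s, t[) c u.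
Proof.
move=> /andP[s0 st] mc cK.
have E : (`[0, t[%classic : set R) = `[0, s[ `|` `[s, t[.
  apply/seteqP; split => u /=; rewrite !in_itv /=.
    by move=> /andP[u0 ut]; case: (ltP u s) => us; [left|right]; apply/andP; split.
  by case=> /andP[h1 h2]; apply/andP; split; lra.
rewrite E Rintegral_setU//.
- by rewrite -E; exact: (@integrable_bounded_itv c K 0 t (lexx _) mc cK).
- apply/disj_setPS => u /= []; rewrite !in_itv /= => /andP[_ us] /andP[su _].
  by rewrite ltNge su in us.
Qed.

End HalfLineIntegral.

Section RightContinuousPath.
Context (R : realType) (y : R -> \bar R).
Hypothesis y_ge0 : forall t, 0 <= t -> (0 <= y t)%E.
Hypothesis y_rc : forall t : R, 0 <= t -> y u @[u --> t^'+] --> y t.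

Lemma right_continuous_seq (t : R) (u : nat -> R) : 0 <= t ->
  (\forall n \near \oo, t <= u n) -> u n @[n --> \oo] --> t ->
  y (u n) @[n --> \oo] --> y t.
Proof.
move=> t0 tu ut A nA.
have := y_rc t0 nA; rewrite /= /at_right => /nbhs_ballP[e /= e0 He].
change (\forall n \near \oo, A (y (u n))).
have H : \forall n \near \oo, `|t - u n| < e by move/cvgrPdist_lt : ut; apply.
near=> n.
have h1 : t <= u n by near: n.
have h2 : `|t - u n| < e by near: n.
move: h1; rewrite le_eqVlt => /predU1P[<-|h1]; first exact: nbhs_singleton nA.
exact: He.
Unshelve. all: by end_near. Qed.

(** The grid point strictly after u is taken, so that right-continuity of the path gives the
    limit. *)
Lemma right_grid_seq (h : nat -> R) (u : R) : 0 <= u -> (forall n, 0 < h n) ->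
  h n @[n --> \oo] --> 0 ->
  y (h n * (Num.truncn (u / h n)).+1%:R) @[n --> \oo] --> y u.
Proof.
move=> u0 h0 hc.
have H n : u <= h n * (Num.truncn (u / h n)).+1%:R <= u + h n.
  have /andP[h1 h2] := truncn_itv (divr_ge0 u0 (ltW (h0 n))).
  rewrite mulrC -ler_pdivrMr// (ltW h2) /= -natr1 mulrDl mul1r lerD2r.
  by rewrite -ler_pdivlMr.
apply: right_continuous_seq => //.
  by apply: nearW => n; case/andP: (H n).
apply: (@squeeze_cvgr _ _ _ _ (fun=> u) (fun n => u + h n)).
- exact: nearW.
- exact: cvg_cst.
- by rewrite -[X in _ --> X]addr0; apply: cvgD => //; exact: cvg_cst.
Qed.

Lemma measurable_grid_fun d (T : measurableType d) (F : nat -> T) (h : R) : 0 < h ->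
  measurable_fun (`[0%R, +oo[%classic : set R) (fun u : R => F (Num.truncn (u / h))).
Proof.
move=> h0 _ B mB.
rewrite [X in measurable X](_ : _ = \bigcup_(j in [set j | B (F j)]) `[h * j%:R, h * j.+1%:R[%classic).
  by apply: bigcup_measurable => j _; exact: measurable_itv.
apply/seteqP; split => u /=; rewrite ?in_itv /= ?andbT.
  move=> [u0 Bu]; exists (Num.truncn (u / h)) => //=; rewrite in_itv /=.
  have := truncn_itv (divr_ge0 u0 (ltW h0)).
  by rewrite ler_pdivlMr// ltr_pdivrMr// ![_ * h]mulrC.
case=> j Bj; rewrite /= in_itv /= => /andP[h1 h2].
split; first by apply: le_trans h1; rewrite mulr_ge0// ltW.
rewrite (_ : Num.truncn _ = j)//; apply: truncn_def.
by rewrite ler_pdivlMr// ltr_pdivrMr// ![_ * h]mulrC h1 h2.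
Qed.

Lemma measurable_right_continuous : measurable_fun (`[0%R, +oo[%classic : set R) y.
Proof.
pose h n : R := n.+1%:R^-1.
have h0 n : 0 < h n by rewrite invr_gt0.
have H := emeasurable_fun_cvg (fun n (u : R) => y (h n * (Num.truncn (u / h n)).+1%:R)) y.
refine (H _ _ _).
  by move=> n; exact: (measurable_grid_fun (fun j => y (h n * j.+1%:R)) (h0 n)).
move=> u; rewrite /= in_itv /= andbT => u0.
by apply: right_grid_seq => //; exact: cvg_harmonic.
Qed.

Variables (K : R).
Hypothesis K0 : 0 <= K.
Let c u := ecap K (y u).

Lemma ecap_path_bound u : 0 <= u -> 0 <= c u <= K.
Proof. by move=> u0; rewrite /c ecap_ge0 ?ecap_le// y_ge0. Qed.

Lemma measurable_ecap_path : measurable_fun (`[0%R, +oo[%classic : set R) c.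
Proof.
exact: (measurableT_comp (measurable_ecap K) measurable_right_continuous).
Qed.

(** Right sums are integrals of step functions that converge to the capped path by right-continuity
    and are dominated by K. Left sums differ from them by a telescoping boundary term of size h K,
    and the grid overshoots t by a vanishing length. *)
Lemma riemann_sum_cvg (h : nat -> R) (k : nat -> nat) (t : R) : 0 <= t ->
  (forall n, 0 < h n) -> h n @[n --> \oo] --> 0 ->
  (\forall n \near \oo, t <= h n * (k n)%:R) -> h n * (k n)%:R @[n --> \oo] --> t ->
  h n * \sum_(j < k n) c (h n * j%:R) @[n --> \oo] -->
  \int[lebesgue_measure]_(u in `[0, t[) c u.
Proof.
move=> t0 h0 hc tk kt.
pose step n u := c (h n * (Num.truncn (u / h n)).+1%:R).
have mstep n : measurable_fun (`[0%R, +oo[%classic : set R) (step n).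
  exact: (measurable_grid_fun (fun j => c (h n * j.+1%:R)) (h0 n)).
have step_bound n u : 0 <= u -> 0 <= step n u <= K.
  by move=> u0; apply: ecap_path_bound; rewrite mulr_ge0// ltW.
have sumE n m : \int[lebesgue_measure]_(u in `[0, h n * m%:R[) step n u =
    h n * \sum_(j < m) c (h n * j.+1%:R).
  elim: m => [|m IH].
    by rewrite mulr0 set_itvco0 Rintegral_set0 big_ord0 mulr0.
  have hm : 0 <= h n * m%:R <= h n * m.+1%:R.
    by rewrite mulr_ge0 ?(ltW (h0 n))//= ler_pM2l// ler_nat.
  rewrite (Rintegral_itv_cat hm (mstep n) (step_bound n)) IH big_ord_recr /= mulrDr.
  congr (_ + _).
  transitivity (\int[lebesgue_measure]_(u in `[h n * m%:R, h n * m.+1%:R[) (c (h n * m.+1%:R))).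
    apply: eq_Rintegral => u; rewrite inE /= in_itv /= => /andP[u1 u2].
    rewrite /step (_ : Num.truncn _ = m)//; apply: truncn_def.
    by rewrite ler_pdivlMr// ltr_pdivrMr// ![_ * h n]mulrC u1 u2.
  rewrite Rintegral_cst; last exact: measurable_itv.
  rewrite lebesgue_itvco; last by case/andP: hm.
  by rewrite -mulrBr -natr1 addrAC subrr add0r mulr1 mulrC.
have shift n m : h n * \sum_(j < m) c (h n * j%:R) =
    h n * \sum_(j < m) c (h n * j.+1%:R) + h n * (c 0 - c (h n * m%:R)).
  rewrite -mulrDr; congr (_ * _).
  elim: m => [|m IH]; first by rewrite !big_ord0 mulr0 subrr addr0.
  by rewrite !big_ord_recr /= IH; ring.
have cint : \int[lebesgue_measure]_(u in `[0, t[) step n u @[n --> \oo] -->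
    \int[lebesgue_measure]_(u in `[0, t[) c u.
  have := @dominated_cvg _ _ _ lebesgue_measure (`[0, t[%classic : set R) (measurable_itv _)
    (fun n => EFin \o step n) (EFin \o c) (EFin \o (fun=> K)).
  move=> H; apply: fine_cvg; rewrite [X in _ --> X]fineK; last first.
    apply: integrable_fin_num; first exact: measurable_itv.
    apply: (@integrable_bounded_itv _ c K 0 t (lexx _) measurable_ecap_path).
    exact: ecap_path_bound.
  apply: H.
  - move=> n; apply/measurable_EFinP; apply: (measurable_funS _ _ (mstep n)) => //.
    by move=> u /=; rewrite !in_itv /= andbT => /andP[].
  - move=> u; rewrite /= in_itv /= => /andP[u0 _]; apply: cvg_EFin; first exact: nearW.
    apply: ecap_cvg => //; first by move=> n; rewrite y_ge0// mulr_ge0// ltW.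
      exact: y_ge0.
    exact: right_grid_seq.
  - by [].
  - by apply: (@integrable_bounded_itv _ (fun=> K) K 0 t) => // u _; rewrite K0 lexx.
  - move=> n u; rewrite /= in_itv /= => /andP[u0 _]; rewrite lee_fin.
    by have /andP[s0 s1] := step_bound n u u0; rewrite ger0_norm.
pose S n := h n * \sum_(j < k n) c (h n * j%:R).
pose I n := \int[lebesgue_measure]_(u in `[0, t[) step n u.
have -> : (fun n => h n * \sum_(j < k n) c (h n * j%:R)) = (fun n => I n + (S n - I n)).
  by apply/funext => n; rewrite [RHS]addrC subrK.
rewrite -[X in _ --> X]addr0; apply: cvgD => //.
apply: (@squeeze_cvgr _ _ _ _ (fun n => - (h n * K)) (fun n => K * (h n * (k n)%:R - t) + h n * K)).
- near=> n; have tn : t <= h n * (k n)%:R by near: n.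
  have t0n : 0 <= t <= h n * (k n)%:R by rewrite t0.
  rewrite /S /I shift -sumE (Rintegral_itv_cat t0n (mstep n) (step_bound n)).
  have := Rintegral_bounded_itv t0n (mstep n) (step_bound n).
  have /andP[] := ecap_path_bound (le_trans t0 tn).
  have /andP[] := ecap_path_bound (lexx 0).
  have := h0 n.
  set A := Rintegral _ _ _; set B := Rintegral _ _ _; move: A B => A B.
  move: (c 0) (c (h n * _)) => c1 c2 hn c10 c1K c20 c2K /andP[b1 b2].
  have h3 : - K <= c1 - c2 <= K by apply/andP; split; lra.
  have : - (h n * K) <= h n * (c1 - c2) <= h n * K.
    by rewrite -mulrN !ler_pM2l.
  by move=> /andP[h4 h5]; apply/andP; split; lra.
- by rewrite -[X in _ --> X]oppr0; apply: cvgN; rewrite -[X in _ --> X](mul0r K); apply: cvgMl.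
- rewrite [X in _ --> X](_ : _ = K * (t - t) + 0 * K); last by rewrite subrr mulr0 mul0r addr0.
  by apply: cvgD; [apply: cvgMr; apply: cvgB => //; exact: cvg_cst|exact: cvgMl].
Unshelve. all: by end_near. Qed.

End RightContinuousPath.

(** * Grid approximation of a random time *)

Section GridTime.
Context (R : realType).

Definition mesh (n : nat) : R := n.+1%:R^-1.
(** With mesh 1 / (n + 1) the grid reaches time n + 1, so that one index both refines the mesh and
    extends the horizon. *)
Definition steps (n : nat) : nat := (n.+1 * n.+1)%N.

(** The first grid index strictly after [tau], cut at the horizon. Below the horizon k < grid_time
    is then the event h k <= tau, whose complement tau < h k is known at time h k. *)
Definition grid_time (tau : \bar R) (n : nat) : nat :=
  if tau is t%:E then minn (steps n) (Num.truncn (t / mesh n)).+1 else steps n.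

Lemma mesh_gt0 n : 0 < mesh n.
Proof. by rewrite invr_gt0. Qed.

Lemma mesh_steps n : mesh n * (steps n)%:R = n.+1%:R.
Proof. by rewrite /mesh /steps natrM mulrA mulVf ?mul1r// pnatr_eq0. Qed.

Lemma mesh_cvg0 : mesh n @[n --> \oo] --> 0.
Proof. exact: cvg_harmonic. Qed.

Lemma grid_time_le tau n : (grid_time tau n <= steps n)%N.
Proof. by case: tau => //= t; rewrite geq_minl. Qed.

Lemma ltn_grid_time (tau : \bar R) n k : (0 <= tau)%E ->
  (k < grid_time tau n)%N = (k < steps n)%N && ((mesh n * k%:R)%:E <= tau)%E.
Proof.
case: tau => [t|_|//]; last by rewrite leey andbT.
rewrite lee_fin => t0; rewrite /= leq_min; congr (_ && _).
rewrite lee_fin ltnS truncn_ge_nat; last by rewrite divr_ge0// ltW// mesh_gt0.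
by rewrite ler_pdivlMr ?mesh_gt0// mulrC.
Qed.

Lemma grid_time_near (t : R) : 0 <= t ->
  \forall n \near \oo, t <= mesh n * (grid_time t%:E n)%:R <= t + mesh n.
Proof.
move=> t0; near=> n.
have tn : t <= n.+1%:R.
  by near: n; exists (Num.truncn t) => // m /= tm; rewrite ltW// -truncn_le_nat.
have /andP[h1 h2] := truncn_itv (divr_ge0 t0 (ltW (mesh_gt0 n))).
have h3 : t <= mesh n * (Num.truncn (t / mesh n)).+1%:R <= t + mesh n.
  rewrite mulrC -ler_pdivrMr ?mesh_gt0// (ltW h2) /= -natr1 mulrDl mul1r lerD2r.
  by rewrite -ler_pdivlMr ?mesh_gt0.
rewrite /=; case: (leqP (steps n) (Num.truncn (t / mesh n)).+1) => h4; last exact: h3.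
rewrite mesh_steps tn /=; case/andP: h3 => _; apply: le_trans.
by rewrite -mesh_steps ler_pM2l ?mesh_gt0// ler_nat.
Unshelve. all: by end_near. Qed.

Lemma grid_time_cvg (t : R) : 0 <= t -> mesh n * (grid_time t%:E n)%:R @[n --> \oo] --> t.
Proof.
move=> t0; apply: (@squeeze_cvgr _ _ _ _ (fun=> t) (fun n => t + mesh n)).
- exact: grid_time_near.
- exact: cvg_cst.
- by rewrite -[X in _ --> X]addr0; apply: cvgD => //; [exact: cvg_cst|exact: mesh_cvg0].
Qed.

End GridTime.

Section StoppedLimit.
Context (R : realType) d (T : measurableType d).
Variables (Pr : \bar R -> probability T R) (X : R -> T -> \bar R).
Hypothesis hF : cadlag_feller_process Pr X.
Variables (lambda mu : R).
Hypotheses (hlambda : 0 < lambda) (hmu : 0 <= mu).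

Let X0 t w : 0 <= t -> (0 <= X t w)%E.
Proof. by move=> t0; exact: (cfp_ge0 hF). Qed.

Let Xrc w t : 0 <= t -> X u w @[u --> t^'+] --> X t w.
Proof. exact: (cfp_cadlag hF w).1. Qed.

(** The strict form tau < t suits first passages below a level, for which tau <= t would look at the
    path just after t. *)
Definition optional_time (tau : T -> \bar R) :=
  (forall w, (0 <= tau w)%E) /\
  forall t : R, 0 <= t -> natural_filtration X t [set w | (tau w < t%:E)%E].

Definition discount (K : R) (tau : T -> \bar R) (w : T) : R :=
  if tau w is t%:E then
    expR (- (lambda * t + mu * \int[lebesgue_measure]_(u in `[0, t[) ecap K (X u w)))
  else 0.

(** For [tau = +oo] this is the state at time 0, which [discount] multiplies by 0. *)
Definition state (tau : T -> \bar R) (w : T) : \bar R := X (fine (tau w)) w.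

Definition continuous_on_half_line (g : \bar R -> R) :=
  bounded_on_half_line g /\ forall (F : nat -> \bar R) (l : \bar R),
    (forall n, (0 <= F n)%E) -> (0 <= l)%E -> F n @[n --> \oo] --> l -> g (F n) @[n --> \oo] --> g l.

Lemma lexp_continuous z : 0 < z -> continuous_on_half_line (lexp z).
Proof.
by move=> z0; split; [exact: lexp_bounded (ltW z0)|move=> F l; exact: lexp_cvg].
Qed.

Lemma ecap_continuous K : 0 <= K -> continuous_on_half_line (ecap K).
Proof. by move=> K0; split; [exact: ecap_bounded|move=> F l; exact: ecap_cvg]. Qed.

Lemma one_continuous : continuous_on_half_line (fun=> 1 : R).
Proof.
split; first by split; [exact: measurable_cst|exists 1 => y _; rewrite normr1].
by move=> *; exact: cvg_cst.
Qed.

Lemma continuous_on_half_line_comp (f : R -> R) g : continuous f ->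
  continuous_on_half_line g -> (exists C : R, forall y, (0 <= y)%E -> `|f (g y)| <= C) ->
  continuous_on_half_line (fun y => f (g y)).
Proof.
move=> cf [[mg bg] cg] bfg; split; first split => //.
  by apply: measurableT_comp => //; exact: continuous_measurable_fun.
by move=> F l F0 l0 Fl; apply: continuous_cvg; [exact: cf|exact: cg].
Qed.

Lemma optional_grid_stopping tau n : optional_time tau ->
  grid_stopping X (mesh R n) (steps n) (fun w => grid_time (tau w) n).
Proof.
move=> [tau0 tauF]; split => [w|k]; first exact: grid_time_le.
have hk : 0 <= mesh R n * k%:R by rewrite mulr_ge0// ltW// mesh_gt0.
case: (ltnP k (steps n)) => kn; last first.
  rewrite [X in natural_filtration _ _ X](_ : _ = set0); first exact: sigma_algebra0.
  by apply/seteqP; split => w //=; rewrite ltnNge (leq_trans (grid_time_le _ _) kn).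
rewrite [X in natural_filtration _ _ X](_ : _ = ~` [set w | (tau w < (mesh R n * k%:R)%:E)%E]).
  exact: (@measurableC _ (g_sigma_algebraType (generators X (mesh R n * k%:R))) _ (tauF _ hk)).
apply/seteqP; split => w /=; rewrite ltn_grid_time// kn /=.
  by move=> h; apply/negP; rewrite -leNgt.
by move=> /negP; rewrite -leNgt.
Qed.

Lemma stopped_cvg K tau g w : 0 <= K -> (0 <= tau w)%E -> continuous_on_half_line g ->
  stopped X lambda mu K (mesh R n) (fun w => grid_time (tau w) n) g w @[n --> \oo] -->
  discount K tau w * g (state tau w).
Proof.
move=> K0; rewrite /stopped /discount /state; case: (tau w) => [t|_|//].
  rewrite lee_fin => t0 [_ cg] /=; apply: cvgM.
    rewrite /grid_weight; apply: continuous_cvg; first exact: continuous_expR.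
    apply: cvgN; apply: cvgD.
      by apply: cvgMr; exact: grid_time_cvg.
    apply: cvgMr; apply: (@riemann_sum_cvg _ (fun u => X u w) _ _ K K0 (mesh R)) => //.
    - by move=> u u0; exact: X0.
    - by move=> u; exact: Xrc.
    - exact: mesh_gt0.
    - exact: mesh_cvg0.
    - by have := grid_time_near t0; apply: filterS => n /andP[].
    - exact: grid_time_cvg.
  apply: cg; first by move=> n; rewrite X0// mulr_ge0// ltW// mesh_gt0.
    exact: X0.
  apply: (right_continuous_seq (y := fun u => X u w)) => //.
  - by move=> u; exact: Xrc.
  - by have := grid_time_near t0; apply: filterS => n /andP[].
  - exact: grid_time_cvg.
(* When [tau] is infinite the grid stops at time n + 1, where the weight is at most exp (- lambda (n
   + 1)). *)
move=> [[_ [C gC]] _]; rewrite mul0r /=.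
have H n : `|grid_weight X lambda mu K (mesh R n) (steps n) w * g (X (mesh R n * (steps n)%:R) w)| <=
    C * expR (- (lambda * n.+1%:R)).
  rewrite normrM mulrC ler_pM// ?gC ?X0// ?mulr_ge0// ?(ltW (mesh_gt0 _ _))//.
  rewrite ger0_norm ?(ltW (grid_weight_gt0 _ _ _ _ _ _ _))//.
  by rewrite -(mesh_steps R n); apply: (grid_weight_le hF) => //; exact: mesh_gt0.
have C0 : C * expR (- (lambda * n.+1%:R)) @[n --> \oo] --> 0.
  rewrite -[X in _ --> X](mulr0 C); apply: cvgMr.
  have -> : (fun n : nat => expR (- (lambda * n.+1%:R))) =
      (fun n => expR (- lambda) * expR (- lambda) ^+ n).
    by apply/funext => n; rewrite -exprS -expRM_natl; congr expR; ring.
  rewrite -[X in _ --> X](mulr0 (expR (- lambda))); apply: cvgMr; apply: cvg_expr.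
  by rewrite ger0_norm ?expR_ge0// expR_lt1 oppr_lt0.
apply: (@squeeze_cvgr _ _ _ _ (fun n => - (C * expR (- (lambda * n.+1%:R))))
   (fun n => C * expR (- (lambda * n.+1%:R)))) => //.
  by apply: nearW => n; rewrite -ler_norml.
by rewrite -[X in _ --> X]oppr0; exact: cvgN.
Qed.

Lemma stopped_expectation_cvg x K tau g : 0 <= K -> optional_time tau ->
  continuous_on_half_line g ->
  bounded_mfun (fun w => discount K tau w * g (state tau w)) /\
  \int[Pr x%:E]_w stopped X lambda mu K (mesh R n) (fun w => grid_time (tau w) n) g w
    @[n --> \oo] --> \int[Pr x%:E]_w (discount K tau w * g (state tau w)).
Proof.
move=> K0 otau cg; have [C gC] := cg.1.2.
apply: (@bounded_convergence _ _ _ (Pr x%:E) _ _ C).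
- move=> n; apply: (bounded_mfun_stopped hF hlambda hmu K0 (mesh_gt0 R n) _ cg.1).1.
  exact: optional_grid_stopping.
- move=> n w; rewrite /stopped normrM -[leRHS]mul1r; apply: ler_pM => //.
    rewrite ger0_norm ?(ltW (grid_weight_gt0 _ _ _ _ _ _ _))//.
    exact: (grid_weight_le1 hF hlambda hmu K0 (mesh_gt0 R n)).
  by apply: gC; apply: X0; rewrite mulr_ge0// ltW// mesh_gt0.
- by move=> w; apply: stopped_cvg => //; exact: otau.1.
Qed.

End StoppedLimit.
Arguments one_continuous {R}.

(** * Passage times and absence of undershoot *)

Lemma is_derive_antiderivative (R : realType) (f : R -> R) (c z0 z1 : R) : c < z0 -> z0 <= z1 ->
  (forall z, c < z -> {for z, continuous f}) ->
  exists2 F : R -> R, (forall z, z0 <= z <= z1 -> is_derive z 1 F (f z)) &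
    F z1 - F z0 = \int[lebesgue_measure]_(z in `[z0, z1]) f z.
Proof.
move=> cz z01 cf; pose b := (c + z0) / 2.
have cb : c < b by rewrite /b; lra.
have bz : b < z0 by rewrite /b; lra.
have cf' (y z : R) : b <= z <= y -> {for z, continuous f}.
  by move=> /andP[h _]; apply: cf; exact: lt_le_trans h.
exists (fun y => \int[lebesgue_measure]_(t in `[b, y]) f t).
  move=> z /andP[h1 h2]; apply: (@is_derive_Rintegral _ f b (z1 + 1) z).
    by apply/andP; split; lra.
  exact: cf'.
have ib : lebesgue_measure.-integrable `[b, z1] (EFin \o f).
  by apply: integrable_continuous_itv => z; exact: cf'.
rewrite Rintegral_itvB ?bnd_simp ?(ltW bz)//.
apply: Rintegral_itv_obnd_cbnd.
have h : lebesgue_measure.-integrable `[z0, z1] (EFin \o f).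
  apply: integrable_continuous_itv => z /andP[h _]; apply: (@cf' z); rewrite lexx andbT; lra.
apply: (integrableS _ _ _ h); try exact: measurable_itv.
by move=> z /=; rewrite !in_itv /= => /andP[h1 h2]; rewrite ltW.
Qed.

Lemma expectation_eq0_ae d (T : measurableType d) (R : realType) (P : probability T R)
    (f : T -> R) : bounded_mfun f -> (forall w, 0 <= f w) -> \int[P]_w f w = 0 ->
  {ae P, forall w, f w = 0}.
Proof.
move=> bf f0 E.
have h : (\int[P]_w `|(f w)%:E| = 0)%E.
  have -> : (\int[P]_w `|(f w)%:E| = \int[P]_w (f w)%:E)%E.
    by apply: eq_integral => w _; rewrite gee0_abs// lee_fin.
  rewrite -[LHS]fineK; first by rewrite -/(Rintegral _ _ _) E.
  by apply: integrable_fin_num => //; exact: bounded_mfun_integrable.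
have mf : measurable_fun setT (EFin \o f) by apply/measurable_EFinP; exact: bf.1.
have := (ae_eq_integral_abs P measurableT mf).1 h.
by apply: filterS => w /(_ I) [].
Qed.

Section OccupationLastStep.
Context (R : realType) d (T : measurableType d).
Variables (Pr : \bar R -> probability T R) (X : R -> T -> \bar R).
Hypothesis hF : cadlag_feller_process Pr X.
Variables (x lambda mu : R).
Hypotheses (hlambda : 0 < lambda) (hmu : 0 <= mu).
Variables (K h : R) (N : nat) (kap : T -> nat).
Hypotheses (K0 : 0 <= K) (h0 : 0 < h) (hkap : grid_stopping X h N kap).

Let X0 t w : 0 <= t -> (0 <= X t w)%E.
Proof. by move=> t0; exact: (cfp_ge0 hF). Qed.

Lemma occupation_ge0 g : (forall y, (0 <= y)%E -> 0 <= g y) ->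
  0 <= occupation Pr X x lambda mu K h N kap g.
Proof.
move=> g0; apply: mulr_ge0; first exact: ltW.
apply: sumr_ge0 => k _; apply: Rintegral_ge0 => w _.
rewrite !mulr_ge0// ?expR_ge0// g0// X0// mulr_ge0//; exact: ltW.
Qed.

(* [k.+1 < kap] leaves out the last grid time before [kap], at which the passage
   may already have taken place. *)
Lemma occupation_norm_le_last g (C C' : R) : bounded_on_half_line g -> 0 <= C -> 0 <= C' ->
  (forall k w, (k.+1 < kap w)%N -> `|g (X (h * k%:R) w)| <= C) ->
  (forall y, (0 <= y)%E -> `|g y| <= C') ->
  `|occupation Pr X x lambda mu K h N kap g| <= C * (lambda^-1 + h) + C' * h.
Proof.
move=> bg C0 C'0 gC gC'; rewrite /occupation normrM (gtr0_norm h0).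
pose b k w : R := (k < kap w)%N%:R.
have bb k : bounded_mfun (b k) by exact: (bounded_mfun_running hF hkap).
pose e k : R := C * expR (- (lambda * (h * k%:R))).
(* The differences P(k < kap) - P(k + 1 < kap) telescope: the exceptional last step occurs at most
   once and costs [C' * h] in total. *)
have He k : `|\int[Pr x%:E]_w ((k < kap w)%N%:R * grid_weight X lambda mu K h k w * g (X (h *
  k%:R) w))| <=
    e k + C' * (\int[Pr x%:E]_w b k w - \int[Pr x%:E]_w b k.+1 w).
  rewrite -expectationB// -expectationZ; last exact: bounded_mfunB.
  rewrite -[e k](expectation_cst (Pr x%:E)) -expectationD; last 2 first.
  - exact: bounded_mfun_cst.
  - by apply: bounded_mfunM; [exact: bounded_mfun_cst|exact: bounded_mfunB].
  apply: expectation_norm_le.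
  - exact: (bounded_mfun_occupation hF hlambda hmu K0 h0 hkap).
  - apply: bounded_mfunD; first exact: bounded_mfun_cst.
    by apply: bounded_mfunM; [exact: bounded_mfun_cst|exact: bounded_mfunB].
  move=> w; have W0 := grid_weight_gt0 X lambda mu K h k w.
  have We := grid_weight_le hF lambda hmu K0 h0 k w.
  have W1 := grid_weight_le1 hF hlambda hmu K0 h0 k w.
  have hk : 0 <= h * k%:R by rewrite mulr_ge0// ltW.
  have e0 : 0 <= e k by rewrite mulr_ge0// expR_ge0.
  rewrite /b; case: (ltnP k (kap w)) => k1; last first.
    by rewrite !mul0r normr0 ltnNge ltnW ?ltnS //= subrr mulr0 addr0.
  rewrite mul1r normrM (gtr0_norm W0); case: (ltnP k.+1 (kap w)) => k2.
    rewrite subrr mulr0 addr0 /e mulrC; apply: ler_pM => //; [exact: ltW|exact: gC].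
  rewrite subr0 mulr1; apply: ler_wpDl => //.
  by rewrite -[leRHS]mul1r; apply: ler_pM => //; [exact: ltW|apply: gC'; exact: X0].
apply: (@le_trans _ _ (h * \sum_(k < N) (e k + C' * (\int[Pr x%:E]_w b k w - \int[Pr x%:E]_w b
  k.+1 w)))).
  rewrite ler_pM2l//; apply: (le_trans (ler_norm_sum _ _ _)); apply: ler_sum => k _; exact: He.
rewrite big_split /= mulrDr; apply: lerD.
  rewrite -mulr_sumr mulrCA ler_wpM2l//.
  exact: geometric_sum_le.
rewrite -mulr_sumr mulrCA ler_wpM2l// ler_piMr ?(ltW h0)//.
rewrite -(big_mkord xpredT (fun k => \int[Pr x%:E]_w b k w - \int[Pr x%:E]_w b k.+1 w)).
under eq_bigr do rewrite -opprB.
rewrite sumrN telescope_sumr// opprB lerBlDr ler_wpDr//.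
  by apply: Rintegral_ge0 => w _; rewrite ler0n.
apply: (le_trans (ler_norm _)); apply: expectation_bounded => // w.
by rewrite /b; case: (_ < _)%N; rewrite ?normr1 ?normr0.
Qed.

End OccupationLastStep.

Section PassageTime.
Context (R : realType) d (T : measurableType d).
Variables (Pr : \bar R -> probability T R) (X : R -> T -> \bar R).
Hypothesis hF : cadlag_feller_process Pr X.

Let X0 t w : 0 <= t -> (0 <= X t w)%E.
Proof. by move=> t0; exact: (cfp_ge0 hF). Qed.

Let Xrc w t : 0 <= t -> X u w @[u --> t^'+] --> X t w.
Proof. exact: (cfp_cadlag hF w).1. Qed.

(** The inequality is strict, so that by right-continuity a passage persists for a while and is seen
    at a rational time. *)
Definition passage_time (a : R) (w : T) : \bar R :=
  ereal_inf [set t%:E | t in [set t : R | 0 <= t /\ (X t w < a%:E)%E]].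

Lemma passage_time_ge0 a w : (0 <= passage_time a w)%E.
Proof. by apply: le_ereal_inf_tmp => _ [t [t0 _] <-]; rewrite lee_fin. Qed.

Lemma passage_time_le a (t : R) w : 0 <= t -> (X t w < a%:E)%E -> (passage_time a w <= t%:E)%E.
Proof. by move=> t0 Xt; apply: ge_ereal_inf; exists t%:E => //; exists t. Qed.

Lemma le_before_passage a (t : R) w : 0 <= t -> (t%:E < passage_time a w)%E -> (a%:E <= X t w)%E.
Proof.
move=> t0; rewrite ltNge => /negP h; rewrite leNgt; apply/negP => Xt; apply: h.
exact: passage_time_le.
Qed.

Lemma right_open (a t : R) w : 0 <= t -> (X t w < a%:E)%E ->
  exists2 e : R, 0 < e & forall u, t <= u < t + e -> (X u w < a%:E)%E.
Proof.
move=> t0 Xt; have nA : nbhs (X t w) [set y | (y < a%:E)%E].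
  by apply: open_nbhs_nbhs; split => //; exact: open_ereal_lt_ereal.
have := Xrc t0 nA; rewrite /= /at_right => /nbhs_ballP[e /= e0 He].
exists e => // u /andP[]; rewrite le_eqVlt => /predU1P[<-//|tu ue].
by apply: He => //=; rewrite /ball /= distrC gtr0_norm ?subr_gt0//; lra.
Qed.

Lemma passage_time_lt a (t : R) w : (passage_time a w < t%:E)%E ->
  exists2 s : R, 0 <= s < t & (X s w < a%:E)%E.
Proof. by move=> /ereal_inf_lt[_ [s [s0 Xs] <-]]; rewrite lte_fin => st; exists s => //;
  rewrite s0. Qed.

Lemma optional_passage_time a : optional_time X (passage_time a).
Proof.
split => [w|t t0]; first exact: passage_time_ge0.
rewrite [X in natural_filtration _ _ X](_ : _ = \bigcup_(r : rat)
  [set w | 0 <= (ratr r : R) < t /\ (X (ratr r) w < a%:E)%E]).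
  apply: (@bigcupT_measurable_rat _ (g_sigma_algebraType (generators X t))) => r.
  case: (boolP (0 <= (ratr r : R) < t)) => rt; last first.
    rewrite [X in measurable X](_ : _ = set0)//; by apply/seteqP; split => w // [].
  apply: sub_sigma_algebra; exists (ratr r), [set y | (y < a%:E)%E]; split.
  - by case/andP: rt => -> /ltW.
  - rewrite [X in measurable X](_ : _ = [set` `]-oo, a%:E[%O]); first exact: emeasurable_itv.
    by apply/seteqP; split => y /=; rewrite in_itv.
  - by apply/seteqP; split => w //= [].
apply/seteqP; split => w /=.
  move=> /passage_time_lt[s /andP[s0 st] Xs]; have [e e0 He] := right_open s0 Xs.
  have : s < Num.min (s + e) t by rewrite lt_min ltrDl e0.
  move=> /rat_in_itvoo[r]; rewrite in_itv /= lt_min => /and3P[h1 h2 h3].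
  by exists r => //; split; [rewrite h3 (le_trans s0 (ltW h1))|apply: He; rewrite ltW].
case=> r _ [/andP[r0 rt] Xr]; apply: (le_lt_trans (passage_time_le r0 Xr)).
by rewrite lte_fin.
Qed.

Lemma state_passage_le a w : (passage_time a w < +oo)%E ->
  (state X (passage_time a) w <= a%:E)%E.
Proof.
move=> tau_fin; have := passage_time_ge0 a w; rewrite /state.
case E : (passage_time a w) tau_fin => [t| |]//= _; rewrite lee_fin => t0.
rewrite leNgt; apply/negP => Xt.
have nA : nbhs (X t w) [set y | (a%:E < y)%E].
  by apply: open_nbhs_nbhs; split => //; exact: open_ereal_gt_ereal.
have := Xrc t0 nA; rewrite /= /at_right => /nbhs_ballP[e /= e0 He].
have : (passage_time a w < (t + e)%:E)%E by rewrite E lte_fin ltrDl.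
move=> /passage_time_lt[s /andP[s0 st] Xs].
have ts : t <= s by have := passage_time_le s0 Xs; rewrite E lee_fin.
move: ts; rewrite le_eqVlt => /predU1P[ts|ts].
  by move: Xs; rewrite -ts ltNge (ltW Xt).
have : (a%:E < X s w)%E by apply: He => //=; rewrite /ball /= distrC gtr0_norm ?subr_gt0//; lra.
by rewrite ltNge (ltW Xs).
Qed.

(** The hypothesis places h (k + 1) at or before the passage, hence h k strictly before it. *)
Lemma running_before_passage a n k w : (k.+1 < grid_time (passage_time a w) n)%N ->
  (a%:E <= X (mesh R n * k%:R) w)%E.
Proof.
rewrite ltn_grid_time; last exact: passage_time_ge0.
move=> /andP[_ h]; apply: le_before_passage; first by rewrite mulr_ge0// ltW// mesh_gt0.
by apply: lt_le_trans h; rewrite lte_fin ltr_pM2l ?mesh_gt0// ltr_nat.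
Qed.

End PassageTime.

Section NoUndershoot.
Context (R : realType) d (T : measurableType d).
Variables (Pr : \bar R -> probability T R) (X : R -> T -> \bar R).
Variables (psi phi : R -> R) (v : R -> R -> R).
Hypothesis hF : cadlag_feller_process Pr X.
Hypothesis hL : forall q x t : R, 0 < q -> 0 <= x -> 0 <= t ->
  (\int[Pr x%:E]_w expeR (- (q%:E * X t w)))%E =
  (expR (- (x * v t q) - \int[lebesgue_measure]_(s in `[0, t]) phi (v s q)))%:E.
Hypothesis psi_lip : forall a b : R, 0 < a -> exists2 c : R, 0 <= c &
  forall x y, a <= x <= b -> a <= y <= b -> `|psi x - psi y| <= c * `|x - y|.
Hypothesis phi_lip : forall a b : R, 0 < a -> exists2 c : R, 0 <= c &
  forall x y, a <= x <= b -> a <= y <= b -> `|phi x - phi y| <= c * `|x - y|.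
Hypothesis psi_quad : exists2 C : R, 0 <= C & forall z, 1 <= z -> `|psi z| <= C * z ^+ 2.
Hypothesis phi_ge0 : forall z : R, 0 <= z -> 0 <= phi z.
Hypothesis hv : cumulant_flow psi v.
Variables (x lambda a : R).
Hypotheses (hlambda : 0 < lambda) (a0 : 0 < a) (ax : a <= x).

Local Notation P := (Pr x%:E).
Local Notation tau := (passage_time X a).
Local Notation disc := (discount X lambda 0 0 tau).
Let x0 : 0 <= x. Proof. by rewrite (le_trans (ltW a0)). Qed.

Lemma mul_lexp_ge_le (z : R) (y : \bar R) : 0 < z -> (a%:E <= y)%E ->
  `|mul_lexp z y| <= expR (- (z * a)) * (a + z^-1).
Proof.
move=> z0; case: y => [y|_|//]; last first.
  by rewrite /mul_lexp mul0r normr0 mulr_ge0 ?expR_ge0// addr_ge0 ?(ltW a0)// invr_ge0 ltW.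
rewrite lee_fin => ay; have h := @mul_expRN_le R z (y - a) z0.
have h1 : expR (- (z * (y - a))) <= 1 by rewrite expR_le1 oppr_le0 mulr_ge0 ?subr_ge0// ltW.
have y0 : 0 <= y by apply: le_trans ay; exact: ltW.
rewrite /mul_lexp /= ger0_norm ?mulr_ge0 ?expR_ge0//.
have -> : y * expR (- (z * y)) =
   expR (- (z * a)) * (a * expR (- (z * (y - a))) + (y - a) * expR (- (z * (y - a)))).
  rewrite -mulrDl [a + _]addrC subrK mulrCA -expRD; congr (_ * expR _); ring.
by rewrite ler_wpM2l ?expR_ge0// lerD// -[leRHS]mulr1 ler_wpM2l// ltW.
Qed.

(** Before the passage the state is at least a, so the occupation of y exp (- z y) carries the
    factor exp (- z a); the terms in Phi and lambda have a favourable sign. Here mu and the cap are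
    0, so that time alone is discounted. *)
Lemma stopped_laplace_le (z : R) : 0 < z ->
  \int[P]_w (disc w * lexp z (state X tau w)) <=
  expR (- (z * x)) + `|psi z| * (expR (- (z * a)) * (a + z^-1) * lambda^-1).
Proof.
move=> z0; have [C [h0 [C0 h00 HD]]] :=
  grid_dynkin hF hL psi_lip phi_lip hv x0 hlambda (lexx 0) z z0.
have otau := optional_passage_time hF a.
have [_ cv] := stopped_expectation_cvg hF hlambda (lexx 0) x (lexx 0) otau (lexp_continuous z0).
pose B n : R := expR (- (z * a)) * (a + z^-1) * (lambda^-1 + mesh R n) + z^-1 * mesh R n.
apply: (ler_cvg_to cv (_ : expR (- (z * x)) + `|psi z| * B n + C * mesh R n @[n --> \oo] --> _)).
  rewrite [X in _ --> X](_ : _ = expR (- (z * x)) +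
     `|psi z| * (expR (- (z * a)) * (a + z^-1) * (lambda^-1 + 0) + z^-1 * 0) + C * 0); last by ring.
  apply: cvgD; last by apply: cvgMr; exact: mesh_cvg0.
  apply: cvgD; first exact: cvg_cst.
  apply: cvgMr; apply: cvgD; apply: cvgMr; last exact: mesh_cvg0.
  by apply: cvgD; [exact: cvg_cst|exact: mesh_cvg0].
near=> n; have hn : 0 < mesh R n <= h0.
  rewrite mesh_gt0 /=; near: n.
  by have := @mesh_cvg0 R => /cvgr_lt/(_ _ h00); apply: filterS => n /ltW.
have hn0 := mesh_gt0 R n.
have zz : z <= z <= z by rewrite lexx.
have hkap := optional_grid_stopping n otau.
have := HD 0 (mesh R n) (steps n) _ z (lexx 0) hn hkap zz.
rewrite generatorE; set H := \int[P]_w _.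
have bm := mul_lexp_bounded z0.
have bl := lexp_bounded (ltW z0).
have be := bounded_on_half_lineM bl (@ecap_bounded R 0 (lexx 0)).
have OD := occupationD hF x hlambda (lexx 0) (lexx 0) hn0 hkap.
have OZ := occupationZ hF x hlambda (lexx 0) (lexx 0) hn0 hkap.
rewrite OD; [|exact: bounded_on_half_lineZ|by apply: bounded_on_half_lineD; exact:
  bounded_on_half_lineZ].
rewrite OD; [|exact: bounded_on_half_lineZ|exact: bounded_on_half_lineZ].
rewrite !OZ// oppr0 mul0r add0r.
have g0 := @occupation_ge0 _ _ _ _ _ hF x lambda 0 0 _ (steps n) (fun w => grid_time (tau w) n)
  hn0 (lexp z) (fun y _ => lexp_ge0 z y).
have := occupation_norm_le_last hF x hlambda (lexx 0) (lexx 0) hn0 hkap bm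
  (C := expR (- (z * a)) * (a + z^-1)) (C' := z^-1).
set O1 := occupation _ _ _ _ _ _ _ _ _ (mul_lexp z).
set O2 := occupation _ _ _ _ _ _ _ _ _ (lexp z) in g0 *.
move=> HO; have O1B : `|O1| <= B n.
apply: HO.
- by rewrite mulr_ge0 ?expR_ge0// addr_ge0 ?(ltW a0)// invr_ge0 ltW.
- by rewrite invr_ge0 ltW.
- by move=> k w kw; apply: mul_lexp_ge_le => //; exact: (running_before_passage kw).
- by move=> y y0; have /andP[h1 h2] := mul_lexp_norm_le z0 y0; rewrite ger0_norm.
rewrite ler_norml => /andP[_].
have h1 : psi z * O1 <= `|psi z| * B n.
  by apply: (le_trans (ler_norm _)); rewrite normrM ler_wpM2l.
have h2 : 0 <= (phi z + lambda) * O2.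
  by rewrite mulr_ge0// addr_ge0 ?(ltW hlambda)// phi_ge0// ltW.
lra.
Unshelve. all: by end_near. Qed.

(** Taken from exp s = (exp (s / 3))^3. A power above the quadratic growth of Psi is required. *)
Lemma expR_ge_cube (s : R) : 0 <= s -> s ^+ 3 / 27 <= expR s.
Proof.
move=> s0; have h := expR_ge1Dx (s / 3).
have -> : expR s = expR (s / 3) ^+ 3 by rewrite -expRM_natl; congr expR; field.
have -> : s ^+ 3 / 27 = (s / 3) ^+ 3 by field.
by rewrite ler_pXn2r ?nnegrE ?expR_ge0// ?divr_ge0//; lra.
Qed.

(** At the passage X <= a. After multiplication by exp (z a), [stopped_laplace_le] bounds the
    discounted mean of exp (z (a - X)) by O(z^2), while this mean is at least z^3 / 27 times that of
    (a - X)^3. For z large the latter is forced to be 0. *)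
Lemma no_undershoot : {ae P, forall w, (tau w < +oo)%E -> state X tau w = a%:E}.
Proof.
have [C C0 psiC] := psi_quad.
have otau := optional_passage_time hF a.
pose g (y : \bar R) : R := (a - ecap a y) ^+ 3.
have g01 y : (0 <= y)%E -> 0 <= a - ecap a y <= a.
  by move=> y0; have := ecap_ge0 (ltW a0) y0; have := ecap_le a y => h1 h2; apply/andP; split; lra.
have cg : continuous_on_half_line g.
  apply: (@continuous_on_half_line_comp _ (fun r => (a - r) ^+ 3)).
  - move=> r; apply: (@continuous_comp _ _ _ (fun r => a - r) (fun r => r ^+ 3)).
      by apply: cvgB; [exact: cvg_cst|exact: cvg_id].
    exact: exprn_continuous.
  - exact: (ecap_continuous (ltW a0)).
  exists (a ^+ 3) => y y0; have /andP[h1 h2] := g01 y y0.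
  by rewrite ger0_norm ?exprn_ge0// ler_pXn2r ?nnegrE// ltW.
have [bg _] := stopped_expectation_cvg hF hlambda (lexx 0) x (lexx 0) otau cg.
have disc0 w : 0 <= disc w by rewrite /discount; case: (tau w) => // t; exact: expR_ge0.
have st0 w : (0 <= state X tau w)%E.
  rewrite /state; apply: (cfp_ge0 hF); exact: fine_ge0 (passage_time_ge0 X a w).
have f0 w : 0 <= disc w * g (state X tau w).
  by rewrite mulr_ge0// exprn_ge0//; have /andP[] := g01 _ (st0 w).
have E0 : \int[P]_w (disc w * g (state X tau w)) = 0.
  pose D : R := 27 * (1 + C * (a + 1) / lambda).
  have D0 : 0 < D.
    rewrite /D mulr_gt0// ltr_pwDl// mulr_ge0 ?invr_ge0 ?(ltW hlambda)// mulr_ge0//.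
    by rewrite addr_ge0// ltW.
  apply/eqP; rewrite eq_le Rintegral_ge0 ?andbT//; apply/ler_addgt0Pr => e e0; rewrite add0r.
  (* With J the discounted mean of the cube, the estimates give z J <= D, and this z satisfies D <=
     z e; hence J <= e. *)
  pose z : R := 1 + D / e.
  have z1 : 1 <= z by rewrite lerDl divr_ge0// ltW.
  have z0 : 0 < z by lra.
  have [blz _] := stopped_expectation_cvg hF hlambda (lexx 0) x (lexx 0) otau (lexp_continuous z0).
  have h1 := stopped_laplace_le z0.
  have h2 : z ^+ 3 / 27 * \int[P]_w (disc w * g (state X tau w)) <=
      expR (z * a) * \int[P]_w (disc w * lexp z (state X tau w)).
    rewrite -!expectationZ//; apply: expectation_le.
    - by apply: bounded_mfunM => //; exact: bounded_mfun_cst.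
    - by apply: bounded_mfunM => //; exact: bounded_mfun_cst.
    move=> w; rewrite !(mulrCA _ (disc w)).
    case E : (tau w) => [t| |].
    - apply: ler_wpM2l => //.
      have : (tau w < +oo)%E by rewrite E ltry.
      move=> /(state_passage_le hF); have := st0 w.
      case: (state X tau w) => [y| |]//; rewrite !lee_fin => y0 ya.
      rewrite /g /= (min_idPl ya) -expRD mulrAC -exprMn.
      have -> : z * a - z * y = z * (a - y) by ring.
      by apply: expR_ge_cube; rewrite mulr_ge0 ?subr_ge0// ltW.
    - by rewrite /discount E !mul0r.
    - by rewrite /discount E !mul0r.
  move: h1 h2 (Rintegral_ge0 P (fun w (_ : setT w) => f0 w)).
  move: (\int[P]_w (disc w * lexp z _)) (\int[P]_w (disc w * g _)) => I J h1 h2 J0.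
  have h3 : expR (z * a) * I <= 1 + C * z ^+ 2 * ((a + 1) / lambda).
    apply: (le_trans (ler_wpM2l (expR_ge0 _) h1)); rewrite mulrDr -expRD; apply: lerD.
      by rewrite expR_le1 -mulrBr mulr_ge0_le0 ?subr_le0// ltW.
    rewrite !mulrA [expR _ * `|_|]mulrC -(mulrA `|psi z|) expRxMexpNx_1 mulr1.
    rewrite -[leLHS]mulrA -[leRHS]mulrA; apply: ler_pM => //.
    - by rewrite divr_ge0 ?(ltW hlambda)// addr_ge0 ?invr_ge0 ?(ltW a0) ?(ltW z0).
    - by have := psiC z z1; rewrite expr2 mulrA.
    - by rewrite ler_wpM2r ?invr_ge0 ?(ltW hlambda)// lerD2l invf_le1.
  have zz : 1 <= z ^+ 2 by rewrite -[leLHS](expr1n _ 2) ler_pXn2r ?nnegrE//; lra.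
  have h4 : z ^+ 3 / 27 * J <= z ^+ 2 * (1 + C * (a + 1) / lambda).
    apply: (le_trans h2); apply: (le_trans h3); rewrite mulrDr mulr1 lerD//.
    by rewrite le_eqVlt; apply/orP; left; apply/eqP; ring.
  have h5 : z * J <= D.
    have z2 : 0 < z ^+ 2 by rewrite exprn_gt0.
    rewrite -(ler_pM2l z2) /D; move: h4.
    have -> : z ^+ 3 / 27 * J = z ^+ 2 * (z * J) / 27 by field.
    by rewrite ler_pdivrMr//; move=> h; apply: (le_trans h); rewrite le_eqVlt; apply/orP; left;
      apply/eqP; ring.
  rewrite -(ler_pM2l z0); apply: (le_trans h5); rewrite /z mulrDl divfK ?gt_eqF//; lra.
have := expectation_eq0_ae bg f0 E0; apply: filterS => w + tauw.
rewrite /discount; move: (state_passage_le hF tauw) (st0 w) (passage_time_ge0 X a w) (tauw).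
case: (tau w) => [t| |]//; case: (state X tau w) => [y| |]//.
rewrite !lee_fin => ya y0 t0 _ /eqP; rewrite mulf_eq0 gt_eqF ?expR_gt0//= /g /= (min_idPl ya).
by rewrite expf_eq0 /= subr_eq0 => /eqP <-.
Qed.

End NoUndershoot.

(** * Ratio identity at passage times *)

Section LaplaceInterpolation.
Context (R : realType).
Implicit Types (z s t : R).

(** By convexity (1 - exp (- z r)) / z does not increase with z, which compares the increments at z
    and z0 with factor z / z0. *)
Let expRN_sub_le z0 z z1 s t : 0 < z0 -> z0 <= z <= z1 -> 0 <= s <= t ->
  0 <= expR (- (z * s)) - expR (- (z * t)) <=
    z1 / z0 * (expR (- (z0 * s)) - expR (- (z0 * t))).
Proof.
move=> z00 /andP[z0z zz1] /andP[s0 st].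
have z_gt0 : 0 < z by exact: lt_le_trans z0z.
apply/andP; split; first by rewrite subr_ge0 ler_expR lerN2 ler_wpM2l// ltW.
have E (c : R) : expR (- (c * s)) - expR (- (c * t)) = expR (- (c * s)) * (1 - expR (- (c * (t - s)))).
  by rewrite mulrBr mulr1 -expRD; congr (_ - expR _); ring.
rewrite !E mulrCA.
have h1 : expR (- (z * s)) <= expR (- (z0 * s)) by rewrite ler_expR lerN2 ler_wpM2r.
have ts : 0 <= t - s by rewrite subr_ge0.
have z0z1 : 0 <= z0 / z <= 1 by rewrite divr_ge0 ?(ltW z00) ?(ltW z_gt0)//= ler_pdivrMr// mul1r.
have h2 := expR_convex (- (z * (t - s))) 0 z0z1.
have e0 : 0 <= 1 - expR (- (z * (t - s))).
  by rewrite subr_ge0 expR_le1 oppr_le0 mulr_ge0// ltW.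
apply: ler_pM => //.
apply: (@le_trans _ _ (z / z0 * (1 - expR (- (z0 * (t - s)))))); last first.
  rewrite ler_wpM2r// ?subr_ge0 ?expR_le1 ?oppr_le0 ?mulr_ge0 ?(ltW z00)//.
  by rewrite ler_pM2r// invr_gt0.
rewrite -ler_pdivrMl ?divr_gt0// invf_div; move: h2.
rewrite mulr0 addr0 expR0 mulr1.
have -> : z0 / z * - (z * (t - s)) = - (z0 * (t - s)) by field; rewrite gt_eqF.
lra.
Qed.

(** The exponent z0 alone controls all z in [z0, z1], so that convergence of the stopped state to a
    for a single test function yields an error uniform in z. *)
Lemma lexp_interpolation z0 z z1 a (y : \bar R) : 0 < z0 -> z0 <= z <= z1 -> 0 <= a -> (0 <= y)%E ->
  `|lexp z y - expR (- (z * a))| <= z1 / z0 * `|lexp z0 y - expR (- (z0 * a))|.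
Proof.
move=> z00 zz a0; have /andP[z0z zz1] := zz; case: y => [y|_|//] /=; last first.
  rewrite !sub0r !normrN !ger0_norm ?expR_ge0//.
  apply: (@le_trans _ _ (expR (- (z0 * a)))); first by rewrite ler_expR lerN2 ler_wpM2r.
  by rewrite ler_peMl ?expR_ge0// ler_pdivlMr// mul1r (le_trans z0z).
rewrite lee_fin => y0; case: (lerP y a) => ya.
  have /andP[h1 h2] := @expRN_sub_le z0 z z1 y a z00 zz (introT andP (conj y0 ya)).
  have /andP[h3 _] := @expRN_sub_le z0 z0 z1 y a z00 (introT andP (conj (lexx _) (le_trans z0z zz1)))
    (introT andP (conj y0 ya)).
  by rewrite !ger0_norm.
have /andP[h1 h2] := @expRN_sub_le z0 z z1 a y z00 zz (introT andP (conj a0 (ltW ya))).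
have /andP[h3 _] := @expRN_sub_le z0 z0 z1 a y z00 (introT andP (conj (lexx _) (le_trans z0z zz1)))
    (introT andP (conj a0 (ltW ya))).
by rewrite distrC [`|_ - expR (- (z0 * a))|]distrC !ger0_norm.
Qed.

(** State and capped state differ above K only, where half of the decay gives exp (- z0 K / 2). *)
Lemma mul_lexp_cap_le z0 z K (y : \bar R) : 0 < z0 -> z0 <= z -> 0 <= K -> (0 <= y)%E ->
  `|mul_lexp z y - lexp z y * ecap K y| <= (z0 / 2)^-1 * expR (- (z0 / 2 * K)).
Proof.
move=> z00 z0z K0; have z020 : 0 < z0 / 2 by rewrite divr_gt0.
have e0 : 0 <= (z0 / 2)^-1 * expR (- (z0 / 2 * K)) by rewrite mulr_ge0 ?expR_ge0 ?invr_ge0 ?(ltW z020).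
case: y => [y|_|//]; last by rewrite /mul_lexp /= !mul0r subrr normr0.
rewrite lee_fin => y0; rewrite /mul_lexp /=; case: (leP y K) => yK.
  by rewrite mulrC subrr normr0.
rewrite mulrC -mulrBr ger0_norm ?mulr_ge0 ?expR_ge0 ?subr_ge0 ?(ltW yK)//.
apply: (@le_trans _ _ (expR (- (z0 * y)) * y)).
  by apply: ler_pM; rewrite ?expR_ge0 ?subr_ge0 ?(ltW yK)// ?gerBl// ler_expR lerN2 ler_wpM2r.
have -> : expR (- (z0 * y)) * y = (y * expR (- (z0 / 2 * y))) * expR (- (z0 / 2 * y)).
  by rewrite -mulrA -expRD mulrC; congr (_ * expR _); field.
apply: ler_pM; rewrite ?expR_ge0 ?mulr_ge0 ?expR_ge0//; first exact: mul_expRN_le.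
by rewrite ler_expR lerN2 ler_wpM2l// ltW.
Qed.

End LaplaceInterpolation.

Section AreaDiscount.
Context (R : realType) d (T : measurableType d).
Variables (Pr : \bar R -> probability T R) (X : R -> T -> \bar R).
Hypothesis hF : cadlag_feller_process Pr X.
Variables (lambda mu : R).
Hypotheses (hlambda : 0 < lambda) (hmu : 0 <= mu).

Let X0 t w : 0 <= t -> (0 <= X t w)%E.
Proof. by move=> t0; exact: (cfp_ge0 hF). Qed.

Let Xrc w t : 0 <= t -> X u w @[u --> t^'+] --> X t w.
Proof. exact: (cfp_cadlag hF w).1. Qed.

Definition area_before (tau : \bar R) (w : T) : \bar R :=
  (\int[lebesgue_measure]_(t in [set t : R | (0 <= t)%R /\ (t%:E < tau)%E]) X t w)%E.

Definition area_discount (tau : \bar R) (w : T) : \bar R :=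
  expeR (- (lambda%:E * tau + mu%:E * area_before tau w)).

Lemma area_beforeE (t : R) w :
  area_before t%:E w = (\int[lebesgue_measure]_(u in `[0%R, t[) X u w)%E.
Proof.
congr (integral _ _ _); apply/seteqP; split => u /=; rewrite in_itv /= lte_fin.
  by case=> -> ->.
by move=> /andP[-> ->].
Qed.

Lemma area_before_ge0 tau w : (0 <= area_before tau w)%E.
Proof. by apply: integral_ge0 => t [t0 _]; exact: X0. Qed.

Lemma area_discounty w : area_discount +oo w = 0%E.
Proof.
have h := area_before_ge0 +oo w.
rewrite /area_discount gt0_muley ?lte_fin// addye//.
by rewrite gt_eqF// (lt_le_trans (ltNyr 0%R))// mule_ge0 ?lee_fin.
Qed.

(** The case mu = 0 is separate: 0 * +oo is 0 in the extended reals, so an infinite area leaves the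
    discount unchanged, whereas [lexp 0 +oo] is 0. *)
Lemma area_discountE (t : R) w : 0 <= t -> area_discount t%:E w =
  (expR (- (lambda * t)) * (if mu == 0 then 1 else lexp mu (area_before t%:E w)))%:E.
Proof.
move=> t0; have h := area_before_ge0 t%:E w; rewrite /area_discount.
have [mu0|mu0] := eqVneq mu 0; first by rewrite mu0 mul0e adde0 mulr1.
have mu1 : 0 < mu by rewrite lt_neqAle eq_sym mu0.
move: h; case: (area_before _ _) => [A| |]// _; last first.
  by rewrite gt0_muley ?lte_fin//= mulr0.
by rewrite -EFinM -EFinM -EFinD -EFinN /= opprD expRD.
Qed.

Lemma area_discount_bounds tau w : (0 <= tau)%E -> (0 <= area_discount tau w <= 1)%E.
Proof.
case: tau => [t|_|//]; last by rewrite area_discounty lexx lee_fin ler01.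
rewrite lee_fin => t0; rewrite area_discountE// !lee_fin.
have h := area_before_ge0 t%:E w.
have : 0 <= (if mu == 0 then 1 else lexp mu (area_before t%:E w)) <= 1.
  by case: ifP => _; [rewrite ler01 lexx|rewrite lexp_ge0 lexp_le1].
move=> /andP[h1 h2]; rewrite mulr_ge0 ?expR_ge0//=.
by apply: mulr_ile1 => //; rewrite ?expR_ge0// expR_le1 oppr_le0 mulr_ge0// ltW.
Qed.

Lemma capped_area_cvg (t : R) w : 0 <= t ->
  (\int[lebesgue_measure]_(u in `[0, t[) ecap j%:R (X u w))%:E @[j --> \oo] -->
  area_before t%:E w.
Proof.
move=> t0; rewrite area_beforeE.
have y_ge0 u : 0 <= u -> (0 <= X u w)%E := @X0 u w.
have y_rc u : 0 <= u -> X s w @[s --> u^'+] --> X u w by exact: Xrc.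
have mc (K : R) : measurable_fun (`[0%R, t[%classic : set R) (fun u => ecap K (X u w)).
  apply: (measurable_funS _ _ (measurable_ecap_path (y := fun u => X u w) y_rc K)) => //.
  by move=> u /=; rewrite !in_itv /= andbT => /andP[].
have E j : (\int[lebesgue_measure]_(u in `[0, t[) ecap j%:R (X u w))%:E =
    (\int[lebesgue_measure]_(u in `[0%R, t[) (ecap j%:R (X u w))%:E)%E.
  rewrite /Rintegral fineK//; apply: integrable_fin_num; first exact: measurable_itv.
  apply: (@integrable_bounded_itv _ (fun u => ecap j%:R (X u w)) j%:R 0 t (lexx _)).
    exact: (measurable_ecap_path (y := fun u => X u w) y_rc).
  by move=> u u0; exact: (ecap_path_bound (y := fun u => X u w)).
under eq_fun do rewrite E.
have Xlim u : 0 <= u -> (ecap j%:R (X u w))%:E @[j --> \oo] --> X u w.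
  move=> u0; move: (X0 w u0); case: (X u w) => [r|_|//] /=.
    rewrite lee_fin => r0; apply: cvg_near_cst; near=> j; congr (_%:E).
    by apply/min_idPl; near: j; exact: nbhs_infty_ger.
  apply/cvgeyPge => A; near=> j; rewrite lee_fin; near: j; exact: nbhs_infty_ger.
have -> : (\int[lebesgue_measure]_(u in `[0%R, t[) X u w =
   \int[lebesgue_measure]_(u in `[0%R, t[) limn (fun j => (ecap j%:R (X u w))%:E))%E.
  apply: eq_integral => u; rewrite inE /= in_itv /= => /andP[u0 _].
  by apply/esym/cvg_lim => //; exact: Xlim.
apply: cvg_monotone_convergence; first exact: measurable_itv.
- by move=> j; apply/measurable_EFinP; exact: mc.
- move=> j u /=; rewrite in_itv /= => /andP[u0 _]; rewrite lee_fin ecap_ge0//; exact: X0.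
- move=> u /=; rewrite in_itv /= => /andP[u0 _] m n mn; rewrite lee_fin.
  have : m%:R <= n%:R :> R by rewrite ler_nat.
  case: (X u w) => [r| |]//= h.
  by rewrite le_min ge_min lexx /= ge_min h orbT.
Unshelve. all: by end_near. Qed.

Lemma discount_area_cvg tau w : (0 <= tau w)%E ->
  discount X lambda mu j%:R tau w @[j --> \oo] --> fine (area_discount (tau w) w).
Proof.
rewrite /discount; case: (tau w) => [t|_|//]; last first.
  by rewrite area_discounty; exact: cvg_cst.
rewrite lee_fin => t0; rewrite area_discountE// [fine _]/=.
under eq_fun do rewrite opprD expRD.
apply: cvgM; first exact: cvg_cst.
case: ifP => [/eqP ->|mu0].
  by under eq_fun do rewrite mul0r oppr0 expR0; exact: cvg_cst.
have mu1 : 0 < mu by rewrite lt_neqAle eq_sym mu0.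
apply: (@lexp_cvg _ mu (fun j : nat =>
  (\int[lebesgue_measure]_(u in `[0, t[) ecap j%:R (X u w))%:E)) => //.
- move=> j; rewrite lee_fin; apply: Rintegral_ge0 => u /=; rewrite in_itv /= => /andP[u0 _].
  by apply: ecap_ge0 => //; exact: X0.
- exact: area_before_ge0.
- exact: capped_area_cvg.
Qed.

End AreaDiscount.

(** Limit of the bound of [capped_hitting_bound] as the mesh vanishes; [E] is the cap factor exp (-
    z0 K / 2), the only error left. *)
Lemma error_bound_cvg (R : realType) (eta m : nat -> R) (l A s D C mu k E w : R) :
  eta n @[n --> \oo] --> 0 -> m n @[n --> \oo] --> 0 ->
  (l + m n) * A + s * m n + D * (eta n + C * m n + mu * (k * E * (l + m n))) * w @[n --> \oo] -->
  l * A + D * (mu * (k * l)) * w * E.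
Proof.
move=> eta0 m0.
rewrite [X in _ --> X](_ : _ = (l + 0) * A + s * 0 + D * (0 + C * 0 + mu * (k * E * (l + 0))) *
  w); last by ring.
have cm : l + m n @[n --> \oo] --> l + 0 by apply: cvgD => //; exact: cvg_cst.
apply: cvgD; first by apply: cvgD; [exact: cvgMl|exact: cvgMr].
apply: cvgMl; apply: cvgMr; apply: cvgD; last by do 2!apply: cvgMr.
by apply: cvgD => //; exact: cvgMr.
Qed.

Section HittingIdentity.
Context (R : realType) d (T : measurableType d).
Variables (Pr : \bar R -> probability T R) (X : R -> T -> \bar R).
Variables (psi phi : R -> R) (v : R -> R -> R).
Hypothesis hF : cadlag_feller_process Pr X.
Hypothesis hL : forall q x t : R, 0 < q -> 0 <= x -> 0 <= t ->
  (\int[Pr x%:E]_w expeR (- (q%:E * X t w)))%E =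
  (expR (- (x * v t q) - \int[lebesgue_measure]_(s in `[0, t]) phi (v s q)))%:E.
Hypothesis psi0 : psi 0 = 0.
Hypothesis psi_convex : forall x y t : R, 0 <= x -> 0 <= y -> 0 <= t <= 1 ->
  psi (t * x + (1 - t) * y) <= t * psi x + (1 - t) * psi y.
Hypothesis psi_lip : forall a b : R, 0 < a -> exists2 c : R, 0 <= c &
  forall x y, a <= x <= b -> a <= y <= b -> `|psi x - psi y| <= c * `|x - y|.
Hypothesis phi_lip : forall a b : R, 0 < a -> exists2 c : R, 0 <= c &
  forall x y, a <= x <= b -> a <= y <= b -> `|phi x - phi y| <= c * `|x - y|.
Hypothesis psi_quad : exists2 C : R, 0 <= C & forall z, 1 <= z -> `|psi z| <= C * z ^+ 2.
Hypothesis phi_ge0 : forall z : R, 0 <= z -> 0 <= phi z.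
Hypothesis hpos : exists q : R, 0 <= q /\ 0 < psi q.
Hypothesis hv : cumulant_flow psi v.
Variables (lambda mu theta : R).
Hypotheses (hlambda : 0 < lambda) (hmu : 0 <= mu).
Local Notation q := (largest_root psi mu).
Hypothesis htheta : q < theta.
Variables (x a : R).
Hypotheses (a0 : 0 < a) (ax : a <= x).

Local Notation P := (Pr x%:E).
Local Notation tau := (passage_time X a).
Local Notation sc := (scale psi phi lambda mu theta).
Local Notation de := (density psi phi lambda mu theta).
Let x0 : 0 <= x. Proof. by rewrite (le_trans (ltW a0)). Qed.
Let otau := optional_passage_time hF a.
Definition capped_laplace (K : R) : R := \int[P]_w discount X lambda mu K tau w.

(** By the Dynkin identity, [scale] times the occupation of exp (- z X) has derivative [density]
    times exp (- x z) - L exp (- a z), up to a small error. Integration over [z0, z1] leaves the two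
    boundary occupations. The mesh tends to 0 with K fixed, so that only the cap error remains. *)
Lemma capped_hitting_bound (z0 z1 : R) : q < z0 -> z0 <= z1 -> exists M : R, forall K : R, 0 <= K ->
  `|\int[lebesgue_measure]_(z in `[z0, z1])
     (de z * (expR (- (x * z)) - capped_laplace K * expR (- (a * z))))| <=
  lambda^-1 * (sc z0 + sc z1 * expR (- (a * z1))) + M * expR (- (z0 / 2 * K)).
Proof.
move=> qz0 z01; have q0 := largest_root_ge0 psi0 psi_convex psi_lip hpos hmu.
have z00 : 0 < z0 by exact: le_lt_trans qz0.
have [D [D0 HD]] : exists D : R, 0 <= D /\ forall z, z0 <= z <= z1 -> `|de z| <= D.
  have cd : {within `[z0, z1], continuous (fun z => `|de z|)}.
    apply/continuous_in_subspaceT => z; rewrite inE /= in_itv /= => /andP[h _].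
    apply: (@continuous_comp _ _ _ de (fun r : R => `|r|)); last exact: norm_continuous.
    by apply: density_continuous => //; exact: lt_le_trans h.
  have [c cz Hc] := EVT_max z01 cd.
  exists `|de c|; split => // z hz; apply: Hc; by rewrite in_itv.
exists (D * (mu * ((z0 / 2)^-1 * lambda^-1)) * (z1 - z0)) => K K0.
set L := capped_laplace K.
have [C [h0 [C0 h00 Hdyn]]] := grid_dynkin hF hL psi_lip phi_lip hv x0 hlambda hmu z1 z00.
have cont z : q < z -> {for z, continuous (fun z => de z * (expR (- (x * z)) - L * expR (- (a * z))))}.
  move=> qz; have ce (c : R) : {for z, continuous (fun z => expR (- (c * z)))}.
    apply: continuous_comp; last exact: continuous_expR.
    by apply: cvgN; apply: cvgMr; exact: cvg_id.
  apply: cvgM; first exact: density_continuous.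
  by apply: cvgB; [exact: ce|apply: cvgMr; exact: ce].
have [F dF FE] := is_derive_antiderivative qz0 z01 cont.
rewrite -FE.
(* Distance from the stopped state to a, seen through the exponent z0; its limiting discounted mean
   is 0 by [no_undershoot]. *)
pose gd y : R := `|lexp z0 y - expR (- (z0 * a))|.
have cgd : continuous_on_half_line gd.
  apply: (@continuous_on_half_line_comp _ (fun r => `|r - expR (- (z0 * a))|)).
  - move=> r; apply: (@continuous_comp _ _ _ (fun r => r - expR (- (z0 * a))) (fun r : R => `|r|)).
      by apply: cvgB; [exact: cvg_id|exact: cvg_cst].
    exact: norm_continuous.
  - exact: lexp_continuous.
  exists (1 + 1) => y y0; rewrite normr_id; apply: (le_trans (ler_normB _ _)).
  rewrite lerD// ger0_norm ?lexp_ge0 ?expR_ge0//; first by apply: lexp_le1 => //; exact: ltW.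
  by rewrite expR_le1 oppr_le0 mulr_ge0// ltW.
have [bgd cvgd] := stopped_expectation_cvg hF hlambda hmu x K0 otau cgd.
have [b1 cv1] := stopped_expectation_cvg hF hlambda hmu x K0 otau one_continuous.
have Egd : \int[P]_w (discount X lambda mu K tau w * gd (state X tau w)) = 0.
  have ae := no_undershoot hF hL psi_lip phi_lip psi_quad phi_ge0 hv hlambda a0 ax.
  rewrite -[RHS](expectation_cst P) /Rintegral; congr fine; apply: ae_eq_integral => //.
    by apply/measurable_EFinP; exact: bgd.1.
  apply: filterS ae => w + _; rewrite /discount /=.
  case: (tau w) => [t /(_ (ltry _)) ->| |]; rewrite ?mul0r//.
  by rewrite /gd /= subrr normr0 mulr0.
have L1 : \int[P]_w (discount X lambda mu K tau w * 1) = L.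
  by apply: eq_Rintegral => w _; rewrite mulr1.
rewrite Egd in cvgd; rewrite L1 in cv1.
pose kap n w := grid_time (tau w) n.
pose S n g := \int[P]_w stopped X lambda mu K (mesh R n) (kap n) g w.
(* [eta] bounds, uniformly in z, the replacement of the stopped value by L exp (- a z). *)
pose eta n : R := z1 / z0 * S n gd + `|S n (fun=> 1) - L|.
have eta0 : eta n @[n --> \oo] --> 0.
  rewrite [X in _ --> X](_ : _ = z1 / z0 * 0 + `|L - L|); last by rewrite subrr normr0; ring.
  by apply: cvgD; [exact: cvgMr|apply: cvg_norm; apply: cvgB => //; exact: cvg_cst].
pose eK := (z0 / 2)^-1 * expR (- (z0 / 2 * K)).
have cvB := @error_bound_cvg _ eta (mesh R) lambda^-1 (sc z0 + sc z1 * expR (- (a * z1))) (sc z0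
  + sc z1)
  D C mu (z0 / 2)^-1 (expR (- (z0 / 2 * K))) (z1 - z0) eta0 (@mesh_cvg0 R).
apply: (ler_cvg_to (cvg_cst `|F z1 - F z0|) cvB).
near=> n; have hn : 0 < mesh R n <= h0.
  rewrite mesh_gt0 /=; near: n.
  by have := @mesh_cvg0 R => /cvgr_lt/(_ _ h00); apply: filterS => n /ltW.
have hn0 := mesh_gt0 R n.
have hkap : grid_stopping X (mesh R n) (steps n) (kap n) := optional_grid_stopping n otau.
pose O g := occupation Pr X x lambda mu K (mesh R n) (steps n) (kap n) g.
have OD f g : bounded_on_half_line f -> bounded_on_half_line g ->
    O (fun y => f y + g y) = O f + O g by exact: occupationD.
have OZ c g : bounded_on_half_line g -> O (fun y => c * g y) = c * O g by exact: occupationZ.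
have ON g := @occupation_norm_le_half_line _ _ _ _ _ hF x _ _ hlambda hmu _ _ _ _ K0 hn0 hkap g.
have ONL g := @occupation_norm_le_last _ _ _ _ _ hF x _ _ hlambda hmu _ _ _ _ K0 hn0 hkap g.
pose H z := S n (lexp z).
have bX g : bounded_on_half_line g -> bounded_mfun (stopped X lambda mu K (mesh R n) (kap n) g).
  exact: (bounded_mfun_stopped hF hlambda hmu K0 hn0 hkap).
have HL z : z0 <= z <= z1 -> `|H z - L * expR (- (a * z))| <= eta n.
  move=> hz; have z_gt0 : 0 < z by case/andP: hz => hz _; exact: lt_le_trans hz.
  have e1 : expR (- (a * z)) <= 1 by rewrite expR_le1 oppr_le0 mulr_ge0// ltW.
  have -> : H z - L * expR (- (a * z)) =
      (H z - expR (- (a * z)) * S n (fun=> 1)) + expR (- (a * z)) * (S n (fun=> 1) - L) by ring.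
  apply: (le_trans (ler_normD _ _)); apply: lerD; last first.
    by rewrite normrM ger0_norm ?expR_ge0// ler_piMl.
  have bz := bX _ (lexp_bounded (ltW z_gt0)); have b1' := bX _ (@one_continuous R).1; have bg' :=
    bX _ cgd.1.
  rewrite /H /S -!expectationZ// -expectationB//; last first.
    by apply: bounded_mfunM => //; exact: bounded_mfun_cst.
  apply: expectation_norm_le.
  - by apply: bounded_mfunB => //; apply: bounded_mfunM => //; exact: bounded_mfun_cst.
  - by apply: bounded_mfunM => //; exact: bounded_mfun_cst.
  move=> w; rewrite /stopped mulr1; set W := grid_weight _ _ _ _ _ _ _; set y := X _ w.
  have W0 : 0 < W by exact: grid_weight_gt0.
  have y0 : (0 <= y)%E by apply: (cfp_ge0 hF); rewrite mulr_ge0// ltW.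
  have -> : W * lexp z y - expR (- (a * z)) * W = W * (lexp z y - expR (- (z * a))).
    by rewrite [a * z]mulrC; ring.
  rewrite normrM (gtr0_norm W0) [leRHS]mulrCA ler_wpM2l ?(ltW W0)//.
  exact: lexp_interpolation (ltW a0) y0.
(* Defect of the differential equation in z, written with the uncapped area; [eK] accounts for the
   cap. *)
pose Bz z := - (psi z - mu) * O (mul_lexp z) + (phi z + lambda) * O (lexp z) - expR (- (x * z)) +
  L * expR (- (a * z)).
pose err := eta n + C * mesh R n + mu * (eK * (lambda^-1 + mesh R n)).
have Hbracket z : z0 <= z <= z1 -> `|Bz z| <= err.
  move=> hz; have /andP[z0z zz1] := hz; have z_gt0 : 0 < z by exact: lt_le_trans z0z.
  have := Hdyn K (mesh R n) (steps n) (kap n) z K0 hn hkap hz.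
  rewrite -/(S n (lexp z)) -/(H z) generatorE -/(O _).
  have bm := mul_lexp_bounded z_gt0; have bl := lexp_bounded (ltW z_gt0).
  have be := bounded_on_half_lineM bl (ecap_bounded K0).
  rewrite OD; [|exact: bounded_on_half_lineZ|by apply: bounded_on_half_lineD; exact:
    bounded_on_half_lineZ].
  rewrite OD; [|exact: bounded_on_half_lineZ|exact: bounded_on_half_lineZ].
  rewrite !OZ//.
  have hcap : `|O (mul_lexp z) - O (fun y => lexp z y * ecap K y)| <= eK * (lambda^-1 + mesh R n).
    have -> : O (mul_lexp z) - O (fun y => lexp z y * ecap K y) =
        O (fun y => mul_lexp z y + -1 * (lexp z y * ecap K y)).
      by rewrite OD ?OZ ?mulN1r//; exact: bounded_on_half_lineZ.
    apply: ON.
    - by apply: bounded_on_half_lineD => //; exact: bounded_on_half_lineZ.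
    - by rewrite mulr_ge0 ?expR_ge0// invr_ge0 divr_ge0// ltW.
    by move=> y y0; rewrite mulN1r; exact: mul_lexp_cap_le.
  have := HL z hz; rewrite /Bz [z * x]mulrC.
  have hmuc := ler_wpM2l hmu hcap; move: hmuc; rewrite -(ger0_norm hmu) -normrM (ger0_norm hmu).
  rewrite /err; move: (O (mul_lexp z)) (O (lexp z)) (O _) (H z) (expR (- (x * z))) (L * _) (psi
    z) (phi z)
    (eta n) (C * _) (mu * (eK * _)) => o1 o2 o3 Hz e1 e2 p f et c1 c2.
  rewrite !ler_norml => /andP[h1 h2] /andP[h3 h4] /andP[h5 h6].
  by apply/andP; split; lra.
(* Because [scale] is an integrating factor, the derivative of [Phi] is [density] times the
   defect. *)
pose Phi z := sc z * O (lexp z) - F z.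
have Hder z : z0 <= z <= z1 -> is_derive z 1 Phi (de z * Bz z).
  move=> hz; have /andP[z0z _] := hz; have z_gt0 : 0 < z by exact: lt_le_trans z0z.
  have qz : q < z by exact: lt_le_trans z0z.
  have ds := is_derive_scale lambda psi0 psi_convex psi_lip phi_lip hpos hmu htheta qz.
  have dO := is_derive_occupation hF x hlambda hmu K0 hn0 hkap z_gt0.
  have dM := is_deriveB (is_deriveM ds dO) (dF z hz).
  apply: (is_derive_eq dM); rewrite /GRing.scale /= -/(O _) -/(O _).
  have Es : sc z = de z * (psi z - mu).
    by rewrite /density divfK// subr_eq0 gt_eqF// (psi_gt_root psi0 psi_convex psi_lip hpos hmu).
  rewrite /Bz Es; ring.
have : `|Phi z1 - Phi z0| <= D * err * (z1 - z0).
  by apply: (is_derive_bounded z01 Hder) => z hz; rewrite normrM ler_pM// ?HD// Hbracket.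
rewrite /Phi.
(* States before the passage are at least a, whence exp (- a z1); the last grid step contributes the
   term in the mesh alone. *)
have O1 : `|O (lexp z1)| <= expR (- (a * z1)) * (lambda^-1 + mesh R n) + 1 * mesh R n.
  have z1_gt0 : 0 < z1 by exact: lt_le_trans z01.
  apply: ONL; [exact: lexp_bounded (ltW z1_gt0)|exact: expR_ge0|exact: ler01| |].
    move=> k w kw; have := running_before_passage kw.
    case: (X _ w) => [r| |]//=; last by rewrite normr0 expR_ge0.
    by rewrite lee_fin => ar; rewrite ger0_norm ?expR_ge0// ler_expR lerN2 mulrC ler_wpM2l// ltW.
  by move=> y y0; rewrite ger0_norm ?lexp_ge0// lexp_le1// ltW.
have O0 : `|O (lexp z0)| <= 1 * (lambda^-1 + mesh R n) + 1 * mesh R n.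
  apply: ONL; [exact: lexp_bounded (ltW z00)|exact: ler01|exact: ler01| |].
    by move=> k w kw; rewrite ger0_norm ?lexp_ge0// lexp_le1 ?(ltW z00)// (cfp_ge0 hF)// mulr_ge0// ltW.
  by move=> y y0; rewrite ger0_norm ?lexp_ge0// lexp_le1// ltW.
have s0 := scale_gt0 psi phi lambda mu theta z0.
have s1 := scale_gt0 psi phi lambda mu theta z1.
move: O1 O0 s0 s1; rewrite -/eK -/err.
move: (sc z0) (sc z1) (O (lexp z1)) (O (lexp z0)) (F z1) (F z0) (D * err * (z1 - z0)) (mesh R n)
  (expR (- (a * z1)))
  (lambda^-1) => s0 s1 o1 o0 f1 f0 E m e l O1 O0 s0_gt0 s1_gt0.
have h1 : `|s1 * o1| <= s1 * (e * (l + m) + 1 * m) by rewrite normrM (gtr0_norm s1_gt0) ler_pM2l.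
have h0' : `|s0 * o0| <= s0 * (1 * (l + m) + 1 * m) by rewrite normrM (gtr0_norm s0_gt0) ler_pM2l.
rewrite ler_norml => /andP[h5 h6]; rewrite ler_norml.
move: h1 h0'; rewrite !ler_norml => /andP[h1 h2] /andP[h3 h4].
by apply/andP; split; lra.
Unshelve. all: by end_near. Qed.

(** The cap is removed with z0 and z1 fixed, since its error is controlled on compact intervals
    only; the interval then exhausts ]q(mu), oo[. *)
Lemma hitting_integral_passage (c M : R) : 0 <= c < a -> 0 <= M ->
  (forall u, M <= u -> 0 < psi u - mu /\ phi u + lambda <= c * (psi u - mu)) ->
  bounded_mfun (fun w => fine (area_discount X lambda mu (tau w) w)) /\
  hitting_integral psi phi lambda mu theta x =
  ((\int[P]_w fine (area_discount X lambda mu (tau w) w))%:E *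
   hitting_integral psi phi lambda mu theta a)%E.
Proof.
move=> ca M0 ratio.
have disc1 (K : R) : 0 <= K -> bounded_mfun (discount X lambda mu K tau).
  move=> K0; have [b1 _] := stopped_expectation_cvg hF hlambda hmu x K0 otau one_continuous.
  by move: b1; under eq_fun do rewrite mulr1.
have [bL cL] : bounded_mfun (fun w => fine (area_discount X lambda mu (tau w) w)) /\
   capped_laplace j%:R @[j --> \oo] --> \int[P]_w fine (area_discount X lambda mu (tau w) w).
  apply: (@bounded_convergence _ _ _ P (fun j => discount X lambda mu j%:R tau) _ 1).
  - by move=> j; exact: (disc1 _ (ler0n _ _)).1.
  - move=> j w; rewrite /discount; case E : (tau w) => [t| |]; rewrite ?normr0//.
    rewrite ger0_norm ?expR_ge0// expR_le1 oppr_le0.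
    have t0 : 0 <= t by have := passage_time_ge0 X a w; rewrite E lee_fin.
    rewrite addr_ge0 ?(mulr_ge0 (ltW hlambda))// mulr_ge0//.
    apply: Rintegral_ge0 => u /=; rewrite in_itv /= => /andP[u0 _].
    by apply: ecap_ge0; [exact: ler0n|exact: (cfp_ge0 hF)].
  - by move=> w; apply: (discount_area_cvg hF) => //; exact: passage_time_ge0.
split=> //; set L := \int[P]_w _ in cL *.
apply: (hitting_integral_ratio (C := lambda^-1) _ _ _ _ _ _ _ _ _ ca M0 ratio) => //.
move=> z0 z1 qz0 z01; have [D HD] := capped_hitting_bound qz0 z01.
have q0 := largest_root_ge0 psi0 psi_convex psi_lip hpos hmu.
have z00 : 0 < z0 by exact: le_lt_trans qz0.
have ide (y : R) : lebesgue_measure.-integrable `[z0, z1] (EFin \o (fun z => de z * expR (- (y * z)))).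
  by apply: integrable_density_exp.
(* The integral is affine in [l], so that the limit of [capped_laplace] passes through it. *)
have E (l : R) : \int[lebesgue_measure]_(z in `[z0, z1]) (de z * (expR (- (x * z)) - l * expR (-
  (a * z)))) =
   \int[lebesgue_measure]_(z in `[z0, z1]) (de z * expR (- (x * z))) -
   l * \int[lebesgue_measure]_(z in `[z0, z1]) (de z * expR (- (a * z))).
  rewrite -RintegralZl; [|exact: measurable_itv|exact: ide].
  rewrite -RintegralB; [|exact: measurable_itv|exact: ide|]; last first.
    by apply: integrable_EFinZl; [exact: measurable_itv|exact: ide].
  by apply: eq_Rintegral => z _; ring.
have {}HD K (K0 : 0 <= K) := HD K K0.
have {}HD K K0 := eq_rect _ (fun r => `|r| <= _) (HD K K0) _ (E (capped_laplace K)).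
rewrite E; move: HD; set I1 := Rintegral _ _ _; set I2 := Rintegral _ _ _; move: I1 I2 => I1 I2.
move: (_ * (sc z0 + _)) => B HD.
have cvl : `|I1 - capped_laplace j%:R * I2| @[j --> \oo] --> `|I1 - L * I2|.
  by apply: cvg_norm; apply: cvgB; [exact: cvg_cst|exact: cvgMl].
have cvr : B + D * expR (- (z0 / 2 * j%:R)) @[j --> \oo] --> B.
  rewrite -[X in _ --> X]addr0; apply: cvgD; first exact: cvg_cst.
  rewrite -[X in _ --> X](mulr0 D); apply: cvgMr.
  have -> : (fun j : nat => expR (- (z0 / 2 * j%:R))) = (fun j => expR (- (z0 / 2)) ^+ j).
    by apply/funext => j; rewrite -expRM_natl; congr expR; ring.
  apply: cvg_expr; rewrite ger0_norm ?expR_ge0// expR_lt1 oppr_lt0 divr_gt0//.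
by apply: (ler_cvg_to cvl cvr); apply: nearW => j; apply: HD; exact: ler0n.
Qed.

End HittingIdentity.

Import HBNNSimple.

(** * First hitting time as a limit of passage times *)

(* Hitting times of a point are only known to agree off a null set with a
   measurable function. *)
Lemma ge0_ae_eq_integral d (T : measurableType d) (R : realType) (mu : {measure set T -> \bar R})
    (f g : T -> \bar R) : (forall x, (0 <= f x)%E) -> (forall x, (0 <= g x)%E) ->
  measurable_fun setT g -> {ae mu, forall x, f x = g x} ->
  (\int[mu]_x f x = \int[mu]_x g x)%E.
Proof.
move=> f0 g0 mg [N [mN N0 fgN]].
have fg x : ~ N x -> f x = g x by move=> Nx; apply: contrapT => h; apply: Nx; apply: fgN.
have drop (h : T -> \bar R) : measurable_fun setT h -> (forall x, (0 <= h x)%E) ->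
    (\int[mu]_x (h x * (\1_(~` N) x)%:E) = \int[mu]_x h x)%E.
  move=> mh h0; apply: ae_eq_integral => //.
    apply: emeasurable_funM => //; apply/measurable_EFinP.
    by apply: measurable_indic; exact: measurableC.
  exists N; split => // x /= hx; apply: contrapT => Nx; apply: hx => _.
  by rewrite indicE mem_set ?mule1.
have ind01 x : (\1_(~` N) x)%:E = 0%E :> \bar R \/ (\1_(~` N) x)%:E = 1%E :> \bar R /\ ~ N x.
  rewrite indicE; case: (boolP (x \in ~` N)) => [/set_mem|] h; [right|left] => //.
(* [f] may fail to be measurable: its integral is the supremum over the simple functions below it,
   each of which can be restricted to the complement of [N]. *)
apply/eqP; rewrite eq_le; apply/andP; split; rewrite (ge0_integralTE _ f0).
  apply: ge_ereal_sup => _ [h /= hf <-]; rewrite -integralT_nnsfun.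
  have h0 x : (0 <= (h x)%:E)%E by rewrite lee_fin.
  have mh : measurable_fun setT (fun x => (h x)%:E) by apply/measurable_EFinP.
  rewrite -(drop _ mh h0); apply: ge0_le_integral => //.
  - by move=> x _; rewrite mule_ge0 ?lee_fin.
  - apply: emeasurable_funM => //; apply/measurable_EFinP.
    by apply: measurable_indic; exact: measurableC.
  move=> x _; case: (ind01 x) => [->|[-> Nx]]; first by rewrite mule0.
  by rewrite mule1 -fg.
rewrite -(drop _ mg g0) ge0_integralTE; last by move=> x; rewrite mule_ge0 ?lee_fin.
apply: ge_ereal_sup => _ [h /= hf <-]; apply: ereal_sup_ubound; exists h => // x.
apply: (le_trans (hf x)); case: (ind01 x) => [->|[-> Nx]]; first by rewrite mule0.
by rewrite mule1 fg.
Qed.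

Section OptionalTimes.
Context (R : realType) d (T : measurableType d).
Variables (X : R -> T -> \bar R).

Lemma natural_filtration_le (s t : R) A : s <= t -> natural_filtration X s A ->
  natural_filtration X t A.
Proof.
move=> st; apply: sub_sigma_algebra2 => _ [u [B [/andP[u0 us] mB ->]]].
by exists u, B; rewrite u0 (le_trans us).
Qed.

(** If all times are below t, their supremum may still equal t; a common rational bound r < t
    restores the strict inequality. *)
Lemma optional_time_sup (tau_ : nat -> T -> \bar R) : (forall m, optional_time X (tau_ m)) ->
  optional_time X (fun w => ereal_sup (range (fun m => tau_ m w))).
Proof.
move=> H; split.
  move=> w; apply: (@le_trans _ _ (tau_ 0%N w)); first exact: (H 0%N).1.
  by apply: ereal_sup_ubound; exists 0%N.
move=> t t0; rewrite [X in natural_filtration _ _ X](_ : _ = \bigcup_(r : rat)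
  [set w | 0 <= (ratr r : R) < t /\ forall m, (tau_ m w < (ratr r)%:E)%E]).
  apply: (@bigcupT_measurable_rat _ (g_sigma_algebraType (generators X t))) => r.
  case: (boolP (0 <= (ratr r : R) < t)) => rt; last first.
    by rewrite [X in measurable X](_ : _ = set0)//; apply/seteqP; split => w // [].
  rewrite [X in measurable X](_ : _ = \bigcap_m [set w | (tau_ m w < (ratr r)%:E)%E]).
    apply: (@bigcapT_measurable _ (g_sigma_algebraType (generators X t))) => m.
    have /andP[r0 /ltW rt'] := rt.
    exact: (natural_filtration_le rt' ((H m).2 _ r0)).
  by apply/seteqP; split => w /=; [move=> [_ h] m _; exact: h|move=> h; split=> // m; exact: h].
apply/seteqP; split => w /=.
  set s := ereal_sup _ => st.
  have s0 : (0 <= s)%E.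
    by apply: (@le_trans _ _ (tau_ 0%N w)); [exact: (H 0%N).1|apply: ereal_sup_ubound; exists 0%N].
  move: s0 st; rewrite /s; case E : (ereal_sup _) => [r| |]//; rewrite lee_fin lte_fin => r0.
  move=> /rat_in_itvoo[p]; rewrite in_itv /= => /andP[rp pt].
  exists p => //; split; first by rewrite pt (le_trans r0 (ltW rp)).
  move=> m; apply: (@le_lt_trans _ _ r%:E); last by rewrite lte_fin.
  by rewrite -E; apply: ereal_sup_ubound; exists m.
case=> r _ [/andP[r0 rt] h]; apply: (@le_lt_trans _ _ (ratr r)%:E); last by rewrite lte_fin.
by apply: ge_ereal_sup => _ [m _ <-]; exact: ltW.
Qed.

End OptionalTimes.

Section QuasiLeftContinuity.
Context (R : realType) d (T : measurableType d).
Variables (Pr : \bar R -> probability T R) (X : R -> T -> \bar R).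
Variables (psi phi : R -> R) (v : R -> R -> R).
Hypothesis hF : cadlag_feller_process Pr X.
Hypothesis hL : forall q x t : R, 0 < q -> 0 <= x -> 0 <= t ->
  (\int[Pr x%:E]_w expeR (- (q%:E * X t w)))%E =
  (expR (- (x * v t q) - \int[lebesgue_measure]_(s in `[0, t]) phi (v s q)))%:E.
Hypothesis psi_lip : forall a b : R, 0 < a -> exists2 c : R, 0 <= c &
  forall x y, a <= x <= b -> a <= y <= b -> `|psi x - psi y| <= c * `|x - y|.
Hypothesis phi_lip : forall a b : R, 0 < a -> exists2 c : R, 0 <= c &
  forall x y, a <= x <= b -> a <= y <= b -> `|phi x - phi y| <= c * `|x - y|.
Hypothesis psi_quad : exists2 C : R, 0 <= C & forall z, 1 <= z -> `|psi z| <= C * z ^+ 2.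
Hypothesis phi_ge0 : forall z : R, 0 <= z -> 0 <= phi z.
Hypothesis hv : cumulant_flow psi v.
Variables (x lambda : R).
Hypotheses (x0 : 0 <= x) (hlambda : 0 < lambda).

Local Notation P := (Pr x%:E).
Local Notation disc := (discount X lambda 0 0).

Lemma discount0E tau w : disc tau w = if tau w is t%:E then expR (- (lambda * t)) else 0.
Proof. by rewrite /discount; case: (tau w) => // t; rewrite mul0r addr0. Qed.

Lemma discount0_ge0 tau w : 0 <= disc tau w.
Proof. by rewrite discount0E; case: (tau w) => // t; exact: expR_ge0. Qed.

Lemma expectation_discount_cvg tau : optional_time X tau -> bounded_mfun (disc tau) /\
  \int[P]_w stopped X lambda 0 0 (mesh R n) (fun w => grid_time (tau w) n) (fun=> 1) w
    @[n --> \oo] --> \int[P]_w disc tau w.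
Proof.
move=> ot; have := stopped_expectation_cvg hF hlambda (lexx 0) x (lexx 0) ot one_continuous.
by have -> : (fun w => disc tau w * 1) = disc tau by apply/funext => w; rewrite mulr1.
Qed.

(** For g = 1 the telescoping is exact, since each step multiplies the weight by exp (- lambda
    h). *)
Lemma occupation1 (h : R) N kap : 0 < h -> grid_stopping X h N kap ->
  (1 - expR (- (lambda * h))) * occupation Pr X x lambda 0 0 h N kap (fun=> 1) =
  h * (1 - \int[P]_w stopped X lambda 0 0 h kap (fun=> 1) w).
Proof.
move=> h0 hkap; rewrite (@stoppedE _ _ _ X lambda 0 0 h N kap _ hkap.1).
pose W := grid_weight X lambda 0 0 h.
have bW k : bounded_mfun (W k) by exact: (bounded_mfun_grid_weight hF hlambda (lexx 0) (lexx 0) h0).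
have bR k : bounded_mfun (fun w : T => (k < kap w)%N%:R : R) by exact: (bounded_mfun_running hF hkap).
pose D k w : R := (k < kap w)%N%:R * (W k.+1 w * 1 - W k w * 1).
have bD k : bounded_mfun (D k).
  apply: bounded_mfunM => //; apply: bounded_mfunB; apply: bounded_mfunM => //; exact: bounded_mfun_cst.
rewrite expectationD; [|exact: bounded_mfun_cst|exact: (@bounded_mfun_sum _ _ _ N D)].
rewrite expectation_cst (@expectation_sum _ _ _ P N D)// opprD addrA subrr add0r.
rewrite /occupation mulrCA; congr (_ * _); rewrite mulr_sumr -sumrN; apply: eq_bigr => k _.
rewrite -expectationZ; last first.
  by apply: bounded_mfunM; [exact: bounded_mfunM|exact: bounded_mfun_cst].
rewrite -[RHS]mulN1r -(@expectationZ _ _ _ P (-1) _ (bD k)); apply: eq_Rintegral => w _.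
by rewrite /D /W grid_weightS !mul0r addr0; ring.
Qed.

Lemma occupation_sub_le (h : R) N kap1 kap2 g (B : R) : 0 < h ->
  grid_stopping X h N kap1 -> grid_stopping X h N kap2 -> (forall w, (kap1 w <= kap2 w)%N) ->
  bounded_on_half_line g -> (forall y, (0 <= y)%E -> `|g y| <= B) ->
  `|occupation Pr X x lambda 0 0 h N kap2 g - occupation Pr X x lambda 0 0 h N kap1 g| <=
  B * (occupation Pr X x lambda 0 0 h N kap2 (fun=> 1) - occupation Pr X x lambda 0 0 h N kap1
    (fun=> 1)).
Proof.
move=> h0 hk1 hk2 k12 bg gB; rewrite /occupation -!mulrBr [leRHS]mulrCA normrM (gtr0_norm h0)
  ler_pM2l//.
rewrite -!sumrB mulr_sumr; apply: (le_trans (ler_norm_sum _ _ _)); apply: ler_sum => k _.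
have bo kap f : grid_stopping X h N kap -> bounded_on_half_line f ->
    bounded_mfun (fun w => (k < kap w)%N%:R * grid_weight X lambda 0 0 h k w * f (X (h * k%:R) w)).
  by move=> hk bf; exact: (bounded_mfun_occupation hF hlambda (lexx 0) (lexx 0) h0 hk).
have b1 := (@one_continuous R).1.
rewrite -expectationB; [|exact: bo|exact: bo].
rewrite -(@expectationB _ _ _ P _ _ (bo _ _ hk2 b1) (bo _ _ hk1 b1)) -expectationZ; last exact:
  bounded_mfunB (bo _ _ hk2 b1) (bo _ _ hk1 b1).
apply: expectation_norm_le.
- by apply: bounded_mfunB; exact: bo.
- apply: bounded_mfunM; first exact: bounded_mfun_cst.
  exact: (bounded_mfunB (bo _ _ hk2 b1) (bo _ _ hk1 b1)).
move=> w; rewrite !mulr1 -mulrBl -mulrBl normrM normrM.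
have W0 := grid_weight_gt0 X lambda 0 0 h k w; rewrite (gtr0_norm W0).
have i0 : 0 <= (k < kap2 w)%N%:R - (k < kap1 w)%N%:R :> R.
  rewrite subr_ge0 ler_nat; case: (ltnP k (kap1 w)) => // kk; by rewrite (leq_trans kk (k12 w)).
rewrite (ger0_norm i0) mulrC ler_wpM2r// ?mulr_ge0 ?(ltW W0)//.
by apply: gB; apply: (cfp_ge0 hF); rewrite mulr_ge0// ltW.
Qed.

(** By [occupation1], the discounted time spent between two ordered stopping rules is measured by
    the loss of discount; the factor comes from h <= (1 / lambda + h) (1 - exp (- lambda h)). *)
Lemma occupation1_sub_le (h : R) N kap1 kap2 : 0 < h ->
  grid_stopping X h N kap1 -> grid_stopping X h N kap2 -> (forall w, (kap1 w <= kap2 w)%N) ->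
  occupation Pr X x lambda 0 0 h N kap2 (fun=> 1) - occupation Pr X x lambda 0 0 h N kap1 (fun=> 1) <=
  (lambda^-1 + h) * (\int[P]_w stopped X lambda 0 0 h kap1 (fun=> 1) w -
                     \int[P]_w stopped X lambda 0 0 h kap2 (fun=> 1) w).
Proof.
move=> h0 hk1 hk2 k12.
have e1 := occupation1 h0 hk1; have e2 := occupation1 h0 hk2.
have d0 : 0 <= occupation Pr X x lambda 0 0 h N kap2 (fun=> 1) -
               occupation Pr X x lambda 0 0 h N kap1 (fun=> 1).
  have := occupation_sub_le h0 hk1 hk2 k12 (@one_continuous R).1 (B := 1).
  move=> H; have := normr_ge0 (occupation Pr X x lambda 0 0 h N kap2 (fun=> 1) -
               occupation Pr X x lambda 0 0 h N kap1 (fun=> 1)).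
  by move=> /le_trans -> //; rewrite -[leRHS]mul1r; apply: H => y _; rewrite normr1.
have q1 : lambda * h <= (1 + lambda * h) * (1 - expR (- (lambda * h))).
  have := expR_ge1Dx (lambda * h); have := expR_gt0 (lambda * h); rewrite expRN => p1 p2.
  have : (1 + lambda * h) / expR (lambda * h) <= 1 by rewrite ler_pdivrMr// mul1r.
  by rewrite mulrBr mulr1; lra.
move: e1 e2 d0; move: (occupation _ _ _ _ _ _ _ _ kap1 _) (occupation _ _ _ _ _ _ _ _ kap2 _) => o1 o2.
move: (Rintegral _ _ _) (Rintegral _ _ _) => w2 w1 e1 e2 d0.
have h1 : lambda * h * (o2 - o1) <= (1 + lambda * h) * (h * (w1 - w2)).
  have -> : h * (w1 - w2) = (1 - expR (- (lambda * h))) * (o2 - o1).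
    by rewrite [RHS]mulrBr e1 e2; ring.
  by rewrite mulrA ler_wpM2r.
rewrite -(@ler_pM2l _ (lambda * h)) ?mulr_gt0//; apply: (le_trans h1).
by rewrite le_eqVlt; apply/orP; left; apply/eqP; field; rewrite gt_eqF.
Qed.

(** The generator is bounded on [0, +oo], so by Dynkin the functional changes by at most this bound
    times the discounted time between [sigma] and [tau], hence times the loss of discount. C does
    not depend on the two times, which is what yields quasi-left-continuity. *)
Lemma optional_laplace_le (z : R) : 0 < z ->
  exists C : R, forall sigma tau : T -> \bar R, optional_time X sigma -> optional_time X tau ->
  (forall w, (sigma w <= tau w)%E) ->
  `|\int[P]_w (disc tau w * lexp z (state X tau w)) -
    \int[P]_w (disc sigma w * lexp z (state X sigma w))| <=
  C * (\int[P]_w disc sigma w - \int[P]_w disc tau w).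
Proof.
move=> z0; have bgen := generator_bounded psi phi lambda 0 (lexx (0 : R)) z0.
have [B gB] := bgen.2.
have [C [h0 [C0 h00 HD]]] := grid_dynkin hF hL psi_lip phi_lip hv x0 hlambda (lexx 0) z z0.
exists (B * lambda^-1) => sigma tau os ot st.
have [_ cs] := stopped_expectation_cvg hF hlambda (lexx 0) x (lexx 0) os (lexp_continuous z0).
have [_ ct] := stopped_expectation_cvg hF hlambda (lexx 0) x (lexx 0) ot (lexp_continuous z0).
have [_ ds] := expectation_discount_cvg os.
have [_ dt] := expectation_discount_cvg ot.
pose S n (tau : T -> \bar R) g := \int[P]_w stopped X lambda 0 0 (mesh R n) (fun w =>
  grid_time (tau w) n) g w.
have cl : `|S n tau (lexp z) - S n sigma (lexp z)| @[n --> \oo] -->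
    `|\int[P]_w (disc tau w * lexp z (state X tau w)) -
      \int[P]_w (disc sigma w * lexp z (state X sigma w))|.
  by apply: cvg_norm; exact: cvgB.
have cr : B * ((lambda^-1 + mesh R n) * (S n sigma (fun=> 1) - S n tau (fun=> 1))) +
    2 * C * mesh R n @[n --> \oo] --> B * lambda^-1 * (\int[P]_w disc sigma w - \int[P]_w disc tau w).
  have cm := @mesh_cvg0 R.
  rewrite [X in _ --> X](_ : _ = B * ((lambda^-1 + 0) * (\int[P]_w disc sigma w - \int[P]_w disc
    tau w)) +
    2 * C * 0); last by rewrite addr0 mulr0 addr0 mulrA.
  apply: cvgD; last exact: cvgMr.
  by apply: cvgMr; apply: cvgM; [apply: cvgD => //; exact: cvg_cst|exact: cvgB].
apply: (ler_cvg_to cl cr); near=> n; have hn : 0 < mesh R n <= h0.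
  rewrite mesh_gt0 /=; near: n.
  by have := @mesh_cvg0 R => /cvgr_lt/(_ _ h00); apply: filterS => n /ltW.
have hn0 := mesh_gt0 R n.
have zz : z <= z <= z by rewrite lexx.
have ks := optional_grid_stopping n os; have kt := optional_grid_stopping n ot.
have k12 w : (grid_time (sigma w) n <= grid_time (tau w) n)%N.
  rewrite leqNgt; apply/negP; rewrite ltn_grid_time; last exact: os.1.
  move=> /andP[k1 k2]; have := ltnn (grid_time (tau w) n).
  by rewrite ltn_grid_time ?k1 ?(le_trans k2)//; exact: ot.1.
have D1 := HD 0 (mesh R n) (steps n) _ z (lexx 0) hn ks zz.
have D2 := HD 0 (mesh R n) (steps n) _ z (lexx 0) hn kt zz.
have D3 := occupation_sub_le hn0 ks kt k12 bgen gB.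
have D4 := occupation1_sub_le hn0 ks kt k12.
have B0 : 0 <= B by exact: le_trans (normr_ge0 _) (gB 0%E (lexx _)).
have {D3 D4} D5 := le_trans D3 (ler_wpM2l B0 D4).
move: D1 D2 D5; rewrite -/(S n sigma (lexp z)) -/(S n tau (lexp z)) -/(S n sigma _) -/(S n tau _).
move: (occupation _ _ _ _ _ _ _ _ _ _) (occupation _ _ _ _ _ _ _ _ _ _) (S n sigma (lexp z))
  (S n tau (lexp z)) (B * _) => o1 o2 s1 s2 e.
by rewrite !ler_norml => /andP[h1 h2] /andP[h3 h4] /andP[h5 h6]; apply/andP; split; lra.
Unshelve. all: by end_near. Qed.

Variable a : R.
Hypotheses (a0 : 0 <= a) (ax : a < x).

(** The denominators start at 2, so that every level lies strictly between a and x. *)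
Definition level (m : nat) : R := a + (x - a) / m.+2%:R.

Lemma level_gt m : a < level m.
Proof. by rewrite ltrDl divr_gt0// subr_gt0. Qed.

Lemma level_le m : level m <= x.
Proof.
rewrite -lerBrDl ler_pdivrMr// ler_peMr ?subr_ge0 ?(ltW ax)//.
by rewrite ler1n.
Qed.

Lemma level_nincr : nonincreasing_seq level.
Proof.
move=> m n mn; rewrite lerD2l ler_pM2l ?subr_gt0// lef_pV2 ?posrE//.
by rewrite ler_nat !ltnS.
Qed.

Lemma level_cvg : level m @[m --> \oo] --> a.
Proof.
rewrite -[X in _ --> X]addr0; apply: cvgD; first exact: cvg_cst.
rewrite -[X in _ --> X](mulr0 (x - a)); apply: cvgMr.
apply: (@squeeze_cvgr _ _ _ _ (fun=> 0) (@harmonic R)).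
- apply: nearW => m; rewrite invr_ge0 ler0n /= lef_pV2 ?posrE ?ltr0n//.
  by rewrite ler_nat.
- exact: cvg_cst.
- exact: cvg_harmonic.
Qed.

(** Limit of the passage times as the levels decrease to a; almost surely it is the hitting time of
    a. *)
Definition first_time (w : T) : \bar R := ereal_sup (range (fun m => passage_time X (level m) w)).

Lemma passage_time_antitone b c w : b <= c -> (passage_time X c w <= passage_time X b w)%E.
Proof.
move=> bc; apply: le_ereal_inf_tmp => _ [t [t0 Xt] <-]; apply: passage_time_le => //.
by apply: lt_le_trans Xt _; rewrite lee_fin.
Qed.

Lemma passage_time_nondecreasing w : nondecreasing_seq (fun m => passage_time X (level m) w).
Proof. by move=> m n mn; apply: passage_time_antitone; exact: level_nincr. Qed.

Lemma passage_time_cvg w : passage_time X (level m) w @[m --> \oo] --> first_time w.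
Proof. exact: ereal_nondecreasing_cvgn (passage_time_nondecreasing w). Qed.

Lemma passage_le_first_time m w : (passage_time X (level m) w <= first_time w)%E.
Proof. by apply: ereal_sup_ubound; exists m. Qed.

Lemma first_time_ge0 w : (0 <= first_time w)%E.
Proof. exact: le_trans (passage_time_ge0 X (level 0) w) (passage_le_first_time 0 w). Qed.

Lemma optional_first_time : optional_time X first_time.
Proof. by apply: optional_time_sup => m; exact: optional_passage_time hF _. Qed.

(* Quasi-left-continuity at [first_time]: the states at the passage times below
   the levels, which are the levels themselves, converge to the state at
   [first_time]. *)
Lemma state_first_time : {ae P, forall w, (first_time w < +oo)%E -> state X first_time w = a%:E}.
Proof.
pose D m : R := \int[P]_w disc (passage_time X (level m)) w.
have op m : optional_time X (passage_time X (level m)) := optional_passage_time hF _.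
have of_ := optional_first_time.
have [bd cD] : bounded_mfun (disc first_time) /\ D m @[m --> \oo] --> \int[P]_w disc first_time w.
  apply: (@bounded_convergence _ _ _ P (fun m => disc (passage_time X (level m))) _ 1).
  - by move=> m; exact: (expectation_discount_cvg (op m)).1.1.
  - move=> m w; rewrite ger0_norm ?discount0_ge0// discount0E.
    have := passage_time_ge0 X (level m) w; case: (passage_time _ _ _) => // t t0.
    by rewrite expR_le1 oppr_le0 mulr_ge0// ltW.
  - move=> w; rewrite discount0E; under eq_fun do rewrite discount0E.
    apply: (@lexp_cvg _ lambda (fun m => passage_time X (level m) w)) => //.
    + by move=> m; exact: passage_time_ge0.
    + exact: first_time_ge0.
    + exact: passage_time_cvg.
set Dl := \int[P]_w disc first_time w in cD.
(* At the passage below [level m] the state is the level, so the functional is the discount times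
   exp (- z level); [optional_laplace_le] carries this to the limit in m. *)
have V z : 0 < z -> bounded_mfun (fun w => disc first_time w * lexp z (state X first_time w)) /\
    \int[P]_w (disc first_time w * lexp z (state X first_time w)) = expR (- (z * a)) * Dl.
  move=> z0; have [bz _] := stopped_expectation_cvg hF hlambda (lexx 0) x (lexx 0) of_
    (lexp_continuous z0).
  split=> //; set V := Rintegral _ _ _.
  have [C HC] := optional_laplace_le z0.
  have Em m : \int[P]_w (disc (passage_time X (level m)) w * lexp z (state X (passage_time X
    (level m)) w)) =
      expR (- (z * level m)) * D m.
    have [bm _] := stopped_expectation_cvg hF hlambda (lexx 0) x (lexx 0) (op m) (lexp_continuous z0).
    have [bdm _] := expectation_discount_cvg (op m).
    rewrite -expectationZ// /Rintegral; congr fine; apply: ae_eq_integral => //.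
    + by apply/measurable_EFinP; exact: bm.1.
    + by apply/measurable_EFinP; apply: measurable_funM => //; exact: bdm.1.
    + have := no_undershoot hF hL psi_lip phi_lip psi_quad phi_ge0 hv hlambda
        (le_lt_trans a0 (level_gt m)) (level_le m).
      apply: filterS => w hw _; rewrite discount0E; move: hw.
      case E : (passage_time X (level m) w) => [t| |]; rewrite ?mul0r ?mulr0// => /(_ (ltry _)) ->.
      by rewrite mulrC.
  have cE : expR (- (z * level m)) * D m @[m --> \oo] --> expR (- (z * a)) * Dl.
    apply: cvgM => //; apply: continuous_cvg; first exact: continuous_expR.
    by apply: cvgN; apply: cvgMr; exact: level_cvg.
  have cN : `|V - expR (- (z * level m)) * D m| @[m --> \oo] --> `|V - expR (- (z * a)) * Dl|.
    by apply: cvg_norm; apply: cvgB => //; exact: cvg_cst.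
  have c0 : C * (D m - Dl) @[m --> \oo] --> 0.
    rewrite -[X in _ --> X](mulr0 C) -[in X in _ --> X](subrr Dl); apply: cvgMr.
    by apply: cvgB => //; exact: cvg_cst.
  apply/eqP; rewrite -subr_eq0 -normr_le0.
  apply: (ler_cvg_to cN c0); apply: nearW => m; rewrite -Em.
  by apply: HC => // w; exact: passage_le_first_time.
(* The exponents 1 and 2 give the first two discounted moments of exp (- X). They are those of the
   constant exp (- a), so the discounted mean square deviation vanishes. *)
have [b1 V1] := V 1 ltr01.
have [b2 V2] := V 2 (ltr0Sn _ _).
pose ea := expR (- (1 * a)).
have ea2 : expR (- (2 * a)) = ea ^+ 2 by rewrite /ea -expRM_natl; congr expR; ring.
pose f w : R := disc first_time w * (lexp 1 (state X first_time w) - ea) ^+ 2.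
have fE : f = (fun w => disc first_time w * lexp 2 (state X first_time w) +
   (- 2 * ea * (disc first_time w * lexp 1 (state X first_time w)) + ea ^+ 2 * disc first_time w)).
  apply/funext => w; rewrite /f.
  have -> : lexp 2 (state X first_time w) = lexp 1 (state X first_time w) ^+ 2.
    by case: (state X first_time w) => [r| |] /=; rewrite ?expr0n//= -expRM_natl; congr expR; ring.
  by ring.
have b3 : bounded_mfun (fun w => - 2 * ea * (disc first_time w * lexp 1 (state X first_time w))).
  by apply: bounded_mfunM => //; exact: bounded_mfun_cst.
have b4 : bounded_mfun (fun w => ea ^+ 2 * disc first_time w).
  by apply: bounded_mfunM => //; exact: bounded_mfun_cst.
have bf : bounded_mfun f by rewrite fE; apply: bounded_mfunD => //; exact: bounded_mfunD.
have f0 w : 0 <= f w by rewrite mulr_ge0 ?sqr_ge0 ?discount0_ge0.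
have Ef : \int[P]_w f w = 0.
  rewrite fE expectationD//; last exact: bounded_mfunD.
  by rewrite expectationD// !expectationZ// V1 V2 ea2 -/ea -/Dl; ring.
have := expectation_eq0_ae bf f0 Ef; apply: filterS => w + fw.
rewrite /f discount0E; move: (first_time_ge0 w) (fw).
have : (0 <= state X first_time w)%E.
  by apply: (cfp_ge0 hF); exact: fine_ge0 (first_time_ge0 w).
case: (first_time w) => [t| |]//; case: (state X first_time w) => [y| |]// y0 t0 _ /eqP.
  rewrite mulf_eq0 gt_eqF ?expR_gt0//= expf_eq0 /= subr_eq0 => /eqP/expR_inj.
  by rewrite !mul1r => /oppr_inj ->.
by rewrite mulf_eq0 gt_eqF ?expR_gt0//= expf_eq0 /= subr_eq0 lt_eqF// expR_gt0.
Qed.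

End QuasiLeftContinuity.

Section AreaDiscountLimit.
Context (R : realType) d (T : measurableType d).
Variables (Pr : \bar R -> probability T R) (X : R -> T -> \bar R).
Hypothesis hF : cadlag_feller_process Pr X.
Variables (lambda mu : R).
Hypotheses (hlambda : 0 < lambda) (hmu : 0 <= mu).

Let X0 t w : 0 <= t -> (0 <= X t w)%E.
Proof. by move=> t0; exact: (cfp_ge0 hF). Qed.

Lemma area_discount_lexp (tau : \bar R) w : (0 <= tau)%E -> area_discount X lambda mu tau w =
  (lexp lambda tau * (if mu == 0 then 1 else lexp mu (area_before X tau w)))%:E.
Proof.
case: tau => [t|_|//]; last by rewrite (area_discounty hF)// mul0r.
by rewrite lee_fin => t0; rewrite (area_discountE hF).
Qed.

(** The time sets increase to that of the supremum, also when the supremum or the area is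
    infinite. *)
Lemma area_before_cvg (tau_ : nat -> \bar R) w : (forall m, (0 <= tau_ m)%E) ->
  nondecreasing_seq tau_ ->
  area_before X (tau_ m) w @[m --> \oo] --> area_before X (ereal_sup (range tau_)) w.
Proof.
move=> tau0 ndt; pose F m := [set t : R | (0 <= t)%R /\ (t%:E < tau_ m)%E].
have sub m : F m `<=` `[0%R, +oo[%classic by move=> t /= [t0 _]; rewrite in_itv /= t0.
rewrite /area_before (_ : [set t : R | 0 <= t /\ _] = \bigcup_m F m); last first.
  apply/seteqP; split => t /=.
    by move=> [t0 /ereal_sup_gt[_ [m _ <-] tm]]; exists m.
  move=> [m _ [t0 tm]]; split => //; apply: (lt_le_trans tm).
  by apply: ereal_sup_ubound; exists m.
apply: ge0_nondecreasing_set_cvg_integral.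
- move=> m n mn; apply/subsetPset => t [t0 tm]; split => //.
  by apply: lt_le_trans tm _; exact: ndt.
- move=> m; rewrite /F; move: (tau0 m); case: (tau_ m) => [t|_|//].
    rewrite lee_fin => t0; rewrite (_ : [set _ | _] = `[0, t[%classic); first exact: measurable_itv.
    apply/seteqP; split => u /=; rewrite in_itv /= lte_fin; first by case=> -> ->.
    by move=> /andP[-> ->].
  rewrite (_ : [set _ | _] = `[0, +oo[%classic); first exact: measurable_itv.
  apply/seteqP; split => u /=; rewrite in_itv /= andbT; first by case.
  by move=> u0; split => //; exact: ltry.
- move=> m; apply: (measurable_funS _ (@sub m)); first exact: measurable_itv.
  by apply: measurable_right_continuous => u; exact: (cfp_cadlag hF w).1.
- by move=> m t [t0 _]; exact: X0.
Qed.

Lemma area_discount_cvg (tau_ : nat -> \bar R) w : (forall m, (0 <= tau_ m)%E) ->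
  nondecreasing_seq tau_ ->
  fine (area_discount X lambda mu (tau_ m) w) @[m --> \oo] -->
  fine (area_discount X lambda mu (ereal_sup (range tau_)) w).
Proof.
move=> tau0 ndt.
have s0 : (0 <= ereal_sup (range tau_))%E.
  by apply: (le_trans (tau0 0%N)); apply: ereal_sup_ubound; exists 0%N.
rewrite area_discount_lexp//.
under eq_fun do rewrite area_discount_lexp//.
apply: cvgM; first by apply: lexp_cvg => //; exact: ereal_nondecreasing_cvgn.
case: ifPn => [_|mu0]; first exact: cvg_cst.
apply: lexp_cvg; [by rewrite lt_neqAle eq_sym mu0| | |exact: area_before_cvg].
- by move=> m; exact: (area_before_ge0 hF).
- exact: (area_before_ge0 hF).
Qed.

End AreaDiscountLimit.

(** Before the passage below [level m] the path is at or above that level, hence above a; so a is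
    not reached before [first_time], and by assumption it is reached then. *)
Lemma hitting_time_first_time (R : realType) d (T : measurableType d) (X : R -> T -> \bar R)
    (x a : R) (w : T) : a < x -> X 0 w = x%:E ->
  ((first_time X x a w < +oo)%E -> state X (first_time X x a) w = a%:E) ->
  hitting_time X a w = first_time X x a w.
Proof.
move=> ax X0x hst; apply/eqP; rewrite eq_le; apply/andP; split.
  have := first_time_ge0 X x a w; move: hst; rewrite /state.
  case: (first_time X x a w) => [t|_ _|//]; last exact: leey.
  (* [hitting_time] looks at t > 0 only; t = 0 is excluded because the path starts at x > a. *)
  move=> /(_ (ltry _)) /= Xt; rewrite lee_fin => t_ge0; have [t0|t0] := eqVneq t 0.
    by move: Xt; rewrite t0 X0x => -[xa]; move: ax; rewrite xa ltxx.
  have {}t0 : 0 < t by rewrite lt_neqAle eq_sym t0.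
  by apply: ge_ereal_inf; exists t%:E => //; exists t.
apply: le_ereal_inf_tmp => _ [t [t0 Xt] <-]; rewrite leNgt; apply/negP.
move=> /ereal_sup_gt[_ [m _ <-] tm].
have := le_before_passage (ltW t0) tm; rewrite Xt lee_fin leNgt.
by rewrite level_gt.
Qed.

(* In [\bar R], +oo^-1 = 0 and expeR -oo = 0. *)
Theorem theorem1 (R : realType)
    (gamma sigma b : R) (pi nu : {measure set R -> \bar R})
    (hsigma : 0 <= sigma) (hb : 0 <= b)
    (hpi : levy_measure 2 pi) (hnu : levy_measure 1 nu)
    (hnontrivial : sigma <> 0 \/ pi [set: R] <> 0%E \/ nu [set: R] <> 0%E)
    (hpos : exists q : R, 0 <= q /\ 0 < branching_mechanism gamma sigma pi q)
    (d : measure_display) (T : measurableType d)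
    (Pr : \bar R -> probability T R) (X : R -> T -> \bar R)
    (hX : CBI_process (branching_mechanism gamma sigma pi)
            (immigration_mechanism b nu) Pr X)
    (x a : R) (hxa : a < x)
    (hav : (b%:E / effective_drift gamma sigma pi <= a%:E)%E)
    (lambda mu : R) (hlambda : 0 < lambda) (hmu : 0 <= mu)
    (theta : R)
    (htheta : largest_root (branching_mechanism gamma sigma pi) mu < theta) :
  (\int[Pr x%:E]_w
     expeR (- (lambda%:E * hitting_time X a w
               + mu%:E * area_before_hitting X a w))
   = hitting_integral (branching_mechanism gamma sigma pi)
       (immigration_mechanism b nu) lambda mu theta x
     / hitting_integral (branching_mechanism gamma sigma pi)
         (immigration_mechanism b nu) lambda mu theta a)%E.
Proof.
have [hF [v hv hL]] := hX.
set psi := branching_mechanism gamma sigma pi in hpos hv hL htheta *.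
set phi := immigration_mechanism b nu in hL *.
have psi_lip (z0 z1 : R) : 0 < z0 -> exists2 c : R, 0 <= c &
    forall y z, z0 <= y <= z1 -> z0 <= z <= z1 -> `|psi y - psi z| <= c * `|y - z|.
  exact: branching_mechanism_lipschitz.
have phi_lip (z0 z1 : R) : 0 < z0 -> exists2 c : R, 0 <= c &
    forall y z, z0 <= y <= z1 -> z0 <= z <= z1 -> `|phi y - phi z| <= c * `|y - z|.
  move=> z00; have [c c0 Hc] := immigration_mechanism_lipschitz hnu hb z00.
  by exists c => // y z /andP[hy _] /andP[hz _]; exact: Hc.
have psi_quad := branching_mechanism_quadratic gamma sigma hpi.
have psi_convex := branching_mechanism_convex gamma sigma hpi.
have psi0 : psi 0 = 0 by exact: branching_mechanism0.
have phi_ge0 : forall z, 0 <= z -> 0 <= phi z by exact: immigration_mechanism_ge0.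
(* For y > a strictly, since at a = v the bound may fail at a itself. *)
have ratio (y : R) : a < y -> exists2 c : R, 0 <= c < y & exists2 M : R, 0 <= M &
    forall u, M <= u -> 0 < psi u - mu /\ phi u + lambda <= c * (psi u - mu).
  move=> ay; apply: (mechanism_ratio hpi hnu hb hpos (ltW hlambda) hmu).
  by apply: (le_lt_trans hav); rewrite lte_fin.
(* Every y > a exceeds some c >= 0. *)
have a0 : 0 <= a.
  apply/ler_addgt0Pr => e e0; have [|c /andP[c0 ce] _] := ratio (a + e).
    by rewrite ltrDl.
  by rewrite (le_trans c0)// ltW.
have x0 : 0 <= x by rewrite (le_trans a0)// ltW.
pose f y := hitting_integral psi phi lambda mu theta y.
pose tau m := passage_time X (level x a m).
pose L m := \int[Pr x%:E]_w fine (area_discount X lambda mu (tau m w) w).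
have HL m : bounded_mfun (fun w => fine (area_discount X lambda mu (tau m w) w)) /\
    f x = ((L m)%:E * f (level x a m))%E.
  have [c ca [M M0 HM]] := ratio _ (level_gt hxa m).
  apply: (hitting_integral_passage hF hL psi0 psi_convex psi_lip phi_lip psi_quad phi_ge0 hpos hv
    hlambda hmu htheta _ (level_le hxa m) ca M0 HM).
  by case/andP: ca => h1 h2; exact: le_lt_trans h2.
pose G w := fine (area_discount X lambda mu (first_time X x a w) w).
have disc_bounds w (s : \bar R) : (0 <= s)%E -> 0 <= fine (area_discount X lambda mu s w) <= 1.
  move=> s0; have /andP[h1 h2] := area_discount_bounds hF hlambda hmu w s0.
  have fd : area_discount X lambda mu s w \is a fin_num.
    by rewrite ge0_fin_numE// (le_lt_trans h2) ?ltry.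
  by rewrite -!lee_fin fineK// h1.
have [bG cL] : bounded_mfun G /\ L m @[m --> \oo] --> \int[Pr x%:E]_w G w.
  apply: (@bounded_convergence _ _ _ _ (fun m w => fine (area_discount X lambda mu (tau m w) w)) _ 1).
  - by move=> m; exact: (HL m).1.1.
  - by move=> m w; have /andP[h1 h2] := disc_bounds w _ (passage_time_ge0 X (level x a m) w);
    rewrite ger0_norm.
  - move=> w; apply: (area_discount_cvg hF hlambda hmu (tau_ := fun m => tau m w)).
      by move=> m; exact: passage_time_ge0.
    exact: passage_time_nondecreasing.
(* The hitting time is replaced by [first_time] on the almost sure event that the path starts at x
   and is at a at [first_time] when this is finite. *)
have -> : (\int[Pr x%:E]_w expeR (- (lambda%:E * hitting_time X a w + mu%:E * area_before_hitting
  X a w)) =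
    (\int[Pr x%:E]_w G w)%:E)%E.
  rewrite /Rintegral fineK; last first.
    by apply: integrable_fin_num => //; exact: bounded_mfun_integrable.
  apply: ge0_ae_eq_integral.
  - by move=> w; exact: expeR_ge0.
  - by move=> w; rewrite lee_fin; have /andP[] := disc_bounds w _ (first_time_ge0 X x a w).
  - by apply/measurable_EFinP; exact: bG.1.
  have ae1 := state_first_time hF hL psi_lip phi_lip psi_quad phi_ge0 hv x0 hlambda a0 hxa.
  have ae2 : {ae Pr x%:E, forall w, X 0 w = x%:E}.
    have mS : measurable (X 0 @^-1` [set x%:E]).
      rewrite -[X in measurable X]setTI; exact: (measurable_X hF (lexx 0)).
    exists (~` (X 0 @^-1` [set x%:E])); split => //; first exact: measurableC.
    rewrite [LHS]probability_setC// (markov_start (cfp_markov hF)) ?lee_fin//.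
    by rewrite subee.
  apply: filterS2 ae1 ae2 => w h1 h2.
  have E := hitting_time_first_time hxa h2 h1.
  have /andP[g0 g1] := area_discount_bounds hF hlambda hmu w (first_time_ge0 X x a w).
  by rewrite /G fineK ?ge0_fin_numE// ?(le_lt_trans g1) ?ltry// -E.
have f0 y : (0 < f y)%E.
  exact: (hitting_integral_gt0 lambda psi0 psi_convex psi_lip phi_lip hpos hmu htheta).
(* Finite because x > a >= v; the denominator [f a] may be infinite. *)
have fx : f x \is a fin_num.
  have [c ca [M M0 HM]] := ratio x hxa.
  rewrite ge0_fin_numE; last exact: ltW (f0 x).
  exact: (hitting_integral_lty psi0 psi_convex psi_lip phi_lip phi_ge0 hpos hlambda hmu htheta ca
    M0 HM).
have cf : f (level x a m) @[m --> \oo] --> f a.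
  apply: (hitting_integral_right_continuous psi0 psi_convex psi_lip phi_lip hpos hmu htheta).
    exact: level_nincr.
  exact: level_cvg.
have G0 : 0 <= \int[Pr x%:E]_w G w.
  by apply: Rintegral_ge0 => w _; have /andP[] := disc_bounds w _ (first_time_ge0 X x a w).
rewrite -/(f x) -/(f a); set l := Rintegral _ _ _ in cL G0 *.
(* The product of the limits is defined unless l = 0 and f a = +oo. *)
have key : (l%:E *? f a)%E -> f x = (l%:E * f a)%E.
  have cLE : (L m)%:E @[m --> \oo] --> l%:E by apply: cvg_EFin; [exact: nearW|exact: cL].
  move=> ldef; have cLf : ((L m)%:E * f (level x a m))%E @[m --> \oo] --> (l%:E * f a)%E.
    exact: cvgeM.
  rewrite -(cvg_lim _ cLf)//; apply/esym/cvg_lim => //.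
  by under eq_fun do rewrite -(HL _).2; exact: cvg_cst.
move: key (f0 a); case: (f a) => [r| |]//= key fa0.
  have r0 : r != 0 by move: fa0; rewrite lte_fin => /gt_eqF ->.
  rewrite key//.
  by rewrite inver (negPf r0) -!EFinM mulfK.
(* Here f a = +oo, so the claim is l = 0; otherwise [key] would make [f x] infinite. *)
rewrite invey mule0; congr (_%:E); apply/eqP; rewrite eq_sym; apply: contraT => l0.
have l_gt0 : 0 < l by rewrite lt_neqAle l0.
by move: fx; rewrite key ?gt0_muley ?lte_fin// eq_sym.
Qed.
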